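(* Let $H$ be a Hilbert space and let $Q\in\mathbb{B}(H)$ be a non-projection idempotent, with associated spaces $H_1,H_4,H_5$, unitary $V_Q:H\to H_1\oplus H_4\oplus H_5\oplus H_5$ and operator $D\in\mathbb{B}(H_5)$ as in the canonical decomposition of $Q$ described in the context. If $1\in\sigma(D)$, then $$C^*\{Q\}=\Big\{V_Q^*\Big(f_{11}(1)I_{H_1}\oplus 0_{H_4}\oplus f(D)\Big)V_Q:\ f=(f_{ij})_{1\le i,j\le 2}\in J_D\Big\},$$ where $$J_D=\Big\{(f_{ij})_{1\le i,j\le2}\in M_2\big(C(\sigma(D))\big):\ f_{12}(1)=f_{21}(1)=f_{22}(1)=0\Big\}$$ and $f(D)=\begin{pmatrix}f_{11}(D)&f_{12}(D)\\ f_{21}(D)&f_{22}(D)\end{pmatrix}\in\mathbb{B}(H_5\oplus H_5)$ is defined by continuous functional calculus.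
   Context: $H$ is a non-zero complex Hilbert space and $\mathbb{B}(H)$ the bounded operators on it. An idempotent satisfies $Q^2=Q$; a projection is a self-adjoint idempotent; a non-projection idempotent is an idempotent that is not a projection. $\mathcal{R},\mathcal{N}$ denote range and null space, $P_M$ the orthogonal projection onto a closed subspace $M$, $\sigma(\cdot)$ the spectrum, $C(\Omega)$ the complex-valued continuous functions on $\Omega$, $|T|=(T^*T)^{1/2}$, $T^\dag$ the Moore-Penrose inverse. $C^*\{Q\}$ is the $C^*$-algebra generated by $Q$ alone (not assumed to contain the identity). Matched projection: $m(Q)=\frac12(|Q^*|+Q^* )|Q^*|^\dag(|Q^*|+I)^{-1}(|Q^*|+Q)$, which is a projection. Canonical decomposition of a non-projection idempotent $Q$: put $H_1=\mathcal{R}(m(Q))\cap\mathcal{R}(Q)$, $H_4=\mathcal{N}(m(Q))\cap\mathcal{N}(Q)$, $H_5=\overline{\mathcal{R}(m(Q)Q(I-m(Q)))}$, $H_6=\overline{\mathcal{R}((I-m(Q))Qm(Q))}$ (some of $H_1,H_4$ may be zero). These are mutually orthogonal with $m(Q)=P_{H_1}+P_{H_5}$ and $I-m(Q)=P_{H_4}+P_{H_6}$, and $U_{m(Q),Q}:H\to H_1\oplus H_4\oplus H_5\oplus H_6$, $x\mapsto(P_{H_1}x,P_{H_4}x,P_{H_5}x,P_{H_6}x)^T$, is unitary. It is known that there are a unitary $U\in\mathbb{B}(H_5,H_6)$ and an operator $D\in\mathbb{B}(H_5)$ with $D\ge I_{H_5}$ and $\mathcal{N}(D-I_{H_5})=\{0\}$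 such that, with $\ell(D)=(D(D-I_{H_5}))^{1/2}$, $$U_{m(Q),Q}\,Q\,U_{m(Q),Q}^*=I_{H_1}\oplus 0_{H_4}\oplus\begin{pmatrix}D&-\ell(D)U^*\\ U\ell(D)&U(I_{H_5}-D)U^*\end{pmatrix}.$$ Set $V_Q=(I_{H_1}\oplus I_{H_4}\oplus I_{H_5}\oplus U^* )U_{m(Q),Q}$. Then $$m(Q)=V_Q^*\big(I_{H_1}\oplus0_{H_4}\oplus I_{H_5}\oplus0_{H_5}\big)V_Q,\qquad Q=V_Q^*\big(I_{H_1}\oplus0_{H_4}\oplus\widetilde{Q}\big)V_Q,\qquad \widetilde{Q}=\begin{pmatrix}D&-\ell(D)\\ \ell(D)&I_{H_5}-D\end{pmatrix}.$$ *)

(* Defs.v *)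
From HB Require Import structures.
From mathcomp Require Import all_boot all_order all_algebra.
From mathcomp Require Import boolp classical_sets functions reals topology normedtype.
From mathcomp Require Import complex.
From mathcomp Require Import ring lra.

Set Implicit Arguments.
Unset Strict Implicit.
Unset Printing Implicit Defensive.

Import Order.TTheory GRing.Theory Num.Theory.
Import numFieldNormedType.Exports.

Local Open Scope classical_set_scope.
Local Open Scope ring_scope.

HB.mixin Record NormedModule_isHilbert (R : realType) H
    & CompleteNormedModule R[i] H := {
  hdot : {dot H for @Num.conj R[i]} ;
  hdotE : forall x : H, hdot x x = `|x| ^+ 2
}.

#[short(type="hilbertType")]
HB.structure Definition Hilbert (R : realType) :=
  {H of CompleteNormedModule R[i] H & NormedModule_isHilbert R H}.

Section Subspace.
Variables (R : realType) (H : hilbertType R).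

Record closed_subspace := ClosedSubspace {
  cs_set :> set H ;
  cs_submod : submod_closed (mem cs_set) ;
  cs_closed : closed cs_set
}.

Variable M : closed_subspace.

Definition cs_pred : {pred H} := mem (cs_set M).

HB.instance Definition _ := GRing.isSubmodClosed.Build R[i] H cs_pred
  (GRing.submod_closed_semi (cs_submod M)).

Record csub := CSub { cs_val : H ; _ : cs_val \in cs_pred }.

HB.instance Definition _ := [isSub for cs_val].
HB.instance Definition _ := [Choice of csub by <:].
HB.instance Definition _ := [SubChoice_isSubLmodule of csub by <:].

Let cs_norm (x : csub) : R[i] := `|cs_val x|.

Let cs_normD x y : cs_norm (x + y) <= cs_norm x + cs_norm y.
Proof. exact: ler_normD. Qed.

Let cs_normZ (a : R[i]) x : cs_norm (a *: x) = `|a| * cs_norm x.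
Proof. by rewrite /cs_norm -normrZ. Qed.

Let cs_norm0 x : cs_norm x = 0 -> x = 0.
Proof. by move/normr0_eq0 => x0; apply/val_inj; rewrite /= x0. Qed.

HB.instance Definition _ :=
  @Lmodule_isNormed.Build R[i] csub cs_norm cs_normD cs_normZ cs_norm0.

Lemma cs_normE (x : csub) : `|x| = `|cs_val x|. Proof. by []. Qed.

Let cs_complete (F : set_system csub) : ProperFilter F -> cauchy F -> cvg F.
Proof.
move=> FF /cauchy_ballP Fc.
have : cvg (cs_val @ F).
  apply/cauchy_cvgP/cauchy_ballP => e e0.
  have := Fc e e0; rewrite /= !near_simpl.
  apply: filterS => -[x y] /=; rewrite -!ball_normE /= cs_normE => h.
  exact: h.
move=> /cvg_ex[l Fl].
have Ml : cs_set M l.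
  apply: closed_cvg (@cs_closed M) _ _ Fl.
  by apply: nearW => -[x Mx] /=; move: Mx; rewrite inE.
apply/cvg_ex; exists (CSub (mem_set Ml)); apply/cvgrPdist_lt => e e0.
by move/cvgrPdist_lt: Fl => /(_ e e0); apply: filterS.
Qed.

HB.instance Definition _ := Uniform_isComplete.Build csub cs_complete.

Definition cs_dot (x y : csub) : R[i] := hdot (cs_val x) (cs_val y).

Let cs_dot_bilinear : bilinear_for
  (GRing.Scale.Law.clone _ _ *%R _)
  (GRing.Scale.Law.clone _ _ (@Num.conj R[i] \; *%R) _) cs_dot.
Proof.
split=> [y|x] a u v; rewrite /cs_dot /=.
  by rewrite linearDl/= linearZl_LR.
by rewrite linearDr/= linearZr_LR.
Qed.

HB.instance Definition _ :=
  bilinear_isBilinear.Build _ _ _ _ _ _ cs_dot cs_dot_bilinear.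

Let cs_dot_herm x y : cs_dot x y = (-1) ^+ false * Num.conj (cs_dot y x).
Proof. exact: hermitian_subproof. Qed.

HB.instance Definition _ :=
  isHermitianSesquilinear.Build _ _ _ _ cs_dot cs_dot_herm.

Let cs_dot_gt0 x : x != 0 -> 0 < cs_dot x x.
Proof. by move=> x0; apply: neq0_dnorm_gt0. Qed.

HB.instance Definition _ := isDotProduct.Build _ _ cs_dot cs_dot_gt0.

Let cs_dotE (x : csub) : cs_dot x x = `|x| ^+ 2.
Proof. exact: hdotE. Qed.

HB.instance Definition _ := NormedModule_isHilbert.Build R csub cs_dotE.

End Subspace.

Lemma minkowski2 (C : numClosedFieldType) (a b c d : C) : 0 <= a -> 0 <= b -> 0 <= c -> 0 <= d ->
  sqrtC ((a + c) ^+ 2 + (b + d) ^+ 2) <=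
  sqrtC (a ^+ 2 + b ^+ 2) + sqrtC (c ^+ 2 + d ^+ 2).
Proof.
move=> a0 b0 c0 d0.
have pos (u v : C) : 0 <= u -> 0 <= v -> 0 <= u ^+ 2 + v ^+ 2.
  by move=> u0 v0; rewrite addr_ge0// exprn_ge0.
have ab := pos _ _ a0 b0; have cd := pos _ _ c0 d0.
have acbd := pos _ _ (addr_ge0 a0 c0) (addr_ge0 b0 d0).
rewrite -ler_sqr ?nnegrE ?addr_ge0 ?sqrtC_ge0//.
rewrite [leRHS]sqrrD !sqrtCK -subr_ge0.
set s := sqrtC _; set t := sqrtC _.
have st : a * c + b * d <= s * t.
  rewrite -ler_sqr ?nnegrE; last 2 first.
  - by rewrite addr_ge0// mulr_ge0.
  - by rewrite mulr_ge0// sqrtC_ge0.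
  rewrite exprMn /s /t !sqrtCK -subr_ge0.
  have -> : (a ^+ 2 + b ^+ 2) * (c ^+ 2 + d ^+ 2) - (a * c + b * d) ^+ 2
      = (a * d - b * c) ^+ 2 by ring.
  by rewrite -realEsqr rpredB// ger0_real// mulr_ge0.
have -> : a ^+ 2 + b ^+ 2 + s * t *+ 2 + (c ^+ 2 + d ^+ 2)
      - ((a + c) ^+ 2 + (b + d) ^+ 2) = (s * t - (a * c + b * d)) *+ 2 by ring.
by rewrite mulrn_wge0// subr_ge0.
Qed.

Section DirectSum.
Variables (R : realType) (H K : hilbertType R).

(* An alias, because the norm of the library on H * K is the max norm. *)
Definition hsum : Type := (H * K)%type.

HB.instance Definition _ := GRing.Lmodule.copy hsum (H * K)%type.

Let hs_norm (x : hsum) : R[i] := sqrtC (`|x.1| ^+ 2 + `|x.2| ^+ 2).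

Let hs_sq_ge0 (x : hsum) : 0 <= `|x.1| ^+ 2 + `|x.2| ^+ 2.
Proof. by rewrite addr_ge0// exprn_ge0. Qed.

Let hs_normD x y : hs_norm (x + y) <= hs_norm x + hs_norm y.
Proof.
apply: le_trans (minkowski2 _ _ _ _) => //.
rewrite ler_sqrtC ?nnegrE//; last by rewrite addr_ge0// exprn_ge0// addr_ge0.
by apply: lerD; rewrite ler_sqr ?nnegrE ?addr_ge0//; exact: ler_normD.
Qed.

Let hs_normZ (a : R[i]) x : hs_norm (a *: x) = `|a| * hs_norm x.
Proof.
rewrite /hs_norm /= !normrZ !exprMn -mulrDr sqrtCM ?nnegrE ?exprn_ge0//.
by rewrite sqrCK.
Qed.

Let hs_norm0 x : hs_norm x = 0 -> x = 0.
Proof.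
move=> /eqP; rewrite sqrtC_eq0 paddr_eq0 ?exprn_ge0// !expf_eq0 /= !normr_eq0.
by case: x => x y /= /andP[/eqP -> /eqP ->].
Qed.

HB.instance Definition _ :=
  @Lmodule_isNormed.Build R[i] hsum hs_norm hs_normD hs_normZ hs_norm0.

Lemma hs_normE (x : hsum) : `|x| = sqrtC (`|x.1| ^+ 2 + `|x.2| ^+ 2).
Proof. by []. Qed.

Lemma hs_norm1 (x : hsum) : `|x.1| <= `|x|.
Proof.
rewrite hs_normE -[leLHS]sqrCK// ler_sqrtC ?nnegrE ?exprn_ge0//.
by rewrite lerDl exprn_ge0.
Qed.

Lemma hs_norm2 (x : hsum) : `|x.2| <= `|x|.
Proof.
rewrite hs_normE -[leLHS]sqrCK// ler_sqrtC ?nnegrE ?exprn_ge0//.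
by rewrite lerDr exprn_ge0.
Qed.

Lemma hs_norm_le (x : hsum) : `|x| <= `|x.1| + `|x.2|.
Proof.
rewrite hs_normE -[leRHS]sqrCK ?addr_ge0//.
rewrite ler_sqrtC ?nnegrE ?exprn_ge0 ?addr_ge0 ?exprn_ge0//.
by rewrite sqrrD lerD2r lerDl mulrn_wge0// mulr_ge0.
Qed.

Let hs_complete (F : set_system hsum) : ProperFilter F -> cauchy F -> cvg F.
Proof.
move=> FF /cauchy_ballP Fc.
have : cvg ((fst : hsum -> H) @ F).
  apply/cauchy_cvgP/cauchy_ballP => e e0.
  have := Fc e e0; rewrite /= !near_simpl.
  apply: filterS => -[x y] /=; rewrite -!ball_normE /=.
  exact: le_lt_trans (hs_norm1 (x - y)).
move=> /cvg_ex[l Fl].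
have : cvg ((snd : hsum -> K) @ F).
  apply/cauchy_cvgP/cauchy_ballP => e e0.
  have := Fc e e0; rewrite /= !near_simpl.
  apply: filterS => -[x y] /=; rewrite -!ball_normE /=.
  exact: le_lt_trans (hs_norm2 (x - y)).
move=> /cvg_ex[m Fm].
apply/cvg_ex; exists (l, m); apply/cvgrPdist_lt => e e0.
have e20 : 0 < e / 2 by rewrite divr_gt0.
move/cvgrPdist_lt: Fl => /(_ _ e20); move/cvgrPdist_lt: Fm => /(_ _ e20).
apply: filterS2 => x x2 x1.
by rewrite (le_lt_trans (hs_norm_le _))//= [e]splitr ltrD.
Qed.

HB.instance Definition _ := Uniform_isComplete.Build hsum hs_complete.

Definition hs_dot (x y : hsum) : R[i] := hdot x.1 y.1 + hdot x.2 y.2.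

Let hs_dot_bilinear : bilinear_for
  (GRing.Scale.Law.clone _ _ *%R _)
  (GRing.Scale.Law.clone _ _ (@Num.conj R[i] \; *%R) _) hs_dot.
Proof.
split=> [y|x] a u v; rewrite /hs_dot /=.
  by rewrite !linearDl/= !linearZl_LR mulrDr addrACA.
by rewrite !linearDr/= !linearZr_LR/= mulrDr addrACA.
Qed.

HB.instance Definition _ :=
  bilinear_isBilinear.Build _ _ _ _ _ _ hs_dot hs_dot_bilinear.

Let hs_dot_herm x y : hs_dot x y = (-1) ^+ false * Num.conj (hs_dot y x).
Proof.
rewrite expr0 mul1r /hs_dot rmorphD.
by congr (_ + _); rewrite hermitian_subproof expr0 mul1r.
Qed.

HB.instance Definition _ :=
  isHermitianSesquilinear.Build _ _ _ _ hs_dot hs_dot_herm.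

Let hs_dotE (x : hsum) : hs_dot x x = `|x| ^+ 2.
Proof. by rewrite /hs_dot !hdotE hs_normE sqrtCK. Qed.

Let hs_dot_gt0 x : x != 0 -> 0 < hs_dot x x.
Proof. by move=> x0; rewrite hs_dotE exprn_gt0// normr_gt0. Qed.

HB.instance Definition _ := isDotProduct.Build _ _ hs_dot hs_dot_gt0.

HB.instance Definition _ := NormedModule_isHilbert.Build R hsum hs_dotE.

End DirectSum.

Section BoundedOperators.
Variables (R : realType) (H K : hilbertType R).

Definition bop_pred : {pred H -> K} :=
  mem [set f | linear f /\ exists M : R[i], forall x, `|f x| <= M * `|x|].

Record bop := Bop { bop_fun :> H -> K ; _ : bop_fun \in bop_pred }.

Lemma bopP (f : H -> K) : reflect
  (linear f /\ exists M : R[i], forall x, `|f x| <= M * `|x|) (f \in bop_pred).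
Proof. by apply: (iffP idP); rewrite inE. Qed.

Let bop_submod : submod_closed bop_pred.
Proof.
split=> [|a f g].
  apply/bopP; split=> [b x y|]; first by rewrite scaler0 addr0.
  by exists 0 => x; rewrite normr0 mul0r.
move=> /bopP[linf [M fM]] /bopP[ling [N gN]]; apply/bopP; split=> [b x y|].
  rewrite !fctE/= linf ling !scalerDr !scalerA mulrC.
  by rewrite addrACA.
exists (`|a| * M + N) => x.
rewrite mulrDl -mulrA (le_trans (ler_normD _ _))// lerD//.
by rewrite normrZ ler_wpM2l.
Qed.

HB.instance Definition _ := GRing.isSubmodClosed.Build R[i] (H -> K) bop_pred
  (GRing.submod_closed_semi bop_submod).
HB.instance Definition _ := [isSub for bop_fun].
HB.instance Definition _ := [Choice of bop by <:].
HB.instance Definition _ := [SubChoice_isSubLmodule of bop by <:].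

Lemma bop_linear (T : bop) : linear T.
Proof. by case: T => f /= /bopP[]. Qed.

HB.instance Definition _ (T : bop) :=
  GRing.isLinear.Build R[i] H K *:%R T (bop_linear T).

Definition opbounds (T : bop) : set R :=
  [set M | 0 <= M /\ forall x, `|T x| <= M%:C%C * `|x|].

Definition opnorm (T : bop) : R[i] := (inf (opbounds T))%:C%C.

Let opbounds_inf T : has_inf (opbounds T).
Proof.
case: T => f fP; have /bopP[_ [M fM]] := fP.
split; last by exists 0 => ? [].
have leM x : `|f x| <= `|M| * `|x|.
  have [x0|x0] := eqVneq x 0; first by have := fM x; rewrite x0 normr0 !mulr0.
  have xgt0 : 0 < `|x| by rewrite normr_gt0.
  by rewrite ger0_norm// -(pmulr_lge0 _ xgt0) (le_trans _ (fM x)).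
exists (complex.Re `|M|); split=> [|x].
  by rewrite -ler0c RRe_real ?normr_real.
by rewrite RRe_real ?normr_real//; exact: leM.
Qed.

Lemma opnorm_bound (T : bop) x : `|T x| <= opnorm T * `|x|.
Proof.
have [->|x0] := eqVneq x 0; first by rewrite raddf0 !normr0 mulr0.
have xgt0 : 0 < `|x| by rewrite normr_gt0.
have TxR : `|T x| / `|x| \is Num.real by rewrite ger0_real// divr_ge0.
rewrite -ler_pdivrMr// -[leLHS]RRe_real// lecR.
apply: lb_le_inf; first by case: (opbounds_inf T).
by move=> M [_ TM]; rewrite -lecR RRe_real// ler_pdivrMr//; exact: TM.
Qed.

Lemma opnorm_le (T : bop) (M : R) : 0 <= M ->
  (forall x, `|T x| <= M%:C%C * `|x|) -> opnorm T <= M%:C%C.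
Proof.
by move=> M0 TM; rewrite lecR; apply: ge_inf; [case: (opbounds_inf T)|split].
Qed.

Lemma opnorm_ge0 T : 0 <= opnorm T.
Proof.
by rewrite ler0c; apply: lb_le_inf; [case: (opbounds_inf T)|move=> M []].
Qed.

Let opnorm_le' (T : bop) (M : R[i]) : 0 <= M -> (forall x, `|T x| <= M * `|x|) ->
  opnorm T <= M.
Proof.
move=> M0 TM; rewrite -[leRHS]RRe_real ?ger0_real//; apply: opnorm_le => [|x].
  by rewrite -ler0c RRe_real ?ger0_real.
by rewrite RRe_real ?ger0_real.
Qed.

Let opnormD S T : opnorm (S + T) <= opnorm S + opnorm T.
Proof.
apply: opnorm_le' => [|x]; first by rewrite addr_ge0 ?opnorm_ge0.
by rewrite mulrDl (le_trans (ler_normD _ _))// lerD// opnorm_bound.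
Qed.

Let opnormZ_le (a : R[i]) T : opnorm (a *: T) <= `|a| * opnorm T.
Proof.
apply: opnorm_le' => [|x]; first by rewrite mulr_ge0 ?opnorm_ge0.
by rewrite -mulrA normrZ ler_wpM2l// opnorm_bound.
Qed.

Let opnormZ (a : R[i]) T : opnorm (a *: T) = `|a| * opnorm T.
Proof.
apply/le_anti; rewrite opnormZ_le/=.
have [->|a0] := eqVneq a 0; first by rewrite normr0 mul0r opnorm_ge0.
rewrite -ler_pdivlMl ?normr_gt0// -normfV.
by rewrite -[in leLHS](scalerK a0 T) opnormZ_le.
Qed.

Let opnorm0 T : opnorm T = 0 -> T = 0.
Proof.
move=> T0; apply/val_inj/funext => x; apply/normr0_eq0/le_anti.
by rewrite normr_ge0 andbT (le_trans (opnorm_bound _ _))// T0 mul0r.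
Qed.

HB.instance Definition _ :=
  @Lmodule_isNormed.Build R[i] bop opnorm opnormD opnormZ opnorm0.

End BoundedOperators.

Notation "''B' ( H , K )" := (bop H K) (format "''B' ( H ,  K )") : type_scope.
Notation "''B' ( H )" := (bop H H) (format "''B' ( H )") : type_scope.

Section OperatorConstructions.
Variable R : realType.
Implicit Types H K L : hilbertType R.

Let bopP' H K (T : 'B(H, K)) : exists M : R[i], forall x, `|T x| <= M * `|x|.
Proof. by exists (opnorm T); exact: opnorm_bound. Qed.

Let id_bop H : (id : H -> H) \in @bop_pred R H H.
Proof. by apply/bopP; split=> //; exists 1 => x; rewrite mul1r. Qed.

Definition oid H : 'B(H) := Bop (id_bop H).

Let comp_bop H K L (S : 'B(K, L)) (T : 'B(H, K)) :
  (S : K -> L) \o T \in @bop_pred R H L.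
Proof.
apply/bopP; split=> [a x y|]; first by rewrite /= !linearP.
exists (opnorm S * opnorm T) => x /=.
rewrite (le_trans (opnorm_bound _ _))// -mulrA ler_wpM2l ?opnorm_ge0//.
exact: opnorm_bound.
Qed.

Definition ocomp H K L (S : 'B(K, L)) (T : 'B(H, K)) : 'B(H, L) :=
  Bop (comp_bop S T).

Let pair_bop H K L (A : 'B(H, K)) (B : 'B(H, L)) :
  ((fun x => (A x, B x)) : H -> hsum K L) \in @bop_pred R H (hsum K L).
Proof.
apply/bopP; split=> [a x y|]; first by rewrite !linearP.
exists (opnorm A + opnorm B) => x.
by rewrite (le_trans (hs_norm_le _))// mulrDl lerD ?opnorm_bound.
Qed.

Definition opair H K L (A : 'B(H, K)) (B : 'B(H, L)) : 'B(H, hsum K L) :=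
  Bop (pair_bop A B).

Let fst_bop H K : (fst : hsum H K -> H) \in @bop_pred R (hsum H K) H.
Proof.
by apply/bopP; split=> //; exists 1 => x; rewrite mul1r hs_norm1.
Qed.

Let snd_bop H K : (snd : hsum H K -> K) \in @bop_pred R (hsum H K) K.
Proof.
by apply/bopP; split=> //; exists 1 => x; rewrite mul1r hs_norm2.
Qed.

Definition ofst H K : 'B(hsum H K, H) := Bop (fst_bop H K).
Definition osnd H K : 'B(hsum H K, K) := Bop (snd_bop H K).

End OperatorConstructions.

Notation "S \ob T" := (ocomp S T)
  (at level 40, left associativity, format "S  \ob  T") : ring_scope.

Section OperatorTheory.
Variable R : realType.
Implicit Types H K : hilbertType R.

Definition oblock H1 H2 K1 K2 (A : 'B(H1, K1)) (B : 'B(H2, K1))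
    (C : 'B(H1, K2)) (D : 'B(H2, K2)) : 'B(hsum H1 H2, hsum K1 K2) :=
  opair (A \ob ofst H1 H2 + B \ob osnd H1 H2)
        (C \ob ofst H1 H2 + D \ob osnd H1 H2).

Definition odsum H1 H2 K1 K2 (A : 'B(H1, K1)) (D : 'B(H2, K2)) :
    'B(hsum H1 H2, hsum K1 K2) :=
  oblock A 0 0 D.

(* The operators below are those characterised by the set comprehension, which
   has at most one element; the default value 0 is irrelevant whenever the
   operator exists in the usual sense. *)

Definition adj H K (T : 'B(H, K)) : 'B(K, H) :=
  xget 0 [set S : 'B(K, H) | forall x y, hdot (T x) y = hdot x (S y)].

(* 0 <= z in R[i] means that z is real and nonnegative. *)
Definition opos H (T : 'B(H)) : Prop := forall x, 0 <= hdot (T x) x.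

Definition osqrt H (T : 'B(H)) : 'B(H) :=
  xget 0 [set S : 'B(H) | opos S /\ S \ob S = T].

Definition oabs H K (T : 'B(H, K)) : 'B(H) := osqrt (adj T \ob T).

Definition op_inv H K (T : 'B(H, K)) : 'B(K, H) :=
  xget 0 [set S : 'B(K, H) | S \ob T = oid H /\ T \ob S = oid K].

Definition mp_inv H K (T : 'B(H, K)) : 'B(K, H) :=
  xget 0 [set X : 'B(K, H) | [/\ T \ob X \ob T = T, X \ob T \ob X = X,
    adj (T \ob X) = T \ob X & adj (X \ob T) = X \ob T]].

Definition ounitary H K (U : 'B(H, K)) : Prop :=
  adj U \ob U = oid H /\ U \ob adj U = oid K.

Definition okernel H K (T : 'B(H, K)) : set H := [set x | T x = 0].

Definition oproj H (M : closed_subspace H) : 'B(H, csub M) :=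
  xget 0 [set P : 'B(H, csub M) |
    forall x (y : csub M), hdot (x - val (P x)) (val y) = 0].

Definition spectrum H (T : 'B(H)) : set R[i]^o :=
  [set a : R[i] | ~ exists S : 'B(H),
    S \ob (a *: oid H - T) = oid H /\ (a *: oid H - T) \ob S = oid H].

(* Elements of C(A) are represented by total functions continuous on A; their
   values outside A are irrelevant (see cfc_ext below). *)
Definition C_on (A : set R[i]^o) : set (R[i]^o -> R[i]^o) :=
  [set f | {within A, continuous f}].

(* The functional calculus is the unital *-homomorphism from C(sigma(D)) that
   maps the identity function to D. *)
Record is_cfc H (D : 'B(H)) (Phi : (R[i]^o -> R[i]^o) -> 'B(H)) : Prop :=
  IsCfc {
  cfc_ext : forall f g, C_on (spectrum D) f -> C_on (spectrum D) g ->
    {in spectrum D, f =1 g} -> Phi f = Phi g ;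
  cfc_add : forall f g, C_on (spectrum D) f -> C_on (spectrum D) g ->
    Phi (fun z => f z + g z) = Phi f + Phi g ;
  cfc_scale : forall (a : R[i]) f, C_on (spectrum D) f ->
    Phi (fun z => a * f z) = a *: Phi f ;
  cfc_mul : forall f g, C_on (spectrum D) f -> C_on (spectrum D) g ->
    Phi (fun z => f z * g z) = Phi f \ob Phi g ;
  cfc_conj : forall f, C_on (spectrum D) f ->
    Phi (fun z => Num.conj (f z : R[i])) = adj (Phi f) ;
  cfc_one : Phi (fun=> 1) = oid H ;
  cfc_id : Phi id = D
}.

Definition cfc H (D : 'B(H)) : (R[i]^o -> R[i]^o) -> 'B(H) :=
  xget (fun=> 0) (is_cfc D).

(* Matrices are indexed from 0: f_{11} is f 0 0 and f_{22} is f 1 1. *)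
Definition cfc_mx H (D : 'B(H)) (f : 'M[R[i]^o -> R[i]^o]_2) : 'B(hsum H H) :=
  oblock (cfc D (f 0 0)) (cfc D (f 0 1)) (cfc D (f 1 0)) (cfc D (f 1 1)).

Definition JD H (D : 'B(H)) : set 'M[R[i]^o -> R[i]^o]_2 :=
  [set f | (forall i j, C_on (spectrum D) (f i j)) /\
           [/\ f 0 1 1 = 0, f 1 0 1 = 0 & f 1 1 1 = 0]].

Record is_cstar_subalgebra H (A : set 'B(H)) : Prop := IsCstarSubalgebra {
  cstar_zero : A 0 ;
  cstar_add : forall S T, A S -> A T -> A (S + T) ;
  cstar_scale : forall (a : R[i]) T, A T -> A (a *: T) ;
  cstar_mul : forall S T, A S -> A T -> A (S \ob T) ;
  cstar_adj : forall T, A T -> A (adj T) ;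
  cstar_closed : closed A
}.

Definition cstar_gen H (Q : 'B(H)) : set 'B(H) :=
  smallest (@is_cstar_subalgebra H) [set Q].

Definition non_projection_idempotent H (Q : 'B(H)) : Prop :=
  Q \ob Q = Q /\ adj Q <> Q.

Definition matched_projection H (Q : 'B(H)) : 'B(H) :=
  2^-1 *: ((oabs (adj Q) + adj Q) \ob mp_inv (oabs (adj Q)) \ob
           op_inv (oabs (adj Q) + oid H) \ob (oabs (adj Q) + Q)).

Section CanonicalDecomposition.
Variables (H : hilbertType R) (H1 H4 H5 H6 : closed_subspace H).

Definition Umap :
    'B(H, hsum (csub H1) (hsum (csub H4) (hsum (csub H5) (csub H6)))) :=
  opair (oproj H1) (opair (oproj H4) (opair (oproj H5) (oproj H6))).

Definition ell K (D : 'B(K)) : 'B(K) := osqrt (D \ob (D - oid K)).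

Record canonical_decomposition (Q : 'B(H)) (U : 'B(csub H5, csub H6))
    (D : 'B(csub H5)) : Prop := CanonicalDecomposition {
  cd_H1 : cs_set H1 = range (matched_projection Q) `&` range Q ;
  cd_H4 : cs_set H4 = okernel (matched_projection Q) `&` okernel Q ;
  cd_H5 : cs_set H5 = closure (range (matched_projection Q \ob Q \ob
                                      (oid H - matched_projection Q))) ;
  cd_H6 : cs_set H6 = closure (range ((oid H - matched_projection Q) \ob Q \ob
                                      matched_projection Q)) ;
  cd_U : ounitary U ;
  cd_D_ge1 : opos (D - oid _) ;
  cd_D_ker : okernel (D - oid _) = [set 0] ;
  cd_Q : Umap \ob Q \ob adj Umap =
    odsum (oid _) (odsum 0 (oblock
      D             (- (ell D \ob adj U))
      (U \ob ell D) (U \ob (oid _ - D) \ob adj U)))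
}.

Definition Vmap (U : 'B(csub H5, csub H6)) :
    'B(H, hsum (csub H1) (hsum (csub H4) (hsum (csub H5) (csub H5)))) :=
  odsum (oid _) (odsum (oid _) (odsum (oid _) (adj U))) \ob Umap.

End CanonicalDecomposition.
End OperatorTheory.

(* Main.v *)
Require Import Defs.
From HB Require Import structures.
From mathcomp Require Import all_boot all_order all_algebra.
From mathcomp Require Import boolp classical_sets functions reals topology.
From mathcomp Require Import normedtype sequences realfun complex.
From mathcomp Require Import ring lra.

Set Implicit Arguments.
Unset Strict Implicit.
Unset Printing Implicit Defensive.

Import Order.TTheory GRing.Theory Num.Theory.
Import numFieldNormedType.Exports.

Local Open Scope classical_set_scope.
Local Open Scope ring_scope.

(* With m := m(Q) one has |Q^*| m = Q m and 2 Q m = |Q^*| + Q.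
   Hence the off-diagonal corners of Q with respect to m are opposite adjoints,
   the orthogonal complement of H5 in the range of m is H1 and that of H6 in the
   kernel of m is H4, so that V_Q is unitary. It then suffices to see which
   matrix functions f of D are reached by the algebra generated by
   [t, -l; l, 1 - t], l = sqrt (t (t - 1)). Since f |-> f(D) is isometric, the
   right-hand side is closed, hence a C*-algebra containing Q. Conversely, write
   Q = u v^T with u = (sqrt t, sqrt (t - 1)), v = (sqrt t, - sqrt (t - 1)) and
   w := u^T u = v^T v = 2 t - 1. As (Q Q^* Q)(t) = w^2 Q(t), Stone-Weierstrass
   shows that every g(D) Q, hence every combination of u v^T, v u^T, u u^T and
   v v^T with continuous coefficients, is in C*{Q}. These four matrices yield
   4 t e_11, 4 l e_12, 4 l e_21 and 4 (t - 1) e_22, and a continuous function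
   vanishing at 1 is a uniform limit of multiples of l, or of t - 1. *)

(** * Real-valued norms and inner products *)

(** The operators [adj], [osqrt], [mp_inv], [oproj] and [cfc] are picked from set comprehensions
    with default 0. Each therefore needs an existence proof before it can be used, and [ell D] and
    the Moore-Penrose inverse can be computed only through uniqueness. Of [cfc D] only the algebraic
    laws of [is_cfc] are known. They mention no norm, so isometry is recovered from positivity
    (upper bound) and approximate eigenvectors (lower bound). The point 1 of the spectrum ties the
    scalar on H1 to f(D): it gives |f_11(1)| <= |f(D)|, so f_11(1) survives norm limits. At t = 1
    the matrix of Q degenerates to e_11. The three vanishing conditions express this, and they make
    f |-> f_11(1) multiplicative. The identity need not belong to C*{Q}, so functions of D can enter
    only as coefficients of products of Q and Q^*. This is why continuous coefficients are produced
    by multiplying with Q^* Q, where the scalar factor w^2 appears, and why w has to be invertible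
    on the spectrum. *)

Lemma inv_nat_small (R : realType) (e : R) : 0 < e ->
  exists N, forall n, (N <= n)%N -> n.+1%:R^-1 < e.
Proof.
move=> e0; exists (Num.trunc e^-1) => n Nn; rewrite invf_plt ?posrE//.
by apply: lt_le_trans (truncnS_gt _) _; rewrite ler_nat ltnS.
Qed.

Section RealNorm.
Variable R : realType.

(* Norms over R[i] take values in R[i]; [nr] is the same norm with values in R. *)
Definition nr (V : normedZmodType R[i]) (x : V) : R := complex.Re `|x|.

Lemma nrE (V : normedZmodType R[i]) (x : V) : `|x| = (nr x)%:C%C.
Proof. by rewrite RRe_real// normr_real. Qed.

Lemma nr_ge0 (V : normedZmodType R[i]) (x : V) : 0 <= nr x.
Proof. by rewrite -ler0c -nrE. Qed.

Lemma nr0 (V : normedZmodType R[i]) : nr (0 : V) = 0.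
Proof. by rewrite /nr normr0. Qed.

Lemma nr_eq0 (V : normedZmodType R[i]) (x : V) : nr x = 0 -> x = 0.
Proof. by move=> x0; apply/normr0_eq0; rewrite nrE x0. Qed.

Lemma nr_gt0 (V : normedZmodType R[i]) (x : V) : (0 < nr x) = (x != 0).
Proof. by rewrite -ltcR -nrE normr_gt0. Qed.

Lemma nrD (V : normedZmodType R[i]) (x y : V) : nr (x + y) <= nr x + nr y.
Proof. by rewrite -lecR rmorphD/= -!nrE ler_normD. Qed.

Lemma nrN (V : normedZmodType R[i]) (x : V) : nr (- x) = nr x.
Proof. by rewrite /nr normrN. Qed.

Lemma nrB (V : normedZmodType R[i]) (x y : V) : nr (x - y) = nr (y - x).
Proof. by rewrite -nrN opprB. Qed.

Lemma nr_tri (V : normedZmodType R[i]) (x y z : V) :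
  nr (x - z) <= nr (x - y) + nr (y - z).
Proof. by rewrite -[x - z](subrKA y); exact: nrD. Qed.

Lemma nrM (a b : R[i]) : nr (a * b) = nr a * nr b.
Proof. by apply: (@complexI R); rewrite rmorphM/= -!nrE normrM. Qed.

Lemma nrV (a : R[i]) : nr a^-1 = (nr a)^-1.
Proof. by apply: (@complexI R); rewrite fmorphV/= -!nrE normfV. Qed.

Lemma nrZ (V : normedModType R[i]) (a : R[i]) (x : V) : nr (a *: x) = nr a * nr x.
Proof. by apply: (@complexI R); rewrite rmorphM/= -!nrE normrZ. Qed.

Lemma nr_real (x : R) : nr (x%:C%C) = `|x|.
Proof. by rewrite /nr normc_def/= expr0n addr0 sqrtr_sqr. Qed.

Lemma conj_real (r : R) : Num.conj (r%:C%C : R[i]) = r%:C%C.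
Proof. by apply: conj_Creal; rewrite complex_real. Qed.

Lemma conj_pair (x y : R) : Num.conj ((x +i* y)%C : R[i]) = (x +i* - y)%C.
Proof. by []. Qed.

Lemma conj_fix_real (a : R[i]) : Num.conj a = a -> a = (complex.Re a)%:C%C.
Proof.
by case: a => x y; rewrite conj_pair => -[] h /=; have -> : y = 0 by lra.
Qed.

Lemma nr_conj (a : R[i]) : nr (Num.conj a) = nr a.
Proof. by rewrite /nr norm_conjC. Qed.

Lemma nr_sqr (a : R[i]) : ((nr a ^+ 2)%:C)%C = a * Num.conj a.
Proof. by rewrite rmorphXn/= -nrE normCK. Qed.

Lemma nr_ReIm (a : R[i]) : nr a ^+ 2 = complex.Re a ^+ 2 + complex.Im a ^+ 2.
Proof. by apply: (@complexI R); rewrite add_Re2_Im2 rmorphXn/= -nrE. Qed.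

Lemma nr_ge_Re (a : R[i]) : `|complex.Re a| <= nr a.
Proof. by rewrite -lecR -nrE; exact: normc_ge_Re. Qed.

Lemma nr_ge_Im (a : R[i]) : `|complex.Im a| <= nr a.
Proof.
rewrite -[leRHS]ger0_norm ?nr_ge0// -ler_sqr ?nnegrE// !real_normK ?num_real//.
by rewrite nr_ReIm lerDr sqr_ge0.
Qed.

Lemma nr_le_ReIm (a : R[i]) : nr a <= `|complex.Re a| + `|complex.Im a|.
Proof.
case: a => x y; rewrite -[in leLHS](_ : x%:C%C + y%:C%C * 'i%C = (x +i* y)%C); last by simpc.
apply: le_trans (nrD _ _) _; rewrite nrM !nr_real/= lerD2l.
by rewrite -[leRHS]mulr1 ler_wpM2l// /nr normc_def/= expr0n expr1n add0r sqrtr1.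
Qed.

Lemma pos_complexP (e : R[i]) : 0 < e -> exists2 r : R, 0 < r & e = r%:C%C.
Proof. by move=> e0; exists (complex.Re e); rewrite -?ltcR RRe_real// gtr0_real. Qed.

Lemma le_eps (x y : R) : (forall e : R, 0 < e -> x <= y + e) -> x <= y.
Proof. by move=> xy; apply/ler_addgt0Pr. Qed.

Lemma closureP (V : normedModType R[i]) (A : set V) x :
  closure A x <-> forall e : R, 0 < e -> exists2 y, A y & nr (x - y) < e.
Proof.
split=> [clAx e e0|clA B].
  have e0' : 0 < e%:C%C by rewrite ltcR.
  have /clAx[y [Ay]] := nbhsx_ballx x _ e0'.
  by rewrite -ball_normE /= nrE ltcR => xye; exists y.
move=> /nbhs_ballP[_ /pos_complexP[e e0 ->]] xeB.
have [y Ay xye] := clA e e0; exists y; split=> //; apply: xeB.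
by rewrite -ball_normE /= nrE ltcR.
Qed.

Lemma closedP (V : normedModType R[i]) (A : set V) : closed A <->
  forall x, (forall e : R, 0 < e -> exists2 y, A y & nr (x - y) < e) -> A x.
Proof.
split=> [clA x Ax|clA x]; first by apply: clA; apply/closureP.
by move=> /closureP/clA.
Qed.

Lemma C_onP (A : set R[i]^o) (f : R[i]^o -> R[i]^o) : C_on A f <->
  forall x, A x -> forall e : R, 0 < e -> exists2 d : R, 0 < d &
    forall y, A y -> nr (y - x) < d -> nr (f y - f x) < e.
Proof.
rewrite /C_on/= subspace_continuousP; split=> [cf x Ax e e0|cf x Ax].
  have e0' : 0 < e%:C%C by rewrite ltcR.
  have /cvgrPdist_lt/(_ _ e0') := cf x Ax.
  rewrite near_withinE => /nbhs_ballP[_ /pos_complexP[d d0 ->] xd].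
  exists d => // y Ay yx; have := xd y; rewrite -ball_normE /= !nrE !ltcR !(nrB _ y).
  by rewrite (nrB _ (f y)); apply.
apply/cvgrPdist_lt => _ /pos_complexP[e e0 ->].
have [d d0 xd] := cf x Ax e e0; rewrite near_withinE; apply/nbhs_ballP.
exists d%:C%C => /=; first by rewrite ltcR.
move=> y; rewrite -ball_normE /= !nrE !ltcR nrB => yx Ay.
by rewrite nrB; exact: xd.
Qed.

Lemma cauchy_cvg (V : completeNormedModType R[i]) (u : nat -> V) :
  (forall e : R, 0 < e -> exists N, forall n m, (N <= n)%N -> (N <= m)%N ->
     nr (u n - u m) < e) ->
  exists l, forall e : R, 0 < e -> exists N, forall n, (N <= n)%N ->
     nr (u n - l) < e.
Proof.
move=> cu; have : cvg (u @ \oo).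
  apply/cauchy_cvgP/cauchy_ballP => _ /pos_complexP[e e0 ->].
  have [N uN] := cu e e0; rewrite !near_simpl.
  exists ([set n | (N <= n)%N], [set n | (N <= n)%N]) => /=.
    by split; exists N.
  by move=> [n m] /= [Nn Nm]; rewrite -ball_normE /= nrE ltcR; exact: uN.
move=> /cvg_ex[l ul]; exists l => e e0.
have e0' : 0 < e%:C%C by rewrite ltcR.
move/cvgrPdist_lt: ul => /(_ _ e0')[N _ uN]; exists N => n Nn.
by have := uN _ Nn; rewrite /= nrE ltcR nrB.
Qed.

End RealNorm.

Section Dot.
Variable R : realType.
Implicit Types H K L : hilbertType R.

Definition dot (H : hilbertType R) (x y : H) : R[i] := hdot x y.
Arguments dot : simpl never.

Section DotAlgebra.
Variable H : hilbertType R.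
Implicit Types x y z : H.

Lemma dotDl x y z : dot (x + y) z = dot x z + dot y z.
Proof. exact: linearDl. Qed.
Lemma dotDr x y z : dot z (x + y) = dot z x + dot z y.
Proof. exact: linearDr. Qed.
Lemma dotNl x z : dot (- x) z = - dot x z.
Proof. exact: linearNl. Qed.
Lemma dotNr x z : dot z (- x) = - dot z x.
Proof. exact: linearNr. Qed.
Lemma dotBl x y z : dot (x - y) z = dot x z - dot y z.
Proof. exact: linearBl. Qed.
Lemma dotBr x y z : dot z (x - y) = dot z x - dot z y.
Proof. exact: linearBr. Qed.
Lemma dotZl (a : R[i]) x z : dot (a *: x) z = a * dot x z.
Proof. exact: linearZl_LR. Qed.
Lemma dotZr (a : R[i]) x z : dot z (a *: x) = Num.conj a * dot z x.
Proof. exact: linearZr_LR. Qed.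
Lemma dot0l z : dot (0 : H) z = 0.
Proof. exact: linear0l. Qed.
Lemma dot0r z : dot z (0 : H) = 0.
Proof. exact: linear0r. Qed.
Lemma dotC x y : dot x y = Num.conj (dot y x).
Proof. by rewrite /dot hermC expr0 mul1r. Qed.
Lemma dotxx x : dot x x = (nr x ^+ 2)%:C%C.
Proof. by rewrite /dot hdotE nrE rmorphXn. Qed.

Lemma dot_ext x y : (forall z, dot z x = dot z y) -> x = y.
Proof.
move=> xy; apply/subr0_eq/nr_eq0/eqP; rewrite -sqrf_eq0 -(inj_eq (@complexI R)).
by rewrite -dotxx dotBr xy subrr.
Qed.

Lemma dot0_eq0 x : dot x x = 0 -> x = 0.
Proof. by rewrite dotxx => -[] /eqP; rewrite sqrf_eq0 => /eqP/nr_eq0. Qed.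

Lemma nr_sqrD x y :
  nr (x + y) ^+ 2 = nr x ^+ 2 + nr y ^+ 2 + complex.Re (dot x y) *+ 2.
Proof.
apply: (@complexI R); rewrite -dotxx dotDl !dotDr !dotxx (dotC y x).
rewrite !(rmorphD, rmorphMn)/= -[_ + _ + (_ + _)]addrA [X in _ + X = _]addrA.
rewrite addcJ mulr_natl; set u := (_ ^+ 2)%:C%C; set v := (_ ^+ 2)%:C%C.
by rewrite [RHS]addrAC addrA.
Qed.

Lemma nr_sqrB x y :
  nr (x - y) ^+ 2 = nr x ^+ 2 + nr y ^+ 2 - complex.Re (dot x y) *+ 2.
Proof. by rewrite nr_sqrD nrN dotNr raddfN/= mulNrn. Qed.

Lemma parallelogram x y :
  nr (x + y) ^+ 2 + nr (x - y) ^+ 2 = (nr x ^+ 2 + nr y ^+ 2) *+ 2.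
Proof. by rewrite nr_sqrB nr_sqrD; ring. Qed.

Lemma cauchy_schwarz x y : nr (dot x y) <= nr x * nr y.
Proof.
have [->|y0] := eqVneq y 0; first by rewrite dot0r !nr0 mulr0.
have ygt0 : 0 < nr y by rewrite nr_gt0.
pose z := x - (dot x y / dot y y) *: y.
have zy : dot z y = 0.
  rewrite dotBl dotZl divfK ?subrr// dotxx; apply/eqP => -[] /eqP.
  by rewrite sqrf_eq0 gt_eqF.
pose w := (dot x y / dot y y) *: y.
have : dot x x = dot z z + dot w w.
  have zw : dot z w = 0 by rewrite dotZr zy mulr0.
  by rewrite -[x in LHS](subrK w) -/z; exact: hnormDd.
rewrite /w !dotxx -rmorphD => -[]; rewrite nrZ nrM nrV nr_real ger0_norm ?sqr_ge0// => xx.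
rewrite -ler_sqr ?nnegrE ?mulr_ge0 ?nr_ge0// exprMn xx.
have -> : (nr z ^+ 2 + (nr (dot x y) / nr y ^+ 2 * nr y) ^+ 2) * nr y ^+ 2 =
  nr z ^+ 2 * nr y ^+ 2 + nr (dot x y) ^+ 2 by field; rewrite gt_eqF.
by rewrite lerDr mulr_ge0 ?sqr_ge0.
Qed.

End DotAlgebra.

Section Projection.
Variables (H : hilbertType R) (M : closed_subspace H).

Let M0 : cs_set M 0.
Proof. by have [+ _] := cs_submod M; rewrite inE. Qed.

Let ML a x y : cs_set M x -> cs_set M y -> cs_set M (a *: x + y).
Proof.
move=> Mx My; have [_ /(_ a x y)] := cs_submod M; rewrite !inE; exact.
Qed.

Let best_approximation x : exists2 y, cs_set M y &
  forall z, cs_set M z -> nr (x - y) <= nr (x - z).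
Proof.
pose S := [set nr (x - y) | y in cs_set M]; pose d := inf S.
have Sinf : has_inf S.
  by split; [exists (nr (x - 0)), 0|exists 0 => _ [y _ <-]; exact: nr_ge0].
have dle z : cs_set M z -> d <= nr (x - z).
  by move=> Mz; apply: ge_inf; [case: Sinf|exists z].
have d0 : 0 <= d by apply: lb_le_inf; [case: Sinf|move=> _ [y _ <-]; exact: nr_ge0].
(* Parallelogram law for [x - u] and [x - v]: half their sum is [x] minus the midpoint of [u] and
   [v], which lies in [M] and so is at distance at least [d] from [x]. This makes minimising
   sequences Cauchy. *)
have mid u v : cs_set M u -> cs_set M v ->
    nr (u - v) ^+ 2 <= (nr (x - u) ^+ 2 - d ^+ 2 + (nr (x - v) ^+ 2 - d ^+ 2)) *+ 2.
  move=> Mu Mv; have := parallelogram (x - u) (x - v).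
  have -> : x - u - (x - v) = v - u by rewrite opprB addrCA addrAC subrr add0r addrC.
  have -> : x - u + (x - v) = 2%:R *: (x - (2%:R^-1 *: u + 2%:R^-1 *: v)).
    rewrite scalerBr scalerDr !scalerA mulfV ?pnatr_eq0// !scale1r scaler_nat.
    by rewrite opprD addrACA mulr2n.
  have Mw : cs_set M (2%:R^-1 *: u + 2%:R^-1 *: v).
    by apply: ML => //; rewrite -[_ *: v]addr0; exact: ML.
  have nr2 : nr (2%:R : R[i]) = 2 by rewrite -(rmorph_nat (real_complex R)) nr_real normr_nat.
  rewrite nrZ nr2 (nrB v u).
  have := dle _ Mw; set t := nr _ => dt.
  have : d ^+ 2 <= t ^+ 2 by rewrite ler_sqr ?nnegrE// (le_trans d0).
  by rewrite exprMn => ? ?; lra.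
have app n : exists y, cs_set M y /\ nr (x - y) ^+ 2 < d ^+ 2 + n.+1%:R^-1.
  have [_ [y My <-] yd] : exists2 s, S s & s < Num.sqrt (d ^+ 2 + n.+1%:R^-1).
    apply: inf_lt; first by case: Sinf.
    rewrite -/d -[ltLHS]ger0_norm// -sqrtr_sqr ltr_sqrt ?ltrDl ?invr_gt0//.
    by rewrite ltr_wpDl ?sqr_ge0 ?invr_gt0.
  exists y; split=> //; rewrite -[ltRHS]sqr_sqrtr ?addr_ge0 ?sqr_ge0 ?invr_ge0//.
  by rewrite ltr_sqr ?nnegrE ?sqrtr_ge0 ?nr_ge0.
have [u uP] := choice app.
have [y uy] : exists l, forall e : R, 0 < e -> exists N, forall n, (N <= n)%N -> nr (u n - l) < e.
  apply: cauchy_cvg => e e0.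
  have [N uN] := inv_nat_small (divr_gt0 (exprn_gt0 2 e0) (ltr0Sn _ 3)).
  exists N => n m /uN Nn /uN Nm; rewrite -ltr_sqr ?nnegrE ?nr_ge0 ?ltW//.
  have [Mn un] := uP n; have [Mm um] := uP m; have := mid _ _ Mn Mm.
  by move: Nn Nm un um; set a := n.+1%:R^-1; set b := m.+1%:R^-1 => *; lra.
exists y.
  apply: (proj1 (closedP _) (@cs_closed _ _ M)) => e e0.
  by have [N uN] := uy e e0; exists (u N); [case: (uP N)|rewrite nrB uN].
suff yd : nr (x - y) <= d by move=> z /dle; exact: le_trans.
apply: le_eps => e e0.
have [N uN] := uy (e / 2) (divr_gt0 e0 (ltr0Sn _ 1)).
have e40 : 0 < (e / 2) ^+ 2 by rewrite exprn_gt0// divr_gt0.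
have [N' N'P] := inv_nat_small e40.
pose n := maxn N N'; have := uN n (leq_maxl _ _); have := N'P n (leq_maxr _ _) => ne un.
have [Mn dn] := uP n.
have : nr (x - u n) < d + e / 2.
  have e20 : 0 <= e / 2 by rewrite divr_ge0// ltW.
  rewrite -ltr_sqr ?nnegrE ?nr_ge0 ?addr_ge0//.
  apply: lt_le_trans dn _; rewrite sqrrD.
  have : 0 <= d * (e / 2) by rewrite mulr_ge0// divr_ge0// ltW.
  by move: ne; set a := n.+1%:R^-1 => ? ?; lra.
by have := nr_tri x (u n) y; lra.
Qed.

Lemma projection_ex x : exists y : csub M, forall z : csub M, dot (x - val y) (val z) = 0.
Proof.
have [y My yP] := best_approximation x; exists (CSub (mem_set My)) => /= -[z /= Mz].
have {}Mz : cs_set M z by move: Mz; rewrite inE.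
have [->|z0] := eqVneq z 0; first by rewrite dot0r.
have zgt0 : 0 < nr z ^+ 2 by rewrite exprn_gt0// nr_gt0.
(* The coefficient that minimises |w - a z|: it lowers |w|^2 by |<w, z>|^2 / |z|^2, which minimality
   of [y] forbids unless <w, z> = 0. *)
set w := x - y; pose a := dot w z / (nr z ^+ 2)%:C%C.
have waz : nr w <= nr (w - a *: z).
  by rewrite /w -addrA -opprD [y + _]addrC; apply: yP; exact: ML.
have aE : a = dot w z / (nr z ^+ 2)%:C%C by [].
clearbody w a.
have : nr (w - a *: z) ^+ 2 = nr w ^+ 2 - nr (dot w z) ^+ 2 / nr z ^+ 2.
  apply: (@complexI R); rewrite -dotxx dotBl !dotBr dotxx !(dotZl, dotZr) (dotC z w) dotxx.
  rewrite rmorphB/=; move: (nr w ^+ 2)%:C%C => nw.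
  rewrite fmorph_div/= nr_sqr aE fmorph_div/=.
  rewrite conj_real.
  have : (nr z ^+ 2)%:C%C != 0 by rewrite (inj_eq (@complexI R) _ 0) gt_eqF.
  by move: (nr z ^+ 2)%:C%C (dot w z) (Num.conj (dot w z)) => u d d' u0; field.
move=> eq1; move: waz; rewrite -ler_sqr ?nnegrE ?nr_ge0// eq1 lerBrDl addrC -lerBrDl subrr.
rewrite pmulr_lle0 ?invr_gt0// => h; apply: nr_eq0; apply/eqP.
by rewrite -sqrf_eq0 eq_le h sqr_ge0.
Qed.

End Projection.

Section Operators.
Variables (H K : hilbertType R).
Implicit Types S T : 'B(H, K).

Lemma bop_ext S T : (forall x, S x = T x) -> S = T.
Proof. by move=> ST; apply/val_inj/funext. Qed.

Lemma bopDE S T x : (S + T) x = S x + T x. Proof. by []. Qed.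
Lemma bopNE S x : (- S) x = - S x. Proof. by []. Qed.
Lemma bopZE (a : R[i]) S x : (a *: S) x = a *: S x. Proof. by []. Qed.
Lemma bop0E x : (0 : 'B(H, K)) x = 0. Proof. by []. Qed.
Lemma bopBE S T x : (S - T) x = S x - T x. Proof. by []. Qed.

Lemma bop0 T : T 0 = 0. Proof. exact: raddf0. Qed.
Lemma bopD T x y : T (x + y) = T x + T y. Proof. exact: raddfD. Qed.
Lemma bopN T x : T (- x) = - T x. Proof. exact: raddfN. Qed.
Lemma bopB T x y : T (x - y) = T x - T y. Proof. exact: raddfB. Qed.
Lemma bopZ T (a : R[i]) x : T (a *: x) = a *: T x. Proof. exact: linearZ. Qed.

Lemma nr_bop T x : nr (T x) <= nr T * nr x.
Proof.
by rewrite -lecR rmorphM/= -!nrE; exact: opnorm_bound.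
Qed.

Lemma nr_bop_le T (M : R) : 0 <= M -> (forall x, nr (T x) <= M * nr x) -> nr T <= M.
Proof.
move=> M0 TM; rewrite -lecR -nrE; apply: opnorm_le => // x.
by rewrite !nrE -rmorphM lecR.
Qed.

Lemma bop_make (f : H -> K) (M : R) : linear f -> (forall x, nr (f x) <= M * nr x) ->
  exists T : 'B(H, K), forall x, T x = f x.
Proof.
move=> lf fM; have fP : f \in @bop_pred R H K.
  by apply/bopP; split=> //; exists M%:C%C => x; rewrite !nrE -rmorphM lecR.
by exists (Bop fP).
Qed.

End Operators.

(** * Riesz representation, adjoints and completeness of the operator norm *)

Section Riesz.
Variable (H : hilbertType R) (f : H -> R[i]).
Hypothesis lf : forall (a : R[i]) x y, f (a *: x + y) = a * f x + f y.
Variable (M : R).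
Hypothesis fM : forall x, nr (f x) <= M * nr x.

Let f0 : f 0 = 0.
Proof.
have := lf 1 0 0; rewrite scale1r mul1r addr0 => /eqP.
by rewrite eq_sym -subr_eq0 addrK => /eqP.
Qed.

Let fB x y : f (x - y) = f x - f y.
Proof. by have := lf (-1) y x; rewrite scaleN1r mulN1r addrC [in RHS]addrC. Qed.

Let fZ a x : f (a *: x) = a * f x.
Proof. by have := lf a x 0; rewrite f0 !addr0. Qed.

Let ker_submod : submod_closed (mem [set x | f x = 0]).
Proof.
split=> [|a x y]; first by rewrite inE.
by rewrite !inE /= lf => -> ->; rewrite mulr0 addr0.
Qed.

Let ker_closed : closed [set x | f x = 0].
Proof.
apply/closedP => x clx /=; apply: nr_eq0; apply/eqP; rewrite eq_le nr_ge0 andbT.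
apply: le_eps => e e0; rewrite add0r.
have M1 : 0 < `|M| + 1 by rewrite ltr_wpDl.
have [y /= fy xy] := clx (e / (`|M| + 1)) (divr_gt0 e0 M1).
have -> : f x = f (x - y) by rewrite fB fy subr0.
apply: le_trans (fM _) _; move: xy; rewrite ltr_pdivlMr// => /ltW; apply: le_trans.
by rewrite mulrC ler_wpM2l ?nr_ge0// (le_trans (ler_norm _))// lerDl.
Qed.

Lemma riesz : exists y, forall x, f x = dot x y.
Proof.
have [f00|] := pselect (forall x, f x = 0); first by exists 0 => x; rewrite f00 dot0r.
move=> /existsNP[x0 /eqP fx0].
pose N := ClosedSubspace ker_submod ker_closed.
have [y yP] := projection_ex N x0.
set z := x0 - val y in yP.
have fz : f z != 0.
  by rewrite fB; case: (y) => y' /= y'0; move: y'0; rewrite inE/= => ->; rewrite subr0.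
have z0 : dot z z != 0.
  by apply/eqP => /dot0_eq0 z0; move: fz; rewrite z0 f0 eqxx.
(* The vector [x - (f x / f z) *: z] lies in the kernel of [f], hence is orthogonal to [z]; solving
   for [f x] gives this multiple, conjugated because [dot] is conjugate-linear on the right. *)
exists ((Num.conj (f z) / dot z z) *: z) => x.
have kx : x - (f x / f z) *: z \in cs_pred N.
  by rewrite inE /= fB fZ divfK// subrr.
have /= := yP (CSub kx); rewrite dotC dotBl dotZl => /eqP; rewrite conjC_eq0 subr_eq0.
rewrite dotZr rmorphM/= fmorphV/= conjCK -dotC => /eqP ->.
by move: (f x) (f z) (dot z z) fz z0 => a b c b0 c0; field; rewrite b0.
Qed.

End Riesz.

Section Adjoint.
Variables (H K : hilbertType R).

Lemma adj_ex (T : 'B(H, K)) : exists S : 'B(K, H), forall x y, dot (T x) y = dot x (S y).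
Proof.
have rz (y : K) : exists z, forall x, dot (T x) y = dot x z.
  apply: (@riesz H (fun x => dot (T x) y) _ (nr T * nr y)) => [a u v|x].
    by rewrite linearP dotDl dotZl.
  rewrite mulrAC; apply: le_trans (cauchy_schwarz _ _) _.
  by rewrite ler_wpM2r ?nr_ge0// nr_bop.
have [g gP] := choice rz.
have [||S SE] := @bop_make _ _ g (nr T).
- move=> a u v; apply: dot_ext => w.
  by rewrite -gP dotDr dotZr dotDr dotZr -!gP.
- move=> y; have [->|gy0] := eqVneq (g y) 0; first by rewrite nr0 mulr_ge0 ?nr_ge0.
  rewrite -(@ler_pM2r _ (nr (g y))) ?nr_gt0// -expr2 -[leLHS]ger0_norm ?sqr_ge0//.
  rewrite -nr_real -dotxx -gP mulrAC; apply: le_trans (cauchy_schwarz _ _) _.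
  by rewrite ler_wpM2r ?nr_ge0// nr_bop.
by exists S => x y; rewrite SE.
Qed.

Lemma adjP (T : 'B(H, K)) x y : dot (T x) y = dot x (adj T y).
Proof.
rewrite /adj; case: xgetP => [S _ SP|no]; first exact: SP.
by have [S SP] := adj_ex T; case: (no S).
Qed.

Lemma adj_uniq (T : 'B(H, K)) (S : 'B(K, H)) : (forall x y, dot (T x) y = dot x (S y)) -> adj T = S.
Proof. by move=> TS; apply: bop_ext => y; apply: dot_ext => z; rewrite -adjP. Qed.

End Adjoint.

Lemma adjP' H K (T : 'B(H, K)) x y : dot (adj T y) x = dot y (T x).
Proof. by rewrite dotC -adjP -dotC. Qed.

Lemma adjK H K (T : 'B(H, K)) : adj (adj T) = T.
Proof. by apply: adj_uniq => x y; rewrite adjP'. Qed.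

Lemma adjD H K (S T : 'B(H, K)) : adj (S + T) = adj S + adj T.
Proof. by apply: adj_uniq => x y; rewrite !bopDE dotDl dotDr !adjP. Qed.

Lemma adjZ H K a (T : 'B(H, K)) : adj (a *: T) = Num.conj a *: adj T.
Proof. by apply: adj_uniq => x y; rewrite !bopZE dotZl dotZr conjCK adjP. Qed.

Lemma adjN H K (T : 'B(H, K)) : adj (- T) = - adj T.
Proof. by apply: adj_uniq => x y; rewrite !bopNE dotNl dotNr adjP. Qed.

Lemma adjB H K (S T : 'B(H, K)) : adj (S - T) = adj S - adj T.
Proof. by rewrite adjD adjN. Qed.

Lemma adj0 H K : adj (0 : 'B(H, K)) = 0.
Proof. by apply: adj_uniq => x y; rewrite !bop0E dot0l dot0r. Qed.

Lemma adj_comp H K L (S : 'B(K, L)) (T : 'B(H, K)) : adj (S \ob T) = adj T \ob adj S.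
Proof. by apply: adj_uniq => x y /=; rewrite !adjP. Qed.

Lemma adj_oid H : adj (oid H) = oid H.
Proof. exact: adj_uniq. Qed.

Lemma nr_adj_sqr H K (T : 'B(H, K)) x : ((nr (T x) ^+ 2)%:C)%C = dot (adj T (T x)) x.
Proof. by rewrite adjP' dotxx. Qed.

Lemma nr_adj_le H K (T : 'B(H, K)) : nr (adj T) <= nr T.
Proof.
apply: nr_bop_le => [|y]; first exact: nr_ge0.
have [->|gy0] := eqVneq (adj T y) 0; first by rewrite nr0 mulr_ge0 ?nr_ge0.
rewrite -(@ler_pM2r _ (nr (adj T y))) ?nr_gt0// -expr2 -[leLHS]ger0_norm ?sqr_ge0//.
rewrite -nr_real -dotxx -adjP mulrAC; apply: le_trans (cauchy_schwarz _ _) _.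
by rewrite ler_wpM2r ?nr_ge0// nr_bop.
Qed.

Lemma nr_adj H K (T : 'B(H, K)) : nr (adj T) = nr T.
Proof. by apply/le_anti; rewrite nr_adj_le -[in leLHS](adjK T) nr_adj_le. Qed.

Lemma nr_comp H K L (S : 'B(K, L)) (T : 'B(H, K)) : nr (S \ob T) <= nr S * nr T.
Proof.
apply: nr_bop_le => [|x /=]; first by rewrite mulr_ge0 ?nr_ge0.
by rewrite (le_trans (nr_bop _ _))// -mulrA ler_wpM2l ?nr_ge0// nr_bop.
Qed.

Lemma bop_complete H K (T : nat -> 'B(H, K)) :
  (forall e : R, 0 < e -> exists N, forall n m, (N <= n)%N -> (N <= m)%N ->
     nr (T n - T m) < e) ->
  exists T0, forall e : R, 0 < e -> exists N, forall n, (N <= n)%N -> nr (T n - T0) < e.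
Proof.
move=> cT.
have pw x : exists l, forall e : R, 0 < e -> exists N, forall n, (N <= n)%N -> nr (T n x - l) < e.
  apply: cauchy_cvg => e e0; have x1 : 0 < nr x + 1 by rewrite ltr_wpDl ?nr_ge0.
  have [N TN] := cT (e / (nr x + 1)) (divr_gt0 e0 x1); exists N => n m Nn Nm.
  rewrite -bopBE; apply: le_lt_trans (nr_bop _ _) _; have := TN n m Nn Nm.
  rewrite ltr_pdivlMr//; apply: le_lt_trans.
  by rewrite ler_wpM2l ?nr_ge0// lerDl.
have [g gP] := choice pw.
(* Letting m tend to infinity in the Cauchy estimate gives a bound proportional to |x|. Linearity
   and boundedness of [g] and convergence in norm all follow from it. *)
have gT (e : R) : 0 < e -> exists N, forall n, (N <= n)%N -> forall x, nr (T n x - g x) <= e * nr x.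
  move=> e0; have [N TN] := cT e e0; exists N => n Nn x; apply: le_eps => d d0.
  have [N' gN'] := gP x d d0; pose m := maxn N N'.
  have := TN n m Nn (leq_maxl _ _); have := gN' m (leq_maxr _ _) => gm /ltW nm.
  apply: le_trans (nr_tri _ (T m x) _) _; apply: lerD; last exact: ltW.
  by rewrite -bopBE (le_trans (nr_bop _ _))// ler_wpM2r ?nr_ge0.
have glin : linear g.
  move=> a x y; apply/subr0_eq/nr_eq0/eqP; rewrite eq_le nr_ge0 andbT.
  set z := a *: x + y.
  apply: le_eps => e e0; rewrite add0r.
  pose s := nr z + nr a * nr x + nr y + 1.
  have s0 : 0 < s by rewrite ltr_wpDl ?addr_ge0 ?mulr_ge0 ?nr_ge0.
  have [N TN] := gT (e / s) (divr_gt0 e0 s0).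
  have -> : g z - (a *: g x + g y) =
      (g z - T N z) + (a *: (T N x - g x) + (T N y - g y)).
    rewrite -[LHS](subrKA (T N z)); congr (_ + _).
    by rewrite /z linearP scalerBr opprD addrACA.
  have Nx := TN N (leqnn _) x; have Ny := TN N (leqnn _) y; have Nz := TN N (leqnn _) z.
  have Nax : nr a * nr (T N x - g x) <= nr a * (e / s * nr x) by rewrite ler_wpM2l ?nr_ge0.
  apply: le_trans (nrD _ _) _; rewrite nrB.
  apply: le_trans (lerD Nz (le_trans (nrD _ _) (lerD _ Ny))) _; first by rewrite nrZ; exact: Nax.
  have -> : e / s * nr z + (nr a * (e / s * nr x) + e / s * nr y) = e / s * (s - 1).
    by rewrite /s; ring.
  by rewrite mulrBr divfK ?gt_eqF// mulr1 gerBl divr_ge0// ltW.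
have [N1 TN1] := gT 1 ltr01.
have [||T0 T0E] := @bop_make _ _ g (nr (T N1) + 1) => //.
  move=> x; have := TN1 _ (leqnn _) x; rewrite nrB mul1r => h.
  rewrite -[g x](subrK (T N1 x)); apply: le_trans (nrD _ _) _.
  by rewrite mulrDl mul1r addrC lerD// nr_bop.
exists T0 => e e0; have [N TN] := gT (e / 2) (divr_gt0 e0 (ltr0Sn _ 1)).
exists N => n Nn; apply: le_lt_trans (_ : e / 2 < e); last by lra.
apply: nr_bop_le => [|x]; first by rewrite divr_ge0// ltW.
by rewrite bopBE T0E; exact: TN.
Qed.

End Dot.

(** * Spectrum of a self-adjoint operator *)

Section OperatorRing.
Variables (R : realType) (H : hilbertType R).

Let compA : associative (@ocomp R H H H).
Proof. by move=> S T U; apply: bop_ext. Qed.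
Let comp1l : left_id (oid H) (@ocomp R H H H).
Proof. by move=> S; apply: bop_ext. Qed.
Let comp1r : right_id (oid H) (@ocomp R H H H).
Proof. by move=> S; apply: bop_ext. Qed.
Let compDl : left_distributive (@ocomp R H H H) +%R.
Proof. by move=> S T U; apply: bop_ext. Qed.
Let compDr : right_distributive (@ocomp R H H H) +%R.
Proof. by move=> S T U; apply: bop_ext => x; exact: raddfD. Qed.

(** The product is [\ob] itself, so [S * T] and [S \ob T] are convertible. The ring is a possibly
    trivial one because 1 = 0 on the zero space. *)
HB.instance Definition _ := GRing.Zmodule_isPzRing.Build 'B(H)
  compA comp1l comp1r compDl compDr.

Implicit Types S T : 'B(H).

Lemma bopME S T x : (S * T) x = S (T x). Proof. by []. Qed.
Lemma bop1E x : (1 : 'B(H)) x = x. Proof. by []. Qed.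

Lemma bopZMl (a : R[i]) S T : (a *: S) * T = a *: (S * T).
Proof. by apply: bop_ext. Qed.
Lemma bopZMr (a : R[i]) S T : S * (a *: T) = a *: (S * T).
Proof. by apply: bop_ext => x; rewrite bopME bopZE linearZ. Qed.
Lemma adjM S T : adj (S * T) = adj T * adj S.
Proof. exact: adj_comp. Qed.
Lemma adj1 : adj (1 : 'B(H)) = 1.
Proof. exact: adj_oid. Qed.
Lemma nr_opM S T : nr (S * T) <= nr S * nr T.
Proof. exact: nr_comp. Qed.

End OperatorRing.

Lemma dot_extl (R : realType) (H : hilbertType R) (x y : H) :
  (forall z, dot x z = dot y z) -> x = y.
Proof. by move=> xy; apply: dot_ext => z; rewrite dotC xy -dotC. Qed.

(* A linear identity between vectors is paired with an arbitrary vector, which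
   turns it into an identity between scalars. *)
Ltac vring := apply: dot_extl => ?;
  rewrite ?(dotDl, dotBl, dotNl, dotZl, dot0l); ring.

Lemma csub_mem (R : realType) (H : hilbertType R) (M : closed_subspace H) (x : csub M) :
  cs_set M (val x).
Proof. by case: x => x /= Mx; move: Mx; rewrite inE. Qed.

(** * Operators bounded below *)

Section BoundedBelow.
Variables (R : realType) (H : hilbertType R).
Implicit Types S T : 'B(H).

Definition bbelow T := exists2 c : R, 0 < c & forall x, c * nr x <= nr (T x).

(** A lower bound makes [T] injective with closed range. The norm condition, which is normality of
    [T], passes injectivity to [adj T], whose kernel is the orthogonal complement of that range. *)
Lemma bbelow_invertible T : (forall x, nr (adj T x) = nr (T x)) -> bbelow T ->
  exists S : 'B(H), S * T = 1 /\ T * S = 1.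
Proof.
move=> nT [c c0 cT].
have Tinj x : T x = 0 -> x = 0.
  move=> Tx0; apply: nr_eq0; apply/eqP; rewrite eq_le nr_ge0 andbT.
  by have := cT x; rewrite Tx0 nr0 pmulr_rle0.
have rsub : submod_closed (mem (range T)).
  split=> [|a x y]; first by rewrite inE; exists 0 => //; rewrite bop0.
  by rewrite !inE => -[u _ <-] [v _ <-]; exists (a *: u + v) => //; rewrite linearP.
have rclosed : closed (range T).
  apply/closedP => y clA.
  have app n : exists x, nr (y - T x) < n.+1%:R^-1.
    have n0 : 0 < n.+1%:R^-1 :> R by rewrite invr_gt0.
    by have [_ [x _ <-] yx] := clA _ n0; exists x.
  have [u uP] := choice app.
  have [x ux] : exists l, forall e : R, 0 < e -> exists N, forall n, (N <= n)%N -> nr (u n - l) < e.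
    apply: cauchy_cvg => e e0.
    have [N NP] := inv_nat_small (divr_gt0 (mulr_gt0 e0 c0) (ltr0Sn _ 1)).
    exists N => n m /NP nN /NP mN; rewrite -(ltr_pM2r c0).
    rewrite mulrC; apply: le_lt_trans (cT _) _; rewrite bopB.
    apply: le_lt_trans (nr_tri _ y _) _; rewrite nrB.
    apply: lt_le_trans (ltrD (lt_trans (uP n) nN) (lt_trans (uP m) mN)) _; lra.
  exists x => //; apply/esym/subr0_eq/nr_eq0/eqP; rewrite eq_le nr_ge0 andbT.
  apply: le_eps => e e0; rewrite add0r.
  have T1 : 0 < nr T + 1 by rewrite ltr_wpDl ?nr_ge0.
  have [N NP] := inv_nat_small (divr_gt0 e0 (ltr0Sn _ 1)).
  have [N' N'P] := ux _ (divr_gt0 (divr_gt0 e0 (ltr0Sn _ 1)) T1).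
  pose n := maxn N N'; have := NP n (leq_maxl _ _); have := N'P n (leq_maxr _ _).
  rewrite ltr_pdivlMr// => xn ne; apply: le_trans (nr_tri _ (T (u n)) _) _.
  rewrite -bopB; have := nr_bop T (u n - x); have := uP n.
  have : nr T * nr (u n - x) <= nr (u n - x) * (nr T + 1).
    by rewrite mulrC ler_wpM2l ?nr_ge0// lerDl.
  by move: ne; set k := n.+1%:R^-1 => *; lra.
(* The part [z] of [y] orthogonal to the range is killed by [adj T], hence by [T] since the norms
   agree, hence is zero. *)
have Tsurj y : exists x, T x = y.
  have [p pP] := projection_ex (ClosedSubspace rsub rclosed) y.
  set z := y - _ in pP.
  have : adj T z = 0.
    apply: dot0_eq0; rewrite adjP'.
    have Tz : T (adj T z) \in cs_pred (ClosedSubspace rsub rclosed).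
      by rewrite inE; exists (adj T z).
    exact: pP (CSub Tz).
  move=> Tz0; have : nr (T z) = 0 by rewrite -nT Tz0 nr0.
  move=> /nr_eq0/Tinj/subr0_eq ->.
  by have [x _ xp] := csub_mem p; exists x.
have [g gP] := choice Tsurj.
have Tinj' x y : T x = T y -> x = y.
  by move=> xy; apply/subr0_eq/Tinj; rewrite bopB xy subrr.
have [||S SE] := @bop_make _ H H g c^-1.
- by move=> a x y; apply: Tinj'; rewrite bopD bopZ !gP.
- by move=> x; rewrite ler_pdivlMl//; apply: le_trans (cT _) _; rewrite gP.
by exists S; split; apply: bop_ext => x; rewrite bopME SE ?gP//; exact: Tinj'.
Qed.

Lemma bbelowN T : bbelow T -> bbelow (- T).
Proof. by move=> [c c0 cT]; exists c => // x; rewrite bopNE nrN. Qed.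

Lemma bbelowM S T : bbelow S -> bbelow T -> bbelow (S * T).
Proof.
move=> [c c0 cS] [d d0 dT]; exists (c * d) => [|x]; first exact: mulr_gt0.
by rewrite bopME; apply: le_trans (cS _); rewrite -mulrA ler_pM2l.
Qed.

Lemma bbelow_linv S T : S * T = 1 -> bbelow T.
Proof.
move=> ST; have S1 : 0 < nr S + 1 by rewrite ltr_wpDl ?nr_ge0.
exists (nr S + 1)^-1 => [|x]; first by rewrite invr_gt0.
rewrite ler_pdivrMl// -[x in nr x](bop1E x) -ST bopME.
by apply: le_trans (nr_bop _ _) _; rewrite ler_wpM2r ?nr_ge0// lerDl.
Qed.

(* Vectors at which S nearly attains its norm are approximate eigenvectors of
   S^* S. *)
Lemma not_bbelow_norm S : (exists x : H, x != 0) ->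
  ~ bbelow (adj S * S - (nr S ^+ 2)%:C%C *: (1 : 'B(H))).
Proof.
move=> [x0 x00] [c c0 cS]; set M := nr S in cS.
(* Expand c^2 |x|^2 <= |S^* S x - M^2 x|^2 = |S^* S x|^2 - 2 M^2 |S x|^2 + M^4 |x|^2 and use |S^* S
   x| <= M |S x|. *)
have main x : (M * nr (S x)) ^+ 2 <= (M ^+ 4 - c ^+ 2) * nr x ^+ 2.
  have := cS x; rewrite -ler_sqr ?nnegrE ?nr_ge0//; last by rewrite mulr_ge0 ?nr_ge0// ltW.
  rewrite bopBE bopME bopZE bop1E nr_sqrB.
  have -> : dot (adj S (S x)) ((M ^+ 2)%:C%C *: x) = (M ^+ 2 * nr (S x) ^+ 2)%:C%C.
    by rewrite dotZr adjP' dotxx conj_real [RHS]rmorphM.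
  rewrite nrZ nr_real ger0_norm ?sqr_ge0//= => h1.
  have : nr (adj S (S x)) <= M * nr (S x) by rewrite /M -nr_adj nr_bop.
  rewrite -ler_sqr ?nnegrE ?nr_ge0//; last by rewrite mulr_ge0 ?nr_ge0.
  move: h1; rewrite !exprMn => *; lra.
have x0gt : 0 < nr x0 ^+ 2 by rewrite exprn_gt0// nr_gt0.
have Mc : 0 <= M ^+ 4 - c ^+ 2.
  by rewrite -(pmulr_lge0 _ x0gt); apply: le_trans (main x0); exact: sqr_ge0.
have M0 : 0 < M.
  rewrite lt_neqAle nr_ge0 andbT; apply/eqP => M0.
  by move: Mc; rewrite -M0 expr0n sub0r oppr_ge0 leNgt exprn_gt0.
have M2 : 0 < M ^+ 2 by rewrite exprn_gt0.
(* By [main] this number bounds |S x| / |x|, hence the norm [M]; squaring gives M^4 <= M^4 - c^2,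
   which is absurd. *)
have : M <= Num.sqrt ((M ^+ 4 - c ^+ 2) / M ^+ 2).
  apply: nr_bop_le => [|x]; first exact: sqrtr_ge0.
  rewrite -ler_sqr ?nnegrE ?mulr_ge0 ?sqrtr_ge0 ?nr_ge0//.
  rewrite exprMn sqr_sqrtr ?divr_ge0 ?(ltW M2)// mulrAC ler_pdivlMr// mulrC -exprMn.
  exact: main.
rewrite -ler_sqr ?nnegrE ?sqrtr_ge0 ?(ltW M0)// sqr_sqrtr ?divr_ge0 ?(ltW M2)//.
rewrite ler_pdivlMr// -exprD/= lerBrDl addrC -lerBrDl subrr leNgt.
by rewrite exprn_gt0.
Qed.

End BoundedBelow.

(** * Polynomials in an operator, and their norms in the self-adjoint case *)

Section PolynomialCalculus.
Variables (R : realType) (H : hilbertType R).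
Implicit Types (T : 'B(H)) (p q : {poly R[i]}).

Definition pev T p : 'B(H) := \sum_(i < size p) p`_i *: T ^+ i.

Lemma pevE T p n : (size p <= n)%N -> pev T p = \sum_(i < n) p`_i *: T ^+ i.
Proof.
move=> pn; rewrite /pev (big_ord_widen n (fun i => p`_i *: T ^+ i))//.
rewrite big_mkcond/=; apply: eq_bigr => i _; case: ltnP => // /(nth_default 0) ->.
by rewrite scale0r.
Qed.

Lemma pevD T p q : pev T (p + q) = pev T p + pev T q.
Proof.
rewrite (pevE T (leq_trans (leqnn _) (size_polyD p q))).
rewrite (pevE T (leq_maxl (size p) (size q))) (pevE T (leq_maxr (size p) (size q))).
by rewrite -big_split; apply: eq_bigr => i _ /=; rewrite coefD scalerDl.
Qed.

Lemma pevZ T a p : pev T (a *: p) = a *: pev T p.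
Proof.
rewrite (pevE T (size_scale_leq a p)) /pev scaler_sumr.
by apply: eq_bigr => i _; rewrite coefZ scalerA.
Qed.

Lemma pevC T (a : R[i]) : pev T a%:P = a *: (1 : 'B(H)).
Proof. by rewrite (pevE T (size_polyC_leq1 a)) big_ord1 coefC eqxx expr0. Qed.

Lemma pevMX T p : pev T (p * 'X) = pev T p * T.
Proof.
have [->|p0] := eqVneq p 0; first by rewrite mul0r /pev size_poly0 !big_ord0 mul0r.
rewrite /pev size_mulX// big_ord_recl coefMX eqxx scale0r add0r mulr_suml.
by apply: eq_bigr => i _; rewrite coefMX /= bopZMl -exprSr.
Qed.

Lemma pevX T : pev T 'X = T.
Proof. by rewrite -['X]mul1r pevMX -polyC1 pevC scale1r mul1r. Qed.

Lemma pevM T p q : pev T (p * q) = pev T p * pev T q.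
Proof.
elim/poly_ind: q => [|q c IH]; first by rewrite mulr0 -polyC0 pevC scale0r mulr0.
rewrite mulrDr mulrA mulrC -mulrC pevD pevMX IH pevD pevMX pevC mulrDr mulrA.
by congr (_ + _); rewrite mulrC mul_polyC pevZ bopZMr mulr1.
Qed.

Lemma pevB T p q : pev T (p - q) = pev T p - pev T q.
Proof. by rewrite pevD -scaleN1r pevZ scaleN1r. Qed.

Lemma pev_XsubC T (a : R[i]) : pev T ('X - a%:P) = T - a *: (1 : 'B(H)).
Proof. by rewrite pevB pevX pevC. Qed.

Lemma adj_pev T p : adj T = T -> adj (pev T p) = pev T (map_poly Num.conj p).
Proof.
move=> aT; elim/poly_ind: p => [|p c IH].
  by rewrite rmorph0 -polyC0 pevC scale0r adj0.
rewrite rmorphD rmorphM/= map_polyX map_polyC/= !pevD !pevMX !pevC adjD adjM aT IH.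
rewrite adjZ adj1; congr (_ + _); rewrite -pevMX -[X in X * _](pevX T) -pevM.
by rewrite mulrC.
Qed.

End PolynomialCalculus.

Section SelfAdjointSpectrum.
Variables (R : realType) (H : hilbertType R) (D : 'B(H)).
Hypothesis Dsa : adj D = D.
Implicit Types (p q : {poly R[i]}).

(** The cross term vanishes: <(D - a) x, x> is real as [D] is self-adjoint, while the factor i b is
    purely imaginary. *)
Let nr_shift (a b : R) x :
  nr ((D - (a +i* b)%C *: (1 : 'B(H))) x) ^+ 2 =
  nr ((D - a%:C%C *: (1 : 'B(H))) x) ^+ 2 + b ^+ 2 * nr x ^+ 2.
Proof.
pose ib : R[i] := (0 +i* b)%C.
have -> : (D - (a +i* b)%C *: (1 : 'B(H))) x = (D - a%:C%C *: (1 : 'B(H))) x - ib *: x.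
  have -> : (a +i* b)%C = a%:C%C + ib by rewrite /ib; simpc.
  by rewrite !bopBE !bopZE !bop1E scalerDl opprD addrA.
set y := (D - _) x; rewrite nr_sqrB dotZr.
have yx : Num.conj (dot y x) = dot y x.
  by rewrite /y bopBE bopZE bop1E dotBl dotZl dotxx rmorphB/= -dotC -adjP' Dsa -rmorphM/= conj_real.
have -> : complex.Re (Num.conj ib * dot y x) = 0.
  rewrite (conj_fix_real yx); move: (complex.Re (dot y x)) => r.
  have -> : complex.Re (Num.conj ib * r%:C%C) = 0 * r - (- b) * 0 by [].
  by rewrite mul0r mulr0 subr0.
rewrite mul0rn subr0 nrZ exprMn; congr (_ + _ * _).
by rewrite nr_ReIm/= expr0n add0r.
Qed.

Lemma nr_adj_shift (a : R[i]) x : nr (adj (D - a *: (1 : 'B(H))) x) = nr ((D - a *: (1 : 'B(H))) x).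
Proof.
apply/eqP; rewrite -(eqrXn2 (n := 2))// ?nr_ge0//; apply/eqP.
rewrite adjB Dsa adjZ adj1; case: a => a b; rewrite -[Num.conj _]/(a +i* (- b))%C.
by rewrite [LHS]nr_shift [RHS]nr_shift sqrrN.
Qed.

(** For self-adjoint [D] the spectrum consists of approximate eigenvalues, because every D - a is
    normal and [bbelow_invertible] applies to it. *)
Lemma spectrumP (a : R[i]) : spectrum D a <-> ~ bbelow (D - a *: (1 : 'B(H))).
Proof.
split=> [sa bb|nb [S [ST _]]]; last first.
  by apply: nb; rewrite -opprB; apply: bbelowN; exact: bbelow_linv ST.
apply: sa; have [S [SD DS]] := bbelow_invertible (nr_adj_shift a) bb.
have SD' x : S ((D - a *: (1 : 'B(H))) x) = x by rewrite -bopME SD.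
have DS' x : (D - a *: (1 : 'B(H))) (S x) = x by rewrite -bopME DS.
exists (- S); rewrite -opprB; split; apply: bop_ext => x.
  by change (- S (- ((D - a *: (1 : 'B(H))) x)) = x); rewrite bopN opprK SD'.
by change (- ((D - a *: (1 : 'B(H))) (- S x)) = x); rewrite bopN opprK DS'.
Qed.

Lemma spectrum_real (a : R[i]) : spectrum D a -> a = (complex.Re a)%:C%C.
Proof.
case: a => a b /spectrumP nb /=; have [->//|b0] := eqVneq b 0.
case: nb; exists `|b|; first by rewrite normr_gt0.
move=> x; rewrite -ler_sqr ?nnegrE ?mulr_ge0 ?nr_ge0// nr_shift exprMn real_normK ?num_real//.
by rewrite lerDr sqr_ge0.
Qed.

Lemma spectrum_conj (a : R[i]) : spectrum D a -> Num.conj a = a.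
Proof. by move=> /spectrum_real ->; exact: conj_real. Qed.

Lemma spectrum_bound (a : R[i]) : spectrum D a -> nr a <= nr D.
Proof.
move=> /spectrumP nb; rewrite leNgt; apply/negP => Da; apply: nb.
exists (nr a - nr D) => [|x]; first by rewrite subr_gt0.
have := nr_tri (a *: x) (D x) 0; rewrite !subr0 nrB bopBE bopZE bop1E nrZ mulrBl.
by have := nr_bop D x; lra.
Qed.

Lemma spectrum_closed : closed (spectrum D).
Proof.
apply/closedP => a cla; apply/spectrumP => -[c c0 cD].
have [b /spectrumP nb ab] := cla (c / 2) (divr_gt0 c0 (ltr0Sn _ 1)); apply: nb.
exists (c / 2) => [|x]; first by rewrite divr_gt0.
have := nr_tri (D x - a *: x) (D x - b *: x) 0; rewrite !subr0.
have -> : D x - a *: x - (D x - b *: x) = (b - a) *: x.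
  by rewrite opprB addrC addrA subrK scalerBl.
have := cD x; rewrite !bopBE !bopZE !bop1E nrZ.
have : nr (b - a) * nr x <= c / 2 * nr x by rewrite ler_wpM2r ?nr_ge0// nrB ltW.
by lra.
Qed.

(** Split [q] into linear factors: a product of operators bounded below is bounded below, so some
    factor D - a is not. *)
Lemma root_in_spectrum q : q != 0 -> ~ bbelow (pev D q) -> exists2 a, spectrum D a & q.[a] = 0.
Proof.
move=> q0; have [r ->] := closed_field_poly_normal q.
have lc0 : lead_coef q != 0 by rewrite lead_coef_eq0.
rewrite pevZ => nb.
have {nb} : ~ bbelow (pev D (\prod_(z <- r) ('X - z%:P))).
  move=> [c c0 cT]; apply: nb; exists (nr (lead_coef q) * c).
    by rewrite mulr_gt0// nr_gt0.
  by move=> x; rewrite bopZE nrZ -mulrA ler_wpM2l ?nr_ge0.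
elim: r => [|a r IH].
  rewrite big_nil -polyC1 pevC scale1r => -[].
  by exists 1 => // x; rewrite mul1r.
rewrite big_cons pevM pev_XsubC => nb.
have [/bbelowM ba|na] := pselect (bbelow (D - a *: (1 : 'B(H)))); last first.
  by exists a; [exact/spectrumP|rewrite !(hornerZ, hornerM, hornerXsubC) subrr mul0r mulr0].
have [b sb b0] := IH (fun h => nb (ba _ h)); exists b => //.
move: b0; rewrite !hornerZ hornerM mulrCA => ->.
by rewrite mulr0.
Qed.

(* The polynomial conj(p) p - |p(D)|^2 is not bounded below at D, hence neither
   is one of its linear factors: this bounds |p(D)| by the values of p on the
   spectrum without the spectral radius formula. *)
Lemma pev_attains p : (exists x : H, x != 0) ->
  exists2 a, spectrum D a & nr p.[a] = nr (pev D p).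
Proof.
move=> H0.
have key q : map_poly Num.conj q * q - (nr (pev D q) ^+ 2)%:C%C%:P != 0 ->
    exists2 a, spectrum D a & nr q.[a] = nr (pev D q).
  set M := nr (pev D q).
  have root a : spectrum D a -> (map_poly Num.conj q * q - (M ^+ 2)%:C%C%:P).[a] = 0 ->
      nr q.[a] = M.
    move=> sa; rewrite hornerD hornerN hornerC hornerM -[in X in X * _](spectrum_conj sa).
    rewrite horner_map/= mulrC -nr_sqr => /subr0_eq [] /eqP.
    by rewrite eqrXn2 ?nr_ge0// => /eqP.
  move=> q0; have [|a sa /(root _ sa)] := root_in_spectrum q0; last by exists a.
  rewrite pevB pevM pevC -adj_pev//; exact: not_bbelow_norm.
have [q0|] := eqVneq (map_poly Num.conj p * p - (nr (pev D p) ^+ 2)%:C%C%:P) 0; last exact: key.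
(* When conj(p) p is the constant |p(D)|^2, any spectral point will do. The polynomial X^2 - |D|^2
   attached to 'X is nonzero, so [key] supplies one. *)
have [|a sa _] := key 'X.
  rewrite map_polyX -expr2 -size_poly_eq0 size_XnsubC//.
exists a => //; have /eqP : (map_poly Num.conj p * p - (nr (pev D p) ^+ 2)%:C%C%:P).[a] = 0.
  by rewrite q0 horner0.
rewrite hornerD hornerN hornerC hornerM -[in X in X * _](spectrum_conj sa) horner_map/=.
rewrite mulrC -nr_sqr.
by rewrite subr_eq0 => /eqP[] /eqP; rewrite eqrXn2 ?nr_ge0// => /eqP.
Qed.

Lemma pev_norm_le p (s : R) : 0 <= s -> (forall a, spectrum D a -> nr p.[a] <= s) ->
  nr (pev D p) <= s.
Proof.
move=> s0 ps; have [H0|H0] := pselect (exists x : H, x != 0).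
  by have [a sa <-] := pev_attains p H0; exact: ps.
apply: nr_bop_le => // x; have [->|x0] := eqVneq x 0; last by case: H0; exists x.
by rewrite bop0 !nr0 mulr0.
Qed.

End SelfAdjointSpectrum.

(** * The Stone-Weierstrass theorem *)

(** A property stable under subsets and finite unions that holds locally holds on a compact set. It
    replaces the extraction of finite subcovers, both for boundedness and for the two lattice steps
    of Stone-Weierstrass. *)
Lemma compact_induction (T : topologicalType) (K : set T) (P : set T -> Prop) :
  compact K -> P set0 ->
  (forall A B, P A -> P B -> P (A `|` B)) ->
  (forall A B, A `<=` B -> P B -> P A) ->
  (forall x, K x -> exists2 V, nbhs x V & P V) -> P K.
Proof.
move=> cK P0 PU PS Ploc; apply: contrapT => nPK.
(* Otherwise the complements of the good sets form a proper filter on K without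
   cluster point. *)
pose F : set_system T := [set B | P (K `&` ~` B)].
have FF : ProperFilter F.
  split; first by rewrite /F /= setC0 setIT.
  split; rewrite /F /=.
  - by rewrite setCT setI0.
  - move=> B C PB PC. rewrite /= setCI setIUr; exact: PU.
  - by move=> B C BC; apply: PS; apply: setIS; exact: subsetC.
have FK : F K by rewrite /F /= setICr.
have [x [Kx clx]] := cK F FF FK.
have [V xV PV] := Ploc x Kx.
have FV : F (~` V) by rewrite /F /= setCK; apply: PS PV; exact: subIsetr.
by have [y [nVy Vy]] := clx _ _ FV xV.
Qed.

Section StoneWeierstrass.
Variables (R : realType) (K : set R[i]^o).
Hypothesis cK : compact K.
Implicit Types f g : R[i] -> R.

Definition rcont f := forall x, K x -> forall e, 0 < e -> exists2 d : R, 0 < d &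
  forall y, K y -> nr (y - x) < d -> `|f y - f x| < e.

Lemma nbhs_nr (x : R[i]^o) (d : R) : 0 < d -> nbhs x [set y | nr (y - x) < d].
Proof.
move=> d0; apply/nbhs_ballP; exists d%:C%C => /=; first by rewrite ltcR.
by move=> y; rewrite -ball_normE /= nrE ltcR nrB.
Qed.

Lemma rcont_bounded f : rcont f -> exists2 M, 0 < M & forall x, K x -> `|f x| <= M.
Proof.
move=> cf; pose P (B : set R[i]^o) := exists2 M, 0 < M & forall x, B x -> K x -> `|f x| <= M.
suff [M M0 KM] : P K by exists M => // x Kx; exact: KM.
apply: compact_induction => //.
- by exists 1.
- move=> A B [M M0 AM] [N N0 BN]; exists (M + N) => [|x [Ax|Bx] Kx]; first exact: addr_gt0.
    by rewrite (le_trans (AM x Ax Kx))// lerDl ltW.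
  by rewrite (le_trans (BN x Bx Kx))// lerDr ltW.
- by move=> A B AB [M M0 BM]; exists M => // x /AB; exact: BM.
- move=> x Kx; have [d d0 xd] := cf x Kx 1 ltr01.
  exists [set y | nr (y - x) < d]; first exact: nbhs_nr.
  exists (`|f x| + 1) => [|y /= yx Ky]; first by rewrite ltr_wpDl.
  rewrite -[f y](subrK (f x)) (le_trans (ler_normD _ _))// addrC lerD2l ltW//.
  exact: xd.
Qed.

Variable A : set (R[i] -> R).
Hypothesis A_cont : forall f, A f -> rcont f.
Hypothesis A_cst : forall c, A (fun=> c).
Hypothesis A_add : forall f g, A f -> A g -> A (fun x => f x + g x).
Hypothesis A_mul : forall f g, A f -> A g -> A (fun x => f x * g x).
Hypothesis A_lim : forall f, (forall e, 0 < e -> exists2 g, A g &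
  forall x, K x -> `|f x - g x| <= e) -> A f.
Hypothesis A_sep : forall x y, K x -> K y -> x != y -> exists2 g, A g & g x != g y.

Let A_ext f g : A f -> (forall x, K x -> f x = g x) -> A g.
Proof.
by move=> Af fg; apply: A_lim => e e0; exists f => // x Kx; rewrite fg// subrr normr0 ltW.
Qed.

(* The iteration p := p + (g^2 - p^2) / 2 increases to |g| when |g| <= 1. *)
Let sqrt_iter (g : R[i] -> R) := fix p n : R[i] -> R :=
  if n is m.+1 then fun x => p m x + (g x * g x + - 1 * (p m x * p m x)) * 2^-1 else fun=> 0.

Let sqrt_iter_bound g n x : `|g x| <= 1 ->
  [/\ 0 <= sqrt_iter g n x, sqrt_iter g n x <= `|g x| &
      `|g x| - sqrt_iter g n x <= 2 / n.+2%:R].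
Proof.
move=> gx1; set s := `|g x| in gx1 *; have s0 : 0 <= s by exact: normr_ge0.
have gg : g x * g x = s ^+ 2 by rewrite /s real_normK ?num_real// expr2.
elim: n => [|n]; first by rewrite /= subr0 divff ?pnatr_eq0.
set c : R := 2 / n.+2%:R; set c' : R := 2 / n.+3%:R.
have t2 : 2 <= n.+2%:R :> R by rewrite ler_nat.
have c'E : c' = 2 / (n.+2%:R + 1) by rewrite /c' -[n.+3]addn1 natrD.
move: (n.+2%:R) @c t2 c'E => t c t2 c'E; have t0 : 0 < t by lra.
have c0 : 0 <= c by rewrite divr_ge0// ltW.
have c1 : c <= 1 by rewrite ler_pdivrMr// mul1r.
(* With r the error s - p, one iteration turns r into r (1 - (s + p) / 2) <= r - r^2 / 2, because p
   >= 0 gives s + p >= r. The bound 2 / (n + 2) is chosen to be stable under this map. *)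
have cc' : c - c ^+ 2 / 2 <= c'.
  rewrite c'E /c ler_pdivlMr; last lra.
  have -> : (2 / t - (2 / t) ^+ 2 / 2) * (t + 1) = 2 * ((t - 1) * (t + 1)) / t ^+ 2.
    by field; rewrite gt_eqF.
  by rewrite ler_pdivrMr ?exprn_gt0// ler_pM2l//; nra.
rewrite /= gg; move: (sqrt_iter g n x) => p [p0 ps ec].
split; [nra|nra|].
suff : s - p - (s - p) ^+ 2 / 2 <= c - c ^+ 2 / 2 by move=> ?; nra.
(* This product is the difference of the values of r - r^2 / 2 at [c] and at [s - p]; it is
   nonnegative because that map increases on [0, 1]. *)
have : 0 <= (c - (s - p)) * (1 - (c + (s - p)) / 2) by apply: mulr_ge0; lra.
by move=> ?; lra.
Qed.

Let A_abs f : A f -> A (fun x => `|f x|).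
Proof.
move=> Af; have [M M0 fM] := rcont_bounded (A_cont Af).
pose g x := M^-1 * f x.
have Ag : A g by apply: A_mul.
have g1 x : K x -> `|g x| <= 1.
  by move=> Kx; rewrite normrM normfV (gtr0_norm M0) ler_pdivrMl// mulr1 fM.
have Ap n : A (sqrt_iter g n).
  elim: n => [|n IH] /=; first exact: A_cst.
  apply: A_add => //; apply: A_mul => //; apply: A_add; first exact: A_mul.
  by apply: A_mul => //; exact: A_mul.
have Aabs : A (fun x => `|g x|).
  apply: A_lim => e e0; have [N NP] := inv_nat_small (divr_gt0 e0 (ltr0Sn _ 1)).
  exists (sqrt_iter g N) => // x Kx.
  have [p0 pg gp] := sqrt_iter_bound N (g1 x Kx).
  rewrite ger0_norm ?subr_ge0//; apply: le_trans gp _.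
  have : N.+2%:R^-1 <= N.+1%:R^-1 :> R by rewrite lef_pV2 ?posrE// ler_nat.
  have := NP N (leqnn N); set a := N.+1%:R^-1; set b := N.+2%:R^-1 => *; lra.
apply: (@A_ext (fun x => M * `|g x|)) => [|x Kx]; first exact: A_mul.
by rewrite normrM normfV (gtr0_norm M0) mulrA divff ?gt_eqF// mul1r.
Qed.

Let A_max f g : A f -> A g -> A (fun x => Num.max (f x) (g x)).
Proof.
move=> Af Ag.
apply: (@A_ext (fun x => (f x + g x + `|f x + - 1 * g x|) * 2^-1)) => [|x Kx].
  apply: A_mul => //; apply: A_add; first exact: A_add.
  by apply: (A_abs (f := fun x => f x + - 1 * g x)); apply: A_add => //; exact: A_mul.
rewrite mulN1r maxr_absE; lra.
Qed.

Let A_min f g : A f -> A g -> A (fun x => Num.min (f x) (g x)).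
Proof.
move=> Af Ag.
apply: (@A_ext (fun x => - 1 * Num.max (- 1 * f x) (- 1 * g x))) => [|x Kx].
  by apply: A_mul => //; apply: (A_max (f := fun x => - 1 * f x)); exact: A_mul.
by rewrite !mulN1r oppr_max !opprK.
Qed.

Let interpolate f x y : K x -> K y -> exists g, [/\ A g, g x = f x & g y = f y].
Proof.
move=> Kx Ky; have [->|xy] := eqVneq x y; first by exists (fun=> f y).
have [h Ah hxy] := A_sep Kx Ky xy.
exists (fun z => f x + (f y - f x) / (h y - h x) * (h z + - h x)); split.
- by apply: A_add => //; apply: A_mul => //; exact: A_add.
- by rewrite subrr mulr0 addr0.
- by rewrite divfK ?subr_eq0 1?eq_sym// addrC subrK.
Qed.

(** Lattice argument: functions of [A] that match [f] at two points are combined by maxima into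
    functions above f - e that touch [f] at a given point, then these by minima into one function
    that also stays below f + e. *)
Theorem stone_weierstrass f : rcont f -> A f.
Proof.
move=> cf; apply: A_lim => e e0.
have below y : K y -> exists g, [/\ A g, g y = f y & forall x, K x -> f x - e < g x].
  move=> Ky; pose P (B : set R[i]^o) :=
    exists g, [/\ A g, g y = f y & forall x, B x -> K x -> f x - e < g x].
  suff [g [Ag gy gf]] : P K by exists g; split=> // x Kx; exact: gf.
  apply: compact_induction => //.
  - by exists (fun=> f y); split.
  - move=> B C [g [Ag gy gB]] [h [Ah hy hC]]; exists (fun x => Num.max (g x) (h x)).
    split; [exact: A_max|by rewrite gy hy maxxx|move=> x [Bx|Cx] Kx]; rewrite lt_max.
      by rewrite gB.
    by rewrite hC ?orbT.
  - by move=> B C BC [g [Ag gy gC]]; exists g; split=> // x /BC; exact: gC.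
  - move=> x Kx; have [g [Ag gx gy]] := interpolate f Kx Ky.
    have e20 : 0 < e / 2 by rewrite divr_gt0.
    have [d d0 xd] := cf x Kx _ e20; have [d' d'0 xd'] := A_cont Ag Kx e20.
    exists [set z | nr (z - x) < Num.min d d'].
      by apply: nbhs_nr; rewrite lt_min d0.
    exists g; split=> // z /=; rewrite lt_min => /andP[zd zd'] Kz.
    have := xd z Kz zd; have := xd' z Kz zd'; rewrite gx !ltr_norml => /andP[? ?] /andP[? ?].
    lra.
pose P (B : set R[i]^o) := exists g, [/\ A g, forall x, K x -> f x - e < g x &
  forall x, B x -> K x -> g x < f x + e].
have [g [Ag gf fg]] : P K.
  apply: compact_induction => //.
  - have [M M0 fM] := rcont_bounded cf; exists (fun=> M); split=> // x Kx.
    by have := fM x Kx; rewrite ler_norml => /andP[? ?]; lra.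
  - move=> B C [g [Ag gf gB]] [h [Ah hf hC]]; exists (fun x => Num.min (g x) (h x)).
    split; [exact: A_min|by move=> x Kx; rewrite lt_min gf ?hf|].
    move=> x [Bx|Cx] Kx; rewrite gt_min; first by rewrite gB.
    by rewrite hC ?orbT.
  - by move=> B C BC [g [Ag gf gC]]; exists g; split=> // x /BC; exact: gC.
  - move=> x Kx; have [g [Ag gx gf]] := below x Kx.
    have e20 : 0 < e / 2 by rewrite divr_gt0.
    have [d d0 xd] := cf x Kx _ e20; have [d' d'0 xd'] := A_cont Ag Kx e20.
    exists [set z | nr (z - x) < Num.min d d'].
      by apply: nbhs_nr; rewrite lt_min d0.
    exists g; split=> // z /=; rewrite lt_min => /andP[zd zd'] Kz.
    have := xd z Kz zd; have := xd' z Kz zd'; rewrite gx !ltr_norml => /andP[? ?] /andP[? ?].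
    lra.
exists g => // x Kx; rewrite ler_norml.
by have := gf x Kx; have := fg x Kx Kx => *; apply/andP; split; lra.
Qed.

End StoneWeierstrass.

(** * Continuous functional calculus *)

Section ContinuousOn.
Variables (R : realType) (A : set R[i]^o).
Implicit Types f g : R[i]^o -> R[i]^o.

Lemma C_on_cst (c : R[i]) : C_on A (fun=> c).
Proof. by move=> x; exact: cvg_cst. Qed.

Lemma C_on_id : C_on A id.
Proof. by apply/C_onP => x Ax e e0; exists e. Qed.

Lemma C_on_add f g : C_on A f -> C_on A g -> C_on A (fun z => f z + g z).
Proof. by move=> cf cg x; apply: cvgD; [exact: cf|exact: cg]. Qed.

Lemma C_on_mul f g : C_on A f -> C_on A g -> C_on A (fun z => f z * g z).
Proof. by move=> cf cg x; apply: cvgM; [exact: cf|exact: cg]. Qed.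

Lemma C_on_opp f : C_on A f -> C_on A (fun z => - f z).
Proof. by move=> cf x; apply: cvgN; exact: cf. Qed.

Lemma C_on_sub f g : C_on A f -> C_on A g -> C_on A (fun z => f z - g z).
Proof. by move=> cf cg; exact: C_on_add cf (C_on_opp cg). Qed.

Lemma C_on_contraction (h : R[i] -> R[i]) f :
  (forall a b, nr (h a - h b) <= nr (a - b)) -> C_on A f -> C_on A (fun z => h (f z)).
Proof.
move=> hc /C_onP cf; apply/C_onP => x Ax e e0.
have [d d0 xd] := cf x Ax e e0; exists d => // y Ay yx.
by apply: le_lt_trans (hc _ _) _; exact: xd.
Qed.

Lemma C_on_conj f : C_on A f -> C_on A (fun z => Num.conj (f z : R[i])).
Proof. by apply: C_on_contraction => a b; rewrite -rmorphB nr_conj. Qed.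

Lemma C_on_rcont (h : R[i] -> R) : rcont A h <-> C_on A (fun z => (h z)%:C%C).
Proof.
split=> [ch|/C_onP ch].
  apply/C_onP => x Ax e e0; have [d d0 xd] := ch x Ax e e0.
  by exists d => // y Ay yx; rewrite -rmorphB nr_real; exact: xd.
move=> x Ax e e0; have [d d0 xd] := ch x Ax e e0.
by exists d => // y Ay yx; have := xd y Ay yx; rewrite -rmorphB nr_real.
Qed.

Lemma rcont_cst (c : R) : rcont A (fun=> c).
Proof. exact/C_on_rcont/C_on_cst. Qed.

Lemma rcont_add (h k : R[i] -> R) : rcont A h -> rcont A k -> rcont A (fun z => h z + k z).
Proof.
move=> /C_on_rcont ch /C_on_rcont ck; apply/C_on_rcont.
have := C_on_add ch ck; congr (C_on A _).
by apply/funext => z; rewrite rmorphD.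
Qed.

Lemma rcont_mul (h k : R[i] -> R) : rcont A h -> rcont A k -> rcont A (fun z => h z * k z).
Proof.
move=> /C_on_rcont ch /C_on_rcont ck; apply/C_on_rcont.
have := C_on_mul ch ck; congr (C_on A _).
by apply/funext => z; rewrite rmorphM.
Qed.

Lemma rcont_lim (h : R[i] -> R) : (forall e : R, 0 < e -> exists2 k, rcont A k &
  forall t, A t -> `|h t - k t| <= e) -> rcont A h.
Proof.
move=> hl x Ax e e0; have e30 : 0 < e / 3 by rewrite divr_gt0.
have [k ck hk] := hl _ e30; have [d d0 xd] := ck x Ax _ e30.
exists d => // y Ay yx; have := xd y Ay yx; have := hk x Ax; have := hk y Ay.
by rewrite !ler_norml !ltr_norml => /andP[? ?] /andP[? ?] /andP[? ?]; apply/andP; split; lra.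
Qed.

Lemma rcont_inv (h : R[i] -> R) (d : R) : 0 < d -> (forall t, A t -> d <= h t) ->
  rcont A h -> rcont A (fun z => (h z)^-1).
Proof.
move=> d0 dh ch x Ax e e0; have [r r0 xr] := ch x Ax _ (mulr_gt0 e0 (exprn_gt0 2 d0)).
exists r => // y Ay yx; have hx := dh x Ax; have hy := dh y Ay.
have hx0 := lt_le_trans d0 hx; have hy0 := lt_le_trans d0 hy.
have -> : (h y)^-1 - (h x)^-1 = - (h y - h x) / (h x * h y).
  by field; rewrite !gt_eqF.
have xy0 : 0 < h x * h y by rewrite mulr_gt0.
rewrite normrM normrN normfV (gtr0_norm xy0) ltr_pdivrMr//.
apply: lt_le_trans (xr y Ay yx) _; rewrite ler_pM2l// expr2.
by apply: ler_pM => //; exact: ltW.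
Qed.

Lemma rcont_Re f : C_on A f -> rcont A (fun z => complex.Re (f z)).
Proof.
move=> cf; apply/C_on_rcont; apply: (C_on_contraction (h := fun a => (complex.Re a)%:C%C)) cf.
by move=> a b; rewrite -rmorphB nr_real -raddfB; exact: nr_ge_Re.
Qed.

Lemma rcont_Im f : C_on A f -> rcont A (fun z => complex.Im (f z)).
Proof.
move=> cf; apply/C_on_rcont; apply: (C_on_contraction (h := fun a => (complex.Im a)%:C%C)) cf.
by move=> a b; rewrite -rmorphB nr_real -raddfB; exact: nr_ge_Im.
Qed.

Lemma C_on_bounded f : compact A -> C_on A f ->
  exists2 M : R, 0 < M & forall t, A t -> nr (f t) <= M.
Proof.
move=> cA cf; have [M M0 fM] := rcont_bounded cA (rcont_Re cf).
have [N N0 fN] := rcont_bounded cA (rcont_Im cf).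
exists (M + N) => [|t At]; first exact: addr_gt0.
by apply: le_trans (nr_le_ReIm _) (lerD _ _); [exact: fM|exact: fN].
Qed.

End ContinuousOn.

Section FunctionalCalculus.
Variables (R : realType) (H : hilbertType R) (D : 'B(H)).
Hypothesis Dsa : adj D = D.
Let K := spectrum D.
Implicit Types f g : R[i]^o -> R[i]^o.

Lemma spectrum_compact : compact K.
Proof.
pose rc : R -> R[i]^o := fun x => x%:C%C.
have crc : continuous rc.
  move=> x; apply/cvgrPdist_lt => _ /pos_complexP[e e0 ->].
  apply: filterS (@nbhsx_ballx _ R^o x e e0) => y.
  by rewrite -ball_normE /= /rc -rmorphB nrE nr_real ltcR.
apply: subclosed_compact (continuous_compact _ (@segment_compact R (- nr D) (nr D))) _.
- exact: spectrum_closed.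
- exact: (continuous_subspaceT crc).
- move=> a sa; exists (complex.Re a); last by rewrite /rc -(spectrum_real Dsa sa).
  rewrite /= in_itv/= -ler_norml; apply: le_trans (nr_ge_Re _) _.
  exact: spectrum_bound.
Qed.

(* [T] is the value at [D] of the uniform limit [f] of polynomials. *)
Definition rep f (T : 'B(H)) := forall e : R, 0 < e -> exists p : {poly R[i]},
  (forall t, K t -> nr (p.[t] - f t) <= e) /\ nr (pev D p - T) <= e.

Lemma rep_poly (p : {poly R[i]}) : rep (fun t => p.[t]) (pev D p).
Proof.
by move=> e e0; exists p; split=> [t _|]; rewrite subrr nr0 ltW.
Qed.

(** The bound for polynomials passes to uniform limits. Applied to differences, it makes the
    operator represented by a function unique and turns uniform convergence into convergence in
    norm. *)
Lemma rep_norm f T (s : R) : 0 <= s -> rep f T -> (forall t, K t -> nr (f t) <= s) ->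
  nr T <= s.
Proof.
move=> s0 fT fs; apply: le_eps => e e0.
have [p [pf pT]] := fT (e / 2) (divr_gt0 e0 (ltr0Sn _ 1)).
have ps : nr (pev D p) <= s + e / 2.
  apply: pev_norm_le => // [|t Kt]; first by rewrite addr_ge0// divr_ge0// ltW.
  by have := nr_tri p.[t] (f t) 0; rewrite !subr0; have := pf t Kt; have := fs t Kt; lra.
by have := nr_tri T (pev D p) 0; rewrite !subr0 nrB; lra.
Qed.

Lemma rep_add f g S T : rep f S -> rep g T -> rep (fun t => f t + g t) (S + T).
Proof.
move=> fS gT e e0; have e20 : 0 < e / 2 by rewrite divr_gt0.
have [p [pf pS]] := fS _ e20; have [q [qg qT]] := gT _ e20.
exists (p + q); split=> [t Kt|].
  rewrite hornerD opprD addrACA; apply: le_trans (nrD _ _) _.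
  by have := pf t Kt; have := qg t Kt; lra.
rewrite pevD opprD addrACA; apply: le_trans (nrD _ _) _; lra.
Qed.

Lemma rep_scale (a : R[i]) f T : rep f T -> rep (fun t => a * f t) (a *: T).
Proof.
move=> fT e e0; have a0 : 0 < nr a + 1 by rewrite ltr_wpDl ?nr_ge0.
have [p [pf pT]] := fT _ (divr_gt0 e0 a0).
have bnd (r : R) : r <= e / (nr a + 1) -> nr a * r <= e.
  rewrite ler_pdivlMr// => re; have [r0|r0] := leP 0 r.
    by apply: le_trans re; rewrite mulrC ler_wpM2l// lerDl.
  by apply: le_trans (ltW e0); rewrite nmulr_lle0 ?nr_ge0.
exists (a *: p); split=> [t Kt|].
  by rewrite hornerZ -mulrBr nrM; apply: bnd; exact: pf.
by rewrite pevZ -scalerBr nrZ; exact: bnd.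
Qed.

Lemma rep_mul f g S T : C_on K f -> C_on K g -> rep f S -> rep g T ->
  rep (fun t => f t * g t) (S * T).
Proof.
move=> cf cg fS gT e e0.
have [M M0 fM] := C_on_bounded spectrum_compact cf.
have [N N0 gN] := C_on_bounded spectrum_compact cg.
pose L := M + N + nr S + nr T + 1.
have S0 := nr_ge0 S; have T0 := nr_ge0 T.
have L0 : 0 < L by rewrite /L; lra.
(* The bound 1 keeps [p] and [pev D p] below [L]; the 2 accounts for the two terms of the product
   estimate. *)
pose d := Num.min 1 (e / (L * 2)).
have d0 : 0 < d by rewrite lt_min ltr01 divr_gt0// mulr_gt0.
have d1 : d <= 1 by rewrite ge_min lexx.
have dL : d * (L * 2) <= e by rewrite -ler_pdivlMr ?mulr_gt0// ge_min lexx orbT.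
have [p [pf pS]] := fS _ d0; have [q [qg qT]] := gT _ d0.
have bnd (a b x y : R) : 0 <= a -> 0 <= y -> a <= L -> y <= L ->
    0 <= b -> 0 <= x -> b <= d -> x <= d ->
    a * b + x * y <= e.
  move=> a0 y0 aL yL b0 x0 bd xd; apply: le_trans (_ : L * d + d * L <= _); last lra.
  by apply: lerD; apply: ler_pM.
exists (p * q); split=> [t Kt|].
  rewrite hornerM.
  have -> : p.[t] * q.[t] - f t * g t = p.[t] * (q.[t] - g t) + (p.[t] - f t) * g t.
    by rewrite mulrBr mulrBl addrA subrK.
  apply: le_trans (nrD _ _) _; rewrite !nrM; apply: bnd; rewrite ?nr_ge0 ?pf ?qg//.
    have := nr_tri p.[t] (f t) 0; rewrite !subr0; have := pf t Kt; have := fM t Kt.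
    by rewrite /L; lra.
  by have := gN t Kt; rewrite /L; lra.
rewrite pevM.
have -> : pev D p * pev D q - S * T = pev D p * (pev D q - T) + (pev D p - S) * T.
  by rewrite mulrBr mulrBl addrA subrK.
apply: le_trans (nrD _ _) _; apply: le_trans (lerD (nr_opM _ _) (nr_opM _ _)) _.
apply: bnd; rewrite ?nr_ge0//; last by rewrite /L; lra.
by have := nr_tri (pev D p) S 0; rewrite !subr0 /L; lra.
Qed.

Lemma rep_conj f T : rep f T -> rep (fun t => Num.conj (f t : R[i])) (adj T).
Proof.
move=> fT e e0; have [p [pf pT]] := fT e e0.
exists (map_poly Num.conj p); split=> [t Kt|].
  rewrite -[in X in X - _](spectrum_conj Dsa Kt) horner_map/= -rmorphB nr_conj.
  exact: pf.
by rewrite -adj_pev// -adjB nr_adj.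
Qed.

Lemma rep_uniq f g S T : rep f S -> rep g T -> (forall t, K t -> f t = g t) -> S = T.
Proof.
move=> fS /(rep_scale (-1)) gT fg; apply/subr0_eq/nr_eq0/eqP.
rewrite eq_le nr_ge0 andbT -scaleN1r.
apply: (rep_norm (lexx 0) (rep_add fS gT)) => t Kt.
by rewrite fg// mulN1r subrr nr0.
Qed.

Lemma rep_lim f : (forall e : R, 0 < e -> exists g S, rep g S /\
    forall t, K t -> nr (f t - g t) <= e) -> exists T, rep f T.
Proof.
move=> fl.
have app n : exists gS : (R[i]^o -> R[i]^o) * 'B(H), rep gS.1 gS.2 /\
    forall t, K t -> nr (f t - gS.1 t) <= n.+1%:R^-1.
  have n0 : 0 < n.+1%:R^-1 :> R by rewrite invr_gt0.
  by have [g [S [gS fg]]] := fl _ n0; exists (g, S).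
have [u uP] := choice app.
have [T TP] : exists T0, forall e : R, 0 < e -> exists N, forall n, (N <= n)%N ->
    nr ((u n).2 - T0) < e.
  apply: bop_complete => e e0.
  have [N NP] := inv_nat_small (divr_gt0 e0 (ltr0Sn _ 2)).
  exists N => n m /NP nN /NP mN; apply: le_lt_trans (_ : e / 3 + e / 3 < e); last lra.
  have [rn fn] := uP n; have [rm fm] := uP m.
  have e3 : 0 <= e / 3 by rewrite divr_ge0// ltW.
  rewrite -scaleN1r; apply: (rep_norm (addr_ge0 e3 e3) (rep_add rn (rep_scale (-1) rm))) => t Kt.
  rewrite mulN1r; apply: le_trans (nr_tri _ (f t) _) (lerD _ _).
    by rewrite nrB (le_trans (fn t Kt))// ltW.
  by rewrite (le_trans (fm t Kt))// ltW.
exists T => e e0; have e30 : 0 < e / 3 by rewrite divr_gt0.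
have [N NP] := TP _ e30; have [N' N'P] := inv_nat_small e30.
pose n := maxn N N'; have := NP n (leq_maxl _ _); have := N'P n (leq_maxr _ _) => ne nT.
have [rn fn] := uP n; have [p [pu pS]] := rn _ e30; exists p; split=> [t Kt|].
  have := nr_tri p.[t] ((u n).1 t) (f t); have := le_trans (fn t Kt) (ltW ne); have := pu t Kt.
  by rewrite (nrB (f t)); lra.
by apply: le_trans (nr_tri _ (u n).2 _) (le_trans (lerD pS (ltW nT)) _); lra.
Qed.

(** The representable real functions form a uniformly closed algebra, which separates points because
    the spectrum is real and z |-> Re z agrees there with the polynomial 'X. Complex functions
    follow from real and imaginary parts. *)
Lemma rep_ex f : C_on K f -> exists T, rep f T.
Proof.
pose A := [set h : R[i] -> R | rcont K h /\ exists T, rep (fun z => (h z)%:C%C) T].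
have real_rep (h : R[i] -> R) : rcont K h -> exists T, rep (fun z => (h z)%:C%C) T.
  move=> ch; suff [] : A h by [].
  apply: (stone_weierstrass spectrum_compact) => //.
  - by move=> h' [].
  - move=> c; split; first exact: rcont_cst.
    exists (pev D (c%:C%C)%:P) => e e0; exists (c%:C%C)%:P.
    by split=> [t Kt|]; rewrite ?hornerC subrr nr0 ltW.
  - move=> h1 h2 [c1 [T1 r1]] [c2 [T2 r2]]; split; first exact: rcont_add.
    exists (T1 + T2); have := rep_add r1 r2; congr (rep _ _).
    by apply/funext => z; rewrite rmorphD.
  - move=> h1 h2 [c1 [T1 r1]] [c2 [T2 r2]]; split; first exact: rcont_mul.
    exists (T1 * T2); move: c1 c2 => /C_on_rcont c1 /C_on_rcont c2.
    have := rep_mul c1 c2 r1 r2; congr (rep _ _).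
    by apply/funext => z; rewrite rmorphM.
  - move=> h' h'l; split.
      by apply: rcont_lim => e e0; have [g [cg _] hg] := h'l e e0; exists g.
    apply: rep_lim => e e0; have [g [cg [S gS]] hg] := h'l e e0.
    exists (fun z => (g z)%:C%C), S; split=> // t Kt.
    by rewrite -rmorphB nr_real; exact: hg.
  - move=> x y Kx Ky xy; exists (fun z => complex.Re z).
      split; first by apply: rcont_Re; exact: C_on_id.
      exists (pev D 'X) => e e0; exists 'X; split=> [t Kt|]; last by rewrite subrr nr0 ltW.
      by rewrite hornerX -(spectrum_real Dsa Kt) subrr nr0 ltW.
    apply: contra xy => /eqP xy.
    by rewrite (spectrum_real Dsa Kx) (spectrum_real Dsa Ky) xy.
move=> cf; have [T1 r1] := real_rep _ (rcont_Re cf); have [T2 r2] := real_rep _ (rcont_Im cf).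
exists (T1 + 'i%C *: T2); have := rep_add r1 (rep_scale 'i%C r2); congr (rep _ _).
by apply/funext => z; rewrite -complexE.
Qed.

(** Existence of one calculus suffices: [cfc D] is then some map satisfying [is_cfc], and later
    arguments use only the fields of that record, not [rep]. *)
Theorem cfcP : is_cfc D (cfc D).
Proof.
rewrite /cfc; case: xgetP => [Phi _ //|no].
have [Phi PhiP] : exists Phi : (R[i]^o -> R[i]^o) -> 'B(H), forall f, C_on K f -> rep f (Phi f).
  have : forall f, exists T, C_on K f -> rep f T.
    move=> f; have [cf|ncf] := pselect (C_on K f); last by exists 0.
    by have [T fT] := rep_ex cf; exists T.
  by move=> ex; have [Phi PhiP] := choice ex; exists Phi.
exfalso; apply: (no Phi); split.
- move=> f g cf cg fg; apply: rep_uniq (PhiP f cf) (PhiP g cg) _ => t Kt.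
  by apply: fg; rewrite inE.
- move=> f g cf cg; apply: rep_uniq (PhiP _ (C_on_add cf cg)) (rep_add (PhiP f cf) (PhiP g cg)) _.
  by [].
- move=> a f cf; have caf := C_on_mul (@C_on_cst _ K a) cf.
  by apply: rep_uniq (PhiP _ caf) (rep_scale a (PhiP f cf)) _.
- move=> f g cf cg; apply: rep_uniq (PhiP _ (C_on_mul cf cg)) _ _.
    exact: (rep_mul cf cg (PhiP f cf) (PhiP g cg)).
  by [].
- move=> f cf; apply: rep_uniq (PhiP _ (C_on_conj cf)) (rep_conj (PhiP f cf)) _.
  by [].
- have := rep_poly 1%:P; rewrite pevC scale1r => r1.
  by apply: rep_uniq (PhiP _ (@C_on_cst _ K 1)) r1 _ => t Kt; rewrite hornerC.
- have := rep_poly 'X; rewrite pevX => rX.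
  by apply: rep_uniq (PhiP _ (@C_on_id _ K)) rX _ => t Kt; rewrite hornerX.
Qed.

End FunctionalCalculus.

Lemma rcont_comp (R : realType) (A : set R[i]^o) (phi : R -> R) (h : R[i] -> R) :
  continuous phi -> rcont A h -> rcont A (fun z => phi (h z)).
Proof.
move=> cphi ch x Ax e e0.
have /cvgrPdist_lt/(_ _ e0)/nbhs_ballP[d /= d0 hd] := cphi (h x).
have [d' d'0 xd'] := ch x Ax d d0; exists d' => // y Ay yx.
rewrite distrC; apply: hd; rewrite -ball_normE /= distrC; exact: xd'.
Qed.

(** * Positivity, and isometry of the functional calculus *)

Section Positive.
Variables (R : realType) (H : hilbertType R).
Implicit Types S T : 'B(H).

(** The quadratic form of T - T^* vanishes because <T x, x> is real; polarising with x + y and x + i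
    y makes the whole sesquilinear form vanish. *)
Lemma opos_sa T : opos T -> adj T = T.
Proof.
move=> T0; pose B := T - adj T.
have B0 x : dot (B x) x = 0.
  rewrite bopBE dotBl adjP' (dotC x) [X in _ - X]conj_Creal ?subrr//.
  exact/ger0_real/T0.
suff : B = 0 by move/subr0_eq.
apply: bop_ext => x; rewrite bop0E; apply: dot_ext => y; rewrite dot0r dotC.
apply/eqP; rewrite conjC_eq0; apply/eqP.
have : dot (B x) y + dot (B y) x = 0.
  by have := B0 (x + y); rewrite bopD dotDl !dotDr !B0 add0r addr0.
have := B0 (x + 'i%C *: y); rewrite bopD bopZ dotDl !dotDr !dotZl !dotZr !B0 !mulr0 add0r addr0.
have -> : Num.conj ('i%C : R[i]) = - 'i%C.
  by rewrite conj_pair; apply/eqP; rewrite eq_complex/= oppr0 !eqxx.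
rewrite mulNr addrC -mulrBr => /eqP; rewrite mulf_eq0 eq_complex/= oner_eq0 andbF/=.
rewrite subr_eq0 => /eqP xy; rewrite xy -mulr2n => /eqP.
by rewrite mulrn_eq0/= => /eqP.
Qed.

Lemma opos_sqr S : adj S = S -> opos (S * S).
Proof. by move=> Ssa x; rewrite -[hdot _ _]/(dot _ _) bopME -{1}Ssa -nr_adj_sqr ler0c sqr_ge0. Qed.

End Positive.

Section CalculusOfSelfAdjoint.
Variables (R : realType) (H : hilbertType R) (D : 'B(H)).
Hypothesis Dsa : adj D = D.
Let K := spectrum D.
Let Phi := cfc D.
Let PhiP : is_cfc D Phi := cfcP Dsa.
Implicit Types f g h : R[i]^o -> R[i]^o.

Lemma cfcB f g : C_on K f -> C_on K g -> Phi (fun z => f z - g z) = Phi f - Phi g.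
Proof.
move=> cf cg; rewrite (cfc_add PhiP cf (C_on_opp cg)); congr (_ + _).
rewrite -scaleN1r -(cfc_scale PhiP (-1) cg); congr (Phi _).
by apply/funext => z; rewrite mulN1r.
Qed.

Lemma cfc_cst (a : R[i]) : Phi (fun=> a) = a *: (1 : 'B(H)).
Proof.
rewrite -[1]/(oid H) -(cfc_one PhiP) -(cfc_scale PhiP a (@C_on_cst _ K 1)).
by congr (Phi _); apply/funext => z; rewrite mulr1.
Qed.

Lemma cfc_ext' f g : C_on K f -> C_on K g -> (forall t, K t -> f t = g t) -> Phi f = Phi g.
Proof. move=> cf cg fg; have fg' : {in spectrum D, f =1 g} by move=> t; rewrite inE => /fg.
exact: (cfc_ext PhiP cf cg fg'). Qed.

Lemma cfc_sa h : C_on K h -> (forall t, K t -> Num.conj (h t : R[i]) = h t) ->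
  adj (Phi h) = Phi h.
Proof.
move=> ch hr; rewrite -(cfc_conj PhiP ch); exact: cfc_ext' (C_on_conj ch) ch hr.
Qed.

Lemma C_on_sqrt (h : R[i] -> R) : rcont K h -> C_on K (fun z => (Num.sqrt (h z))%:C%C).
Proof. by move=> ch; apply/C_on_rcont; apply: rcont_comp ch; exact: sqrt_continuous. Qed.

Lemma cfc_sqrt (h : R[i] -> R) : rcont K h -> (forall t, K t -> 0 <= h t) ->
  let S := Phi (fun z => (Num.sqrt (h z))%:C%C) in
  adj S = S /\ S * S = Phi (fun z => (h z)%:C%C).
Proof.
move=> ch h0 S; have cs := C_on_sqrt ch; split.
  by apply: cfc_sa => // t _; exact: conj_real.
rewrite -[S * S](cfc_mul PhiP cs cs); apply: cfc_ext'.
- exact: C_on_mul.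
- exact/C_on_rcont.
- by move=> t Kt; rewrite -rmorphM -expr2 sqr_sqrtr// h0.
Qed.

Lemma cfc_opos (h : R[i] -> R) : rcont K h -> (forall t, K t -> 0 <= h t) ->
  opos (Phi (fun z => (h z)%:C%C)).
Proof. by move=> ch h0; have [Ssa <-] := cfc_sqrt ch h0; exact: opos_sqr. Qed.

(* |g|^2 + s^2 - |h|^2 is nonnegative on the spectrum, so its value at D is a
   positive operator. *)
Lemma cfc_dominated g h (s : R) x : C_on K g -> C_on K h ->
  (forall t, K t -> nr (h t) ^+ 2 <= nr (g t) ^+ 2 + s ^+ 2) ->
  nr (Phi h x) ^+ 2 <= nr (Phi g x) ^+ 2 + s ^+ 2 * nr x ^+ 2.
Proof.
move=> cg ch hg; pose k z := nr (g z) ^+ 2 + s ^+ 2 - nr (h z) ^+ 2.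
have ckC : C_on K (fun z => (k z)%:C%C).
  have := C_on_sub (C_on_add (C_on_mul cg (C_on_conj cg)) (@C_on_cst _ K (s ^+ 2)%:C%C))
    (C_on_mul ch (C_on_conj ch)).
  by congr (C_on K _); apply/funext => z; rewrite /k rmorphB rmorphD/= -!nr_sqr.
have kpos : opos (Phi (fun z => (k z)%:C%C)).
  by apply: cfc_opos; [exact/C_on_rcont|move=> t Kt; rewrite subr_ge0 hg].
have sq f : C_on K f -> Phi (fun z => f z * Num.conj (f z : R[i])) = adj (Phi f) * Phi f.
  move=> cf; rewrite -[X in _ = X * _](cfc_conj PhiP cf).
  rewrite -[RHS](cfc_mul PhiP (C_on_conj cf) cf); congr (Phi _).
  by apply/funext => z; rewrite mulrC.
have kE : Phi (fun z => (k z)%:C%C) =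
    adj (Phi g) * Phi g + (s ^+ 2)%:C%C *: (1 : 'B(H)) - adj (Phi h) * Phi h.
  have cgg := C_on_mul cg (C_on_conj cg); have chh := C_on_mul ch (C_on_conj ch).
  have cs := @C_on_cst _ K (s ^+ 2)%:C%C.
  rewrite -(sq g cg) -(sq h ch) -(cfc_cst (s ^+ 2)%:C%C) -(cfc_add PhiP cgg cs).
  rewrite -(cfcB (C_on_add cgg cs) chh).
  by congr (Phi _); apply/funext => z; rewrite /k rmorphB rmorphD/= !nr_sqr.
have := kpos x; rewrite kE -[hdot _ _]/(dot _ _) bopBE bopDE bopZE !bopME bop1E.
rewrite dotBl dotDl dotZl !adjP' !dotxx -rmorphM -rmorphD -rmorphB ler0c.
by rewrite subr_ge0.
Qed.

(** Domination with g = 0: the function s^2 - |h|^2 is nonnegative on the spectrum. *)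
Lemma cfc_norm_le h (s : R) : C_on K h -> 0 <= s -> (forall t, K t -> nr (h t) <= s) ->
  nr (Phi h) <= s.
Proof.
move=> ch s0 hs; apply: nr_bop_le => // x.
rewrite -ler_sqr ?nnegrE ?mulr_ge0 ?nr_ge0//.
have := @cfc_dominated (fun=> 0) h s x (@C_on_cst _ K 0) ch.
rewrite cfc_cst scale0r bop0E !nr0 expr0n/= !add0r exprMn; apply => t Kt.
by rewrite ?add0r ler_sqr ?nnegrE ?nr_ge0// hs.
Qed.

Lemma approx_eigenvector (a : R[i]) : K a -> forall c : R, 0 < c ->
  exists2 x, x != 0 & nr (D x - a *: x) < c * nr x.
Proof.
move=> /(spectrumP Dsa) nb c c0; apply: contrapT => nx; apply: nb.
exists c => // x; rewrite leNgt; apply/negP => xc; apply: nx; exists x => //.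
by apply: contraTneq xc => ->; rewrite bop0 nr0 mulr0 ltxx.
Qed.

(** An approximate eigenvector of [D] for [a] is one of h(D) for h(a), so |h(a)| |x| is at most
    |h(D) x| up to a small error. *)
Lemma cfc_norm_ge h (a : R[i]) : C_on K h -> K a -> nr (h a) <= nr (Phi h).
Proof.
move=> ch Ka; have ch' := C_on_sub ch (@C_on_cst _ K (h a)).
have [M M0 hM] := C_on_bounded (spectrum_compact Dsa) ch'.
apply: le_eps => e e0; have e20 : 0 < e / 2 by rewrite divr_gt0.
have [d d0 ad] := proj1 (C_onP _ _) ch a Ka _ e20.
(* Within [d] of [a] the difference h - h(a) is below e / 2 by continuity; farther away |g| is at
   least its bound [M]. So |h - h(a)|^2 <= |g|^2 + (e / 2)^2 everywhere on the spectrum, and g(D) is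
   a multiple of D - a. *)
pose g (z : R[i]) := ((M / d)%:C%C : R[i]) * (z - a).
have cg : C_on K g.
  exact: C_on_mul (@C_on_cst _ K _) (C_on_sub (@C_on_id _ K) (@C_on_cst _ K _)).
have Md0 : 0 < M / d by exact: divr_gt0.
have dom t : K t -> nr (h t - h a) ^+ 2 <= nr (g t) ^+ 2 + (e / 2) ^+ 2.
  move=> Kt; have [ta|ta] := ltP (nr (t - a)) d.
    apply: le_trans (_ : (e / 2) ^+ 2 <= _); last by rewrite lerDr sqr_ge0.
    by rewrite ler_sqr ?nnegrE ?nr_ge0 ?(ltW e20)// ltW// ad.
  apply: le_trans (_ : nr (g t) ^+ 2 <= _); last by rewrite lerDl sqr_ge0.
  rewrite ler_sqr ?nnegrE ?nr_ge0//; apply: le_trans (hM t Kt) _.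
  by rewrite nrM nr_real gtr0_norm// mulrAC ler_pdivlMr// ler_wpM2l// ltW.
have [x x0 xD] := approx_eigenvector Ka (divr_gt0 e20 Md0).
have x0' : 0 < nr x by rewrite nr_gt0.
have gx : nr (Phi g x) <= e / 2 * nr x.
  have -> : Phi g = (M / d)%:C%C *: (D - a *: (1 : 'B(H))).
    have c1 := C_on_sub (@C_on_id _ K) (@C_on_cst _ K a).
    rewrite [LHS](cfc_scale PhiP (M / d)%:C%C c1).
    rewrite [X in _ *: X](cfcB (@C_on_id _ K) (@C_on_cst _ K a)).
    by rewrite cfc_cst (cfc_id PhiP).
  rewrite bopZE bopBE bopZE bop1E nrZ nr_real gtr0_norm// mulrC -ler_pdivlMr//.
  by rewrite mulrAC ltW.
have := cfc_dominated x cg ch' dom; rewrite (cfcB ch (@C_on_cst _ K (h a))) cfc_cst.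
rewrite bopBE bopZE bop1E => hx.
have : nr (Phi h x - h a *: x) <= e * nr x.
  rewrite -ler_sqr ?nnegrE ?mulr_ge0 ?nr_ge0 ?(ltW e0)//; apply: le_trans hx _.
  have es := mulr_ge0 (ltW e20) (ltW x0').
  move: gx; rewrite -ler_sqr ?nnegrE ?nr_ge0// !exprMn => gx.
  have : 0 <= e ^+ 2 * nr x ^+ 2 by rewrite mulr_ge0 ?sqr_ge0.
  by lra.
move=> he; rewrite -(ler_pM2r x0') mulrDl.
have := nr_tri (h a *: x) (Phi h x) 0; rewrite !subr0 nrB nrZ.
by have := nr_bop (Phi h) x; lra.
Qed.

End CalculusOfSelfAdjoint.

(** * Existence and uniqueness of the positive square root *)

Section SquareRoot.
Variables (R : realType) (H : hilbertType R).
Implicit Types S T : 'B(H).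

Lemma opos_spectrum T t : opos T -> spectrum T t -> 0 <= complex.Re t.
Proof.
move=> T0 st; have Tsa := opos_sa T0; rewrite leNgt; apply/negP => t0.
have {}st := st; move: (st) => /(spectrumP Tsa); apply.
exists (- complex.Re t) => [|x]; first by rewrite oppr_gt0.
have [->|x0] := eqVneq x 0; first by rewrite nr0 mulr0 nr_ge0.
rewrite -(ler_pM2r (x := nr x)) ?nr_gt0//; apply: le_trans (cauchy_schwarz _ _).
apply: le_trans (le_trans (ler_norm _) (nr_ge_Re _)).
rewrite bopBE bopZE bop1E dotBl dotZl dotxx {2}(spectrum_real Tsa st) -rmorphM raddfB/=.
have : 0 <= complex.Re (dot (T x) x) by rewrite -ler0c RRe_real ?T0// ger0_real ?T0.
by lra.
Qed.

Lemma osqrtP T : opos T -> opos (osqrt T) /\ osqrt T * osqrt T = T.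
Proof.
move=> T0; have Tsa := opos_sa T0.
rewrite /osqrt; case: xgetP => [S _ //|no]; exfalso.
have cRe : rcont (spectrum T) (fun z => complex.Re z) by apply: rcont_Re; exact: C_on_id.
have [Ssa SS] := cfc_sqrt Tsa cRe (fun t st => opos_spectrum T0 st).
set S := cfc T _ in Ssa SS.
apply: (no S); split.
  apply: (cfc_opos Tsa (h := fun z => Num.sqrt (complex.Re z))).
    by apply: rcont_comp cRe; exact: sqrt_continuous.
  by move=> t _; exact: sqrtr_ge0.
rewrite -[_ \ob _]/(S * S) SS -[RHS](cfc_id (cfcP Tsa)); apply: (cfc_ext' Tsa).
- exact/C_on_rcont.
- exact: C_on_id.
- by move=> t st; rewrite -(spectrum_real Tsa st).
Qed.

(* No commutation is needed: with D := S - T and G := S + T, one has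
   G D + D G = 0 and |<D x, x>| <= <G x, x>, so that an approximate eigenvector
   of D for an eigenvalue a with |a| = |D| forces a = 0. *)
Lemma osqrt_uniq S T : opos S -> opos T -> S * S = T * T -> S = T.
Proof.
move=> S0 T0 ST; have Ssa := opos_sa S0; have Tsa := opos_sa T0.
apply/eqP; rewrite -subr_eq0; apply: contrapT => /negP D0.
pose D := S - T; pose G := S + T.
have Dsa : adj D = D by rewrite adjB Ssa Tsa.
have Gsa : adj G = G by rewrite adjD Ssa Tsa.
have [x0 x00] : exists x : H, x != 0.
  apply: contrapT => nx; move/negP: D0; apply; apply/eqP; apply: bop_ext => x.
  have [->|x0] := eqVneq x 0; first by rewrite bop0.
  by case: nx; exists x.
(* The polynomial 'X yields a spectral point of modulus |D|. *)
have [a sa] := pev_attains Dsa 'X (ex_intro _ x0 x00); rewrite pevX hornerX => naD.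
have aE := spectrum_real Dsa sa; set r := complex.Re a in aE.
(* The sum is 2 (S^2 - T^2); the mixed products cancel. *)
have anti x : G (D x) + D (G x) = 0.
  have STx : S (S x) = T (T x) by rewrite -[LHS]/((S * S) x) ST.
  by rewrite /G /D !(bopDE, bopNE) !(bopD, bopN) STx; vring.
have GE x : G x = S x + T x by [].
have DE x : D x = S x - T x by [].
have naD0 : 0 < nr D by rewrite nr_gt0.
have r0 : 0 < `|r| by rewrite -nr_real -aE naD.
clearbody G D.
have key c : 0 < c -> c <= 1 -> `|r| ^+ 2 <= c * (nr G + `|r|).
  move=> c0 c1; have [x x_neq0 xD] := approx_eigenvector Dsa sa c0.
  have x2 : 0 < nr x ^+ 2 by rewrite exprn_gt0// nr_gt0.
  pose gx := complex.Re (dot (G x) x); pose e := D x - a *: x.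
  have dS y : dot (S y) y = (complex.Re (dot (S y) y))%:C%C by rewrite RRe_real// ger0_real// S0.
  have dT y : dot (T y) y = (complex.Re (dot (T y) y))%:C%C by rewrite RRe_real// ger0_real// T0.
  have posS : 0 <= complex.Re (dot (S x) x) by rewrite -ler0c -dS; exact: S0.
  have posT : 0 <= complex.Re (dot (T x) x) by rewrite -ler0c -dT; exact: T0.
  have De : D x = a *: x + e by rewrite /e addrC subrK.
  have ex : nr e <= c * nr x by rewrite ltW.
  have gxE : dot (G x) x = gx%:C%C by rewrite /gx GE dotDl dS dT -rmorphD.
  clearbody e.
  (* Pairing G D + D G = 0 with [x] gives Re <D x, G x> = 0; then substitute D x = r x + e. *)
  have dGe : complex.Re (dot e (G x)) = - (r * gx).
    have : dot (D x) (G x) + dot (G x) (D x) = 0.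
      rewrite -[in X in X + _]Gsa -[in X in _ + X]Dsa -!adjP.
      by rewrite -dotDl anti dot0l.
    rewrite De dotDl dotDr dotZl dotZr [dot x (G x)]dotC gxE conj_real aE conj_real.
    rewrite [dot (G x) e]dotC.
    case: (dot e (G x)) => u v /(congr1 (@complex.Re R)) /=.
    by rewrite !mul0r !subr0; lra.
  have bound1 : `|r| * gx <= c * nr G * nr x ^+ 2.
    have -> : `|r| * gx = `|complex.Re (dot e (G x))|.
      by rewrite dGe normrN normrM [X in _ = _ * X]ger0_norm// /gx GE dotDl raddfD addr_ge0.
    apply: le_trans (nr_ge_Re _) _; apply: le_trans (cauchy_schwarz _ _) _.
    rewrite (_ : c * nr G * nr x ^+ 2 = (c * nr x) * (nr G * nr x)); last by ring.
    by rewrite ler_pM ?nr_ge0// nr_bop.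
  have bound2 : `|r| * nr x ^+ 2 <= gx + c * nr x ^+ 2.
    have Dx : `|complex.Re (dot (D x) x)| <= gx.
      by rewrite /gx DE GE dotBl dotDl raddfB raddfD/= ler_norml; apply/andP; split; lra.
    have xe : `|complex.Re (dot e x)| <= c * nr x ^+ 2.
      apply: le_trans (nr_ge_Re _) _; apply: le_trans (cauchy_schwarz _ _) _.
      by rewrite expr2 mulrA ler_wpM2r ?nr_ge0.
    have : complex.Re (dot (D x) x) = r * nr x ^+ 2 + complex.Re (dot e x).
      by rewrite De dotDl dotZl dotxx aE -rmorphM raddfD.
    have <- : `|r * nr x ^+ 2| = `|r| * nr x ^+ 2 by rewrite normrM (gtr0_norm x2).
    move: Dx xe.
    by rewrite !ler_norml => /andP[? ?] /andP[? ?] ?; apply/andP; split; lra.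
  rewrite -(ler_pM2r x2).
  have : `|r| * (`|r| * nr x ^+ 2) <= `|r| * (gx + c * nr x ^+ 2) by rewrite ler_wpM2l.
  by lra.
have L0 : 0 < nr G + `|r| by rewrite ltr_wpDl ?nr_ge0.
(* With this choice [key] would give r^2 <= r^2 / 2. *)
pose c := Num.min 1 (`|r| ^+ 2 / (2 * (nr G + `|r|))).
have c0 : 0 < c by rewrite lt_min ltr01 divr_gt0 ?mulr_gt0 ?exprn_gt0.
have := key c c0; rewrite ge_min lexx => /(_ isT).
have : c * (2 * (nr G + `|r|)) <= `|r| ^+ 2.
  by rewrite -ler_pdivlMr ?mulr_gt0// ge_min lexx orbT.
have : 0 < `|r| ^+ 2 by rewrite exprn_gt0.
by lra.
Qed.

End SquareRoot.

(** * The matched projection *)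

Section OrthogonalProjection.
Variables (R : realType) (H : hilbertType R) (M : closed_subspace H).

Lemma dot_val (x y : csub M) : dot (cs_val x) (cs_val y) = dot x y.
Proof. by []. Qed.

Lemma nr_val (x : csub M) : nr (cs_val x) = nr x.
Proof. by []. Qed.

Lemma oproj_spec x (y : csub M) : dot (x - cs_val (oproj M x)) (cs_val y) = 0.
Proof.
rewrite /oproj; case: xgetP => [P _ PP|no]; first exact: PP.
exfalso; have [g gP0] := choice (projection_ex M).
have gP x' (w : csub M) : dot (x' - cs_val (g x')) (cs_val w) = 0 := gP0 x' w.
have uniq x' (z : csub M) : (forall y : csub M, dot (x' - cs_val z) (cs_val y) = 0) -> g x' = z.
  move=> zP; apply: dot_extl => w; apply/eqP; rewrite -subr_eq0 -!dot_val -dotBl; apply/eqP.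
  have -> : cs_val (g x') - cs_val z = (x' - cs_val z) - (x' - cs_val (g x')).
    by vring.
  by rewrite dotBl zP gP subr0.
have lg : linear g.
  move=> a u v; apply: uniq => w.
  have -> : cs_val (a *: g u + g v) = a *: cs_val (g u) + cs_val (g v) by [].
  rewrite opprD addrACA -scalerBr dotDl dotZl.
  by rewrite !gP mulr0 addr0.
have [|P PE] := @bop_make _ _ _ g 1 lg; last by apply: (no P) => x' y'; rewrite PE; exact: gP.
move=> x'; rewrite mul1r -ler_sqr ?nnegrE ?nr_ge0//.
rewrite -[x' in leRHS](subrK (cs_val (g x'))) nr_sqrD.
by rewrite gP mul0rn addr0 nr_val lerDr sqr_ge0.
Qed.

Lemma oproj_uniq x (z : csub M) : (forall y : csub M, dot (x - cs_val z) (cs_val y) = 0) ->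
  oproj M x = z.
Proof.
move=> zP; apply: dot_extl => w; apply/eqP; rewrite -subr_eq0 -!dot_val -dotBl; apply/eqP.
have -> : cs_val (oproj M x) - cs_val z = (x - cs_val z) - (x - cs_val (oproj M x)).
  by vring.
by rewrite dotBl zP oproj_spec subr0.
Qed.

Lemma oproj_val (z : csub M) : oproj M (cs_val z) = z.
Proof. by apply: oproj_uniq => y; rewrite subrr dot0l. Qed.

Lemma oproj_dot x (y : csub M) : dot (oproj M x) y = dot x (cs_val y).
Proof. by apply/eqP; rewrite eq_sym -subr_eq0 -dot_val -dotBl oproj_spec. Qed.

Lemma adj_oprojE (y : csub M) : adj (oproj M) y = cs_val y.
Proof. by apply: dot_ext => x; rewrite -adjP oproj_dot. Qed.

Lemma oproj_orth x : (forall y, cs_set M y -> dot x y = 0) -> oproj M x = 0.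
Proof.
by move=> xM; apply: oproj_uniq => y; rewrite subr0; apply: xM; exact: csub_mem.
Qed.

End OrthogonalProjection.

Lemma dot_closure (R : realType) (H : hilbertType R) (S : set H) x y :
  closure S y -> (forall s, S s -> dot x s = 0) -> dot x y = 0.
Proof.
move=> /closureP Sy xS; apply: nr_eq0; apply/eqP; rewrite eq_le nr_ge0 andbT.
apply: le_eps => e e0; rewrite add0r.
have x1 : 0 < nr x + 1 by rewrite ltr_wpDl ?nr_ge0.
have [s Ss ys] := Sy _ (divr_gt0 e0 x1).
rewrite -[y](subrK s) dotDr (xS s Ss) addr0; apply: le_trans (cauchy_schwarz _ _) _.
move: ys; rewrite ltr_pdivlMr// => /ltW; apply: le_trans.
by rewrite mulrC ler_wpM2l ?nr_ge0// lerDl.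
Qed.

Lemma bop_closure (R : realType) (H K : hilbertType R) (T : 'B(H, K)) (S : set H) y :
  closure S y -> (forall s, S s -> T s = 0) -> T y = 0.
Proof.
move=> Sy TS; apply: dot_extl => z; rewrite dot0l adjP dotC.
by rewrite (dot_closure Sy) ?conjC0// => s Ss; rewrite adjP' TS// dot0r.
Qed.

Section OperatorLemmas.
Variables (R : realType) (H : hilbertType R).
Implicit Types S T X Y : 'B(H).

Lemma adj_mul_eq0 T : adj T * T = 0 -> T = 0.
Proof.
move=> TT; apply: bop_ext => x; apply: dot0_eq0.
by rewrite -adjP' -bopME TT bop0E dot0l.
Qed.

Lemma opos_dot_eq0 T x : opos T -> dot (T x) x = 0 -> T x = 0.
Proof.
move=> /osqrtP[S0 <-]; have Ssa := opos_sa S0.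
by rewrite !bopME -{1}Ssa adjP' => /dot0_eq0 ->; rewrite bop0.
Qed.

Lemma op_inv_spec T : (exists S, S * T = 1 /\ T * S = 1) ->
  op_inv T * T = 1 /\ T * op_inv T = 1.
Proof.
move=> [S STS]; rewrite /op_inv; case: xgetP => [S' _ //|no].
by case: (no S).
Qed.

Definition penrose T X :=
  [/\ T * X * T = T, X * T * X = X, adj (T * X) = T * X & adj (X * T) = X * T].

(** [T * X] and [T * Y] are self-adjoint idempotents with the range of [T], hence equal; likewise
    [X * T] and [Y * T]. *)
Lemma penrose_uniq T X Y : penrose T X -> penrose T Y -> X = Y.
Proof.
move=> [X1 X2 X3 X4] [Y1 Y2 Y3 Y4].
have TXY : T * X = T * Y.
  have e : T * X = (T * Y) * (T * X) by rewrite mulrA Y1.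
  by rewrite -[LHS]X3 e adjM X3 Y3 mulrA X1.
have XTY : X * T = Y * T.
  have e : X * T = (X * T) * (Y * T) by rewrite -mulrA (mulrA T) Y1.
  by rewrite -[LHS]X4 e adjM X4 Y4 -mulrA (mulrA T) X1.
by rewrite -X2 XTY -mulrA TXY mulrA.
Qed.

Lemma mp_invE T X : penrose T X -> mp_inv T = X.
Proof.
move=> TX; rewrite /mp_inv; case: xgetP => [Y _ TY|no]; last by case: (no X).
exact: penrose_uniq TY TX.
Qed.

End OperatorLemmas.

Section MatchedProjection.
Variables (R : realType) (H : hilbertType R) (Q : 'B(H)).
Hypothesis QQ : Q * Q = Q.
Let q := adj Q.
Let A := oabs q.

Let A0 : opos A /\ A * A = Q * q.
Proof.
rewrite /A /oabs /q adjK; apply: osqrtP => x.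
by rewrite -[hdot _ _]/(dot _ _) /= adjP dotxx ler0c sqr_ge0.
Qed.

Let Asa : adj A = A. Proof. exact/opos_sa/(proj1 A0). Qed.
Let AA : A * A = Q * q := proj2 A0.

Let qq : q * q = q. Proof. by rewrite /q -adjM QQ. Qed.

Let QA : Q * A = A.
Proof.
suff : A * (1 - q) = 0.
  move=> /(congr1 (@adj _ _ _)); rewrite adj0 adjM adjB adj1 adjK Asa mulrBl mul1r.
  by move/subr0_eq.
apply: adj_mul_eq0; rewrite adjM adjB adj1 adjK Asa -mulrA (mulrA A) AA.
by rewrite -mulrA (mulrBr q) mulr1 qq subrr !mulr0.
Qed.

Let Aq : A * q = A. Proof. by rewrite -[in LHS]Asa -adjM QA. Qed.

Let rQ : range Q = [set x | Q x = x].
Proof.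
apply/seteqP; split=> [_ [y _ <-]|x /= <-]; last by exists x.
by rewrite /= -bopME QQ.
Qed.

Let N_submod : submod_closed (mem (range Q)).
Proof.
split=> [|a x y]; first by rewrite inE; exists 0 => //; exact: bop0.
by rewrite !inE => -[u _ <-] [v _ <-]; exists (a *: u + v) => //; rewrite bopD bopZ.
Qed.

Let N_closed : closed (range Q).
Proof.
rewrite rQ => y cly /=; have : (Q - 1) y = 0.
  by apply: (bop_closure cly) => s Qs; rewrite bopBE bop1E [Q s]Qs subrr.
by rewrite bopBE bop1E => /subr0_eq.
Qed.

Let N := ClosedSubspace N_submod N_closed.
(** The orthogonal projection onto the range of [Q], as an operator on [H]: [adj (oproj N)] is the
    inclusion. *)
Let P : 'B(H) := adj (oproj N) \ob oproj N.

Let PE x : P x = cs_val (oproj N x). Proof. by rewrite -adj_oprojE. Qed.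
Let Psa : adj P = P. Proof. by rewrite adj_comp adjK. Qed.
Let QP : Q * P = P.
Proof.
apply: bop_ext => x; rewrite bopME PE.
by have := csub_mem (oproj N x); rewrite [cs_set N]rQ.
Qed.
Let PQ : P * Q = Q.
Proof.
apply: bop_ext => x; rewrite bopME PE.
have Qx : Q x \in cs_pred N by rewrite inE; exists x.
by rewrite -[Q x]/(cs_val (CSub Qx)) oproj_val.
Qed.
Let PP : P * P = P. Proof. by rewrite -{2}QP mulrA PQ QP. Qed.
Let PA : P * A = A. Proof. by rewrite -[in LHS]QA mulrA PQ. Qed.
Let AP : A * P = A. Proof. by rewrite -[in LHS]Asa -[in LHS]Psa -adjM PA. Qed.

Let nrA x : nr (A x) = nr (q x).
Proof.
apply/eqP; rewrite -(eqrXn2 (n := 2)) ?nr_ge0//; apply/eqP/(@complexI R).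
by rewrite !nr_adj_sqr Asa -!bopME AA /q adjK.
Qed.

(* A vanishes on the complement of the range of Q and is bounded below on that
   range, so the inverse of A + (1 - P) gives the Moore-Penrose inverse of A. *)
Let W_ex : exists W, W * (A + (1 - P)) = 1 /\ (A + (1 - P)) * W = 1.
Proof.
have Tsa : adj (A + (1 - P)) = A + (1 - P) by rewrite adjD adjB adj1 Asa Psa.
apply: bbelow_invertible; first by rewrite Tsa.
exists 1 => // x; rewrite mul1r -ler_sqr ?nnegrE ?nr_ge0// bopDE nr_sqrD.
have perp y : dot (P y) ((1 - P) x) = 0.
  by rewrite -{1}Psa adjP' -bopME mulrBr mulr1 PP subrr bop0E dot0r.
have -> : dot (A x) ((1 - P) x) = 0 by rewrite -PA bopME perp.
have -> : nr x ^+ 2 = nr (P x) ^+ 2 + nr ((1 - P) x) ^+ 2.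
  rewrite -[in LHS](_ : P x + (1 - P) x = x) ?nr_sqrD ?perp ?mul0rn ?addr0//.
  by rewrite bopBE bop1E addrC subrK.
rewrite mul0rn addr0 lerD2r ler_sqr ?nnegrE ?nr_ge0// -AP bopME nrA.
have [->|Px0] := eqVneq (P x) 0; first by rewrite nr0 nr_ge0.
(* As Q P = P, |P x|^2 = <P x, Q^* P x> up to conjugation, so Cauchy-Schwarz gives |P x| <= |Q^* P
   x| = |A P x|; this is the lower bound 1. *)
rewrite -(ler_pM2l (x := nr (P x))) ?nr_gt0//; apply: le_trans (cauchy_schwarz _ _).
rewrite -/q /q -adjP -bopME QP -expr2 dotxx nr_real.
exact: ler_norm.
Qed.

Let X := mp_inv A.

Let X_spec : [/\ A * X = P, X * A = P, X * P = X & P * X = X].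
Proof.
have [W [WT TW]] := W_ex.
have WA : W * A = P.
  have TP : (A + (1 - P)) * P = A by rewrite mulrDl AP mulrBl mul1r PP subrr addr0.
  by rewrite -TP mulrA WT mul1r.
have AW : A * W = P.
  have PT : P * (A + (1 - P)) = A by rewrite mulrDr PA mulrBr mulr1 PP subrr addr0.
  by rewrite -PT -mulrA TW mulr1.
have PW : P * W = W * P by rewrite -{1}WA -mulrA AW.
have XE : X = W * P.
  apply: mp_invE; split.
  - by rewrite (mulrA A) AW PP PA.
  - by rewrite -(mulrA W) PA WA mulrA PW -mulrA PP.
  - by rewrite mulrA AW PP.
  - by rewrite -mulrA PA WA.
rewrite XE; split.
- by rewrite mulrA AW PP.
- by rewrite -mulrA PA WA.
- by rewrite -mulrA PP.
- by rewrite mulrA PW -mulrA PP.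
Qed.

Let Z := op_inv (A + 1).

Let Z_spec : Z * (A + 1) = 1 /\ (A + 1) * Z = 1.
Proof.
apply: op_inv_spec; have Tsa : adj (A + 1) = A + 1 by rewrite adjD adj1 Asa.
apply: bbelow_invertible; first by rewrite Tsa.
exists 1 => // x; rewrite mul1r; have [->|x0] := eqVneq x 0; first by rewrite nr0 nr_ge0.
rewrite -(ler_pM2r (x := nr x)) ?nr_gt0//; apply: le_trans (cauchy_schwarz _ _).
apply: le_trans (le_trans (ler_norm _) (nr_ge_Re _)).
rewrite bopDE bop1E dotDl dotxx raddfD/= -expr2 lerDr -ler0c RRe_real ?(proj1 A0)//.
by rewrite ger0_real// (proj1 A0).
Qed.

Let m := matched_projection Q.

Let mE : m = (2 : R[i])^-1 *: ((A + q) * X * Z * (A + Q)).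
Proof. by rewrite /m /matched_projection. Qed.

Let two_m : (2 : R[i]) *: m = (A + q) * X * Z * (A + Q).
Proof. by rewrite mE scalerA divff ?pnatr_eq0// scale1r. Qed.

(* The witness [B] is |Q^*|. *)
Lemma matched_projection_spec : exists2 B : 'B(H), opos B &
  [/\ adj m = m, m * m = m, B * m = Q * m, (2 : R[i]) *: (Q * m) = B + Q &
      forall x, m x = x -> B x = 0 -> x = 0].
Proof.
have [AX XA XP PX] := X_spec; have [ZA AZ] := Z_spec.
have half (S T : 'B(H)) : (2 : R[i]) *: S = (2 : R[i]) *: T -> S = T.
  by move/(scalerI _); apply; rewrite pnatr_eq0.
have XZ : X * Z = Z * X.
  rewrite -[X in LHS]mul1r -ZA -!mulrA; congr (Z * _).
  by rewrite mulrA mulrDl mul1r AX -{1}XA -{2}[X]mulr1 -mulrDr -mulrA AZ mulr1.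
have Xsa : adj X = X.
  have h1 : adj X * A = P by rewrite -[in LHS]Asa -adjM AX.
  rewrite -[RHS]PX -h1 -mulrA AX; apply/esym.
  by rewrite -[P in LHS]Psa -adjM PX.
have Zsa : adj Z = Z.
  have A1sa : adj (A + 1) = A + 1 by rewrite adjD adj1 Asa.
  have h1 : adj Z * (A + 1) = 1 by rewrite -[X in _ * X]A1sa -adjM AZ adj1.
  by rewrite -[LHS]mulr1 -AZ mulrA h1 mul1r.
have Ssa : adj (X * Z) = X * Z by rewrite adjM Xsa Zsa XZ.
have msa : adj m = m.
  apply: half; rewrite -[in LHS](conjC_nat _ 2) -adjZ two_m -(mulrA (A + q)).
  by rewrite adjM (adjM (A + q)) Ssa !adjD Asa /q adjK mulrA.
have QE : Q * (A + q) = A * (A + 1) by rewrite mulrDr QA mulrDr mulr1 AA addrC.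
have PAQ : P * (A + Q) = A + Q by rewrite mulrDr PA PQ.
(* [X] inverts [A] on the range of [Q] and [Z] inverts [A + 1], so the first four factors reduce to
   [P], which fixes [A + Q]. *)
have cancel : A * (A + 1) * X * Z * (A + Q) = A + Q.
  have -> : A * (A + 1) * X * Z = A * ((A + 1) * X * Z) by rewrite !mulrA.
  have -> : (A + 1) * X * Z = X.
    by rewrite mulrDl mul1r AX -[P]XA -{2}[X]mulr1 -mulrDr -mulrA AZ mulr1.
  by rewrite AX PAQ.
have twoQm : (2 : R[i]) *: (Q * m) = A + Q.
  by rewrite -bopZMr two_m !mulrA QE cancel.
have AQm : (A + Q) * m = A + Q.
  apply: half; rewrite -bopZMr two_m !mulrA.
  have -> : (A + Q) * (A + q) = (2 : R[i]) *: (A * (A + 1)).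
    by rewrite mulrDl QE mulrDr Aq mulrDr mulr1 scaler_nat mulr2n.
  by rewrite !bopZMl cancel.
have mm : m * m = m by apply: half; rewrite -bopZMl two_m -mulrA AQm.
have twomA : (2 : R[i]) *: (m * A) = A + q.
  rewrite -bopZMl two_m -mulrA (mulrDl A Q) QA.
  have -> : A * A + A = (A + 1) * A by rewrite mulrDl mul1r.
  rewrite -[LHS]mulrA (mulrA Z) ZA mul1r -mulrA XA mulrDl AP; congr (_ + _).
  by rewrite /q -{1}Psa -adjM PQ.
(* Both doubles equal [A + Q]: one by [twoQm], the other as the adjoint of [twomA]. *)
have Am : A * m = Q * m.
  apply: half; rewrite twoQm -[X in X * m]Asa -[X in _ * X]msa -adjM.
  by rewrite -[2](conjC_nat _ 2) -adjZ twomA adjD Asa /q adjK.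
exists A; first exact: (proj1 A0).
split=> // x mx Ax.
(* For m x = x, 2 Q x = 2 A x = 0. As 2 m factors through [A + Q] on the right, it follows that m x
   = 0. *)
have : (A + Q) x = 0 by rewrite -twoQm bopZE bopME mx -mx -bopME -Am bopME mx Ax scaler0.
move=> AQx; rewrite -mx; apply: (scalerI (a := (2 : R[i]))); first by rewrite pnatr_eq0.
by rewrite -bopZE two_m bopME AQx bop0 scaler0.
Qed.

End MatchedProjection.

(** * Block operators and the canonical decomposition *)

Section Blocks.
Variable R : realType.
Implicit Types H K L M N : hilbertType R.

Lemma dot_pair H K (x y : hsum H K) : dot x y = dot x.1 y.1 + dot x.2 y.2.
Proof. by []. Qed.

Lemma ocompE H K L (S : 'B(K, L)) (T : 'B(H, K)) x : (S \ob T) x = S (T x).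
Proof. by []. Qed.

Lemma oblockE H1 H2 K1 K2 (A : 'B(H1, K1)) (B : 'B(H2, K1)) (C : 'B(H1, K2)) (D : 'B(H2, K2)) x :
  oblock A B C D x = (A x.1 + B x.2, C x.1 + D x.2) :> hsum K1 K2.
Proof. by []. Qed.

Lemma adj_opair H K L (A : 'B(H, K)) (B : 'B(H, L)) (y : hsum K L) :
  adj (opair A B) y = adj A y.1 + adj B y.2.
Proof. by apply: dot_ext => x; rewrite -adjP dot_pair dotDr -!adjP. Qed.

Lemma oblock_comp H1 H2 K1 K2 L1 L2
    (A : 'B(K1, L1)) (B : 'B(K2, L1)) (C : 'B(K1, L2)) (D : 'B(K2, L2))
    (A' : 'B(H1, K1)) (B' : 'B(H2, K1)) (C' : 'B(H1, K2)) (D' : 'B(H2, K2)) :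
  oblock A B C D \ob oblock A' B' C' D' =
  oblock (A \ob A' + B \ob C') (A \ob B' + B \ob D')
         (C \ob A' + D \ob C') (C \ob B' + D \ob D').
Proof.
apply: bop_ext => x; rewrite ocompE !oblockE.
by congr (_, _); rewrite !bopDE !ocompE !bopD addrACA.
Qed.

Lemma oblockD H1 H2 K1 K2
    (A A' : 'B(H1, K1)) (B B' : 'B(H2, K1)) (C C' : 'B(H1, K2)) (D D' : 'B(H2, K2)) :
  oblock A B C D + oblock A' B' C' D' = oblock (A + A') (B + B') (C + C') (D + D').
Proof.
apply: bop_ext => x; rewrite bopDE !oblockE.
by congr (_, _); rewrite !bopDE addrACA.
Qed.

Lemma oblockZ H1 H2 K1 K2 (a : R[i])
    (A : 'B(H1, K1)) (B : 'B(H2, K1)) (C : 'B(H1, K2)) (D : 'B(H2, K2)) :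
  a *: oblock A B C D = oblock (a *: A) (a *: B) (a *: C) (a *: D).
Proof.
apply: bop_ext => x; rewrite bopZE !oblockE.
by congr (_, _); rewrite scalerDr.
Qed.

Lemma adj_oblock H1 H2 K1 K2
    (A : 'B(H1, K1)) (B : 'B(H2, K1)) (C : 'B(H1, K2)) (D : 'B(H2, K2)) :
  adj (oblock A B C D) = oblock (adj A) (adj C) (adj B) (adj D).
Proof.
apply: adj_uniq => x y; rewrite !oblockE !dot_pair /= !dotDl !dotDr -!adjP.
by rewrite addrACA.
Qed.

Lemma odsum_comp H1 H2 K1 K2 L1 L2 (A : 'B(K1, L1)) (D : 'B(K2, L2))
    (A' : 'B(H1, K1)) (D' : 'B(H2, K2)) :
  odsum A D \ob odsum A' D' = odsum (A \ob A') (D \ob D').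
Proof.
rewrite /odsum oblock_comp; congr oblock; apply: bop_ext => x.
- by rewrite bopDE ocompE bop0E addr0.
- by rewrite bopDE !ocompE !bop0E bop0 addr0.
- by rewrite bopDE !ocompE !bop0E bop0 addr0.
- by rewrite bopDE !ocompE bop0E add0r.
Qed.

Lemma odsumD H1 H2 K1 K2 (A A' : 'B(H1, K1)) (D D' : 'B(H2, K2)) :
  odsum A D + odsum A' D' = odsum (A + A') (D + D').
Proof. by rewrite /odsum oblockD !addr0. Qed.

Lemma odsumZ H1 H2 K1 K2 (a : R[i]) (A : 'B(H1, K1)) (D : 'B(H2, K2)) :
  a *: odsum A D = odsum (a *: A) (a *: D).
Proof. by rewrite /odsum oblockZ !scaler0. Qed.

Lemma adj_odsum H1 H2 K1 K2 (A : 'B(H1, K1)) (D : 'B(H2, K2)) :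
  adj (odsum A D) = odsum (adj A) (adj D).
Proof. by rewrite /odsum adj_oblock !adj0. Qed.

Lemma odsum_oid H K : odsum (oid H) (oid K) = oid (hsum H K).
Proof.
apply: bop_ext => -[x y]; rewrite oblockE.
by congr (_, _); rewrite !bop0E ?addr0 ?add0r.
Qed.

Lemma ounitary_odsum H1 H2 K1 K2 (A : 'B(H1, K1)) (D : 'B(H2, K2)) :
  ounitary A -> ounitary D -> ounitary (odsum A D).
Proof.
by move=> [A1 A2] [D1 D2]; split; rewrite adj_odsum odsum_comp ?A1 ?A2 ?D1 ?D2 odsum_oid.
Qed.

Lemma ounitary_oid H : ounitary (oid H).
Proof. by split; rewrite adj_oid; apply: bop_ext. Qed.

Lemma ounitary_adj H K (A : 'B(H, K)) : ounitary A -> ounitary (adj A).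
Proof. by move=> [A1 A2]; split; rewrite adjK. Qed.

Lemma ounitary_comp H K L (A : 'B(K, L)) (B : 'B(H, K)) :
  ounitary A -> ounitary B -> ounitary (A \ob B).
Proof.
move=> [A1 A2] [B1 B2]; split; rewrite adj_comp; apply: bop_ext => x.
  by rewrite -[LHS]/(adj B ((adj A \ob A) (B x))) A1 -[LHS]/((adj B \ob B) x) B1.
by rewrite -[LHS]/(A ((B \ob adj B) (adj A x))) B2 -[LHS]/((A \ob adj A) x) A2.
Qed.

Lemma nr_hsum1 H K (x : hsum H K) : nr x.1 <= nr x.
Proof. by rewrite -lecR -!nrE hs_norm1. Qed.
Lemma nr_hsum2 H K (x : hsum H K) : nr x.2 <= nr x.
Proof. by rewrite -lecR -!nrE hs_norm2. Qed.
Lemma nr_hsum_le H K (x : hsum H K) : nr x <= nr x.1 + nr x.2.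
Proof. by rewrite -lecR rmorphD/= -!nrE hs_norm_le. Qed.

Lemma nr_hsum_inl H K (x : H) : nr ((x, 0) : hsum H K) = nr x.
Proof.
apply/le_anti; rewrite (nr_hsum1 ((x, 0) : hsum H K)) andbT.
by apply: le_trans (nr_hsum_le _) _; rewrite /= nr0 addr0.
Qed.
Lemma nr_hsum_inr H K (x : K) : nr ((0, x) : hsum H K) = nr x.
Proof.
apply/le_anti; rewrite (nr_hsum2 ((0, x) : hsum H K)) andbT.
by apply: le_trans (nr_hsum_le _) _; rewrite /= nr0 add0r.
Qed.

Section BlockNorm.
Variables (H1 H2 K1 K2 : hilbertType R).
Variables (A : 'B(H1, K1)) (B : 'B(H2, K1)) (C : 'B(H1, K2)) (D : 'B(H2, K2)).

Lemma nr_oblock11 : nr A <= nr (oblock A B C D).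
Proof.
apply: nr_bop_le => [|x]; first exact: nr_ge0.
have := nr_bop (oblock A B C D) (x, 0); rewrite nr_hsum_inl; apply: le_trans.
by apply: le_trans (nr_hsum1 _); rewrite oblockE /= bop0 addr0.
Qed.
Lemma nr_oblock12 : nr B <= nr (oblock A B C D).
Proof.
apply: nr_bop_le => [|x]; first exact: nr_ge0.
have := nr_bop (oblock A B C D) (0, x); rewrite nr_hsum_inr; apply: le_trans.
by apply: le_trans (nr_hsum1 _); rewrite oblockE /= bop0 add0r.
Qed.
Lemma nr_oblock21 : nr C <= nr (oblock A B C D).
Proof.
apply: nr_bop_le => [|x]; first exact: nr_ge0.
have := nr_bop (oblock A B C D) (x, 0); rewrite nr_hsum_inl; apply: le_trans.
by apply: le_trans (nr_hsum2 _); rewrite oblockE /= bop0 addr0.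
Qed.
Lemma nr_oblock22 : nr D <= nr (oblock A B C D).
Proof.
apply: nr_bop_le => [|x]; first exact: nr_ge0.
have := nr_bop (oblock A B C D) (0, x); rewrite nr_hsum_inr; apply: le_trans.
by apply: le_trans (nr_hsum2 _); rewrite oblockE /= bop0 add0r.
Qed.

Lemma nr_oblock_le : nr (oblock A B C D) <= nr A + nr B + (nr C + nr D).
Proof.
apply: nr_bop_le => [|x]; first by rewrite !addr_ge0 ?nr_ge0.
rewrite oblockE; apply: le_trans (nr_hsum_le _) _; rewrite /= !mulrDl.
have h1 (S : 'B(H1, K1)) := le_trans (nr_bop S x.1) (ler_wpM2l (nr_ge0 S) (nr_hsum1 x)).
have h2 (S : 'B(H2, K1)) := le_trans (nr_bop S x.2) (ler_wpM2l (nr_ge0 S) (nr_hsum2 x)).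
have h3 (S : 'B(H1, K2)) := le_trans (nr_bop S x.1) (ler_wpM2l (nr_ge0 S) (nr_hsum1 x)).
have h4 (S : 'B(H2, K2)) := le_trans (nr_bop S x.2) (ler_wpM2l (nr_ge0 S) (nr_hsum2 x)).
apply: lerD; first exact: le_trans (nrD _ _) (lerD (h1 A) (h2 B)).
exact: le_trans (nrD _ _) (lerD (h3 C) (h4 D)).
Qed.

End BlockNorm.

End Blocks.

(** * Orthogonal decomposition of the space along the matched projection *)

Section Decomposition.
Variables (R : realType) (H : hilbertType R) (Q : 'B(H)).
Hypothesis QQ : Q * Q = Q.
Variables (m A : 'B(H)).
Hypotheses (A0 : opos A) (msa : adj m = m) (mm : m * m = m) (Am : A * m = Q * m).
Hypothesis twoQm : (2 : R[i]) *: (Q * m) = A + Q.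
Hypothesis kerA : forall x, m x = x -> A x = 0 -> x = 0.
Variables (H1 H4 H5 H6 : closed_subspace H).
Hypothesis H1E : cs_set H1 = range m `&` range Q.
Hypothesis H4E : cs_set H4 = okernel m `&` okernel Q.
Hypothesis H5E : cs_set H5 = closure (range (m * Q * (1 - m))).
Hypothesis H6E : cs_set H6 = closure (range ((1 - m) * Q * m)).

Let n := 1 - m.
Let nsa : adj n = n. Proof. by rewrite adjB adj1 msa. Qed.
Let mn : m * n = 0. Proof. by rewrite mulrBr mulr1 mm subrr. Qed.
Let nm : n * m = 0. Proof. by rewrite mulrBl mul1r mm subrr. Qed.
Let nE x : n x = x - m x. Proof. by []. Qed.

(* The two off-diagonal corners of Q with respect to m are opposite adjoints. *)
Let adj_mQn : adj (m * Q * n) = - (n * Q * m).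
Proof.
have : (2 : R[i]) *: (m * adj Q) = A + adj Q.
  by rewrite -(opos_sa A0) -adjD -twoQm adjZ conjC_nat adjM msa.
move=> /(congr1 (fun T => n * T * m)).
rewrite bopZMr bopZMl (mulrA n m) nm !mul0r scaler0 mulrDr mulrDl -(mulrA n A) Am.
move=> /esym/eqP; rewrite addrC addr_eq0 => /eqP nqm.
by rewrite !adjM nsa msa -(mulrA n Q) -nqm mulrA.
Qed.

Let adj_nQm : adj (n * Q * m) = - (m * Q * n).
Proof. by rewrite -[n * Q * m]opprK -adj_mQn adjN adjK. Qed.

Let QnE : Q * n = - (A * n).
Proof.
move: twoQm => /(congr1 (fun T => T * n)); rewrite bopZMl -mulrA mn mulr0 scaler0 mulrDl.
by move=> /esym/eqP; rewrite addrC addr_eq0 => /eqP.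
Qed.

Let H1P x : cs_set H1 x <-> m x = x /\ Q x = x.
Proof.
rewrite H1E; split=> [[[u _ <-] [v _ vu]]|[mx Qx]].
  by rewrite -bopME mm; split=> //; rewrite -vu -bopME QQ.
by split; exists x.
Qed.

Let H4P x : cs_set H4 x <-> m x = 0 /\ Q x = 0.
Proof. by rewrite H4E. Qed.

Let H5m x : cs_set H5 x -> m x = x.
Proof.
rewrite H5E => clx; apply/esym/subr0_eq; rewrite -nE.
by apply: (bop_closure clx) => _ [z _ <-]; rewrite -bopME !mulrA nm !mul0r.
Qed.

Let H6m x : cs_set H6 x -> m x = 0.
Proof.
rewrite H6E => clx.
by apply: (bop_closure clx) => _ [z _ <-]; rewrite -bopME !mulrA mn !mul0r.
Qed.

Let orth_m x y : m x = x -> m y = 0 -> dot x y = 0.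
Proof. by move=> <- my; rewrite -{1}msa adjP' my dot0r. Qed.

Let orth15 x y : cs_set H1 x -> cs_set H5 y -> dot x y = 0.
Proof.
move=> /H1P[mx Qx]; rewrite H5E => cly; apply: (dot_closure cly) => _ [z _ <-].
by rewrite -adjP' adj_mQn bopNE !bopME mx Qx nE mx subrr oppr0 dot0l.
Qed.

Let orth46 x y : cs_set H4 x -> cs_set H6 y -> dot x y = 0.
Proof.
move=> /H4P[mx Qx]; rewrite H6E => cly; apply: (dot_closure cly) => _ [z _ <-].
by rewrite -adjP' adj_nQm bopNE !bopME nE mx subr0 Qx bop0 oppr0 dot0l.
Qed.

(** Orthogonality to H5 means (m Q n)^* x = 0, that is n Q x = 0, so Q x stays in the range of [m].
    It remains to see that Q x = x. *)
Let complement1 x : m x = x -> (forall y, cs_set H5 y -> dot x y = 0) -> cs_set H1 x.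
Proof.
move=> mx x5; apply/H1P; split=> //.
have nQx : n (Q x) = 0.
  rewrite -{1}mx -!bopME ?mulrA -[LHS]opprK -bopNE -adj_mQn; apply/eqP; rewrite oppr_eq0; apply/eqP.
  apply: dot_extl => z; rewrite dot0l adjP'; apply: x5; rewrite H5E.
  by apply: subset_closure; exists z.
have mQx : m (Q x) = Q x by apply/esym/subr0_eq; rewrite -nE.
(* [y] lies in the range of [m] and in the kernel of [Q], so <A y, y> = <Q m y, y> = 0; positivity
   gives A y = 0, and [kerA] gives y = 0. *)
set y := Q x - x.
have my : m y = y by rewrite /y bopB mx mQx.
have mQy : Q y = 0 by rewrite /y bopB -bopME QQ subrr.
have y0 : y = 0.
  apply: kerA => //; apply: opos_dot_eq0 A0 _.
  by rewrite -{1}my -bopME Am bopME my mQy dot0l.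
exact: subr0_eq y0.
Qed.

(** Here y = Q x lies in the kernel of [m] and is fixed by [Q]. Since Q n = - A n, |y|^2 = - <A y,
    y> <= 0. *)
Let complement4 x : m x = 0 -> (forall y, cs_set H6 y -> dot x y = 0) -> cs_set H4 x.
Proof.
move=> mx x6; apply/H4P; split=> //.
have nx : n x = x by rewrite nE mx subr0.
have mQx : m (Q x) = 0.
  rewrite -{1}nx -!bopME ?mulrA -[LHS]opprK -bopNE -adj_nQm; apply/eqP; rewrite oppr_eq0; apply/eqP.
  apply: dot_extl => z; rewrite dot0l adjP'; apply: x6; rewrite H6E.
  by apply: subset_closure; exists z.
set y := Q x in mQx *.
have ny : n y = y by rewrite nE mQx subr0.
have Qy : Q y = y by rewrite /y -bopME QQ.
have : dot y y = - dot (A y) y by rewrite -{1}Qy -{1}ny -bopME QnE bopNE bopME ny dotNl.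
move=> yA; apply: dot0_eq0; apply/le_anti/andP; split; last by rewrite dotxx ler0c sqr_ge0.
by rewrite yA oppr_le0; exact: A0.
Qed.

Let P1 := oproj H1. Let P4 := oproj H4. Let P5 := oproj H5. Let P6 := oproj H6.

Let sum_proj x : cs_val (P1 x) + (cs_val (P4 x) + (cs_val (P5 x) + cs_val (P6 x))) = x.
Proof.
set s := _ + _; set y := x - s.
have mem1 := csub_mem (P1 x). have mem4 := csub_mem (P4 x).
have mem5 := csub_mem (P5 x). have mem6 := csub_mem (P6 x).
have m1 := proj1 (proj1 (H1P _) mem1); have m4 := proj1 (proj1 (H4P _) mem4).
have m5 := H5m mem5; have m6 := H6m mem6.
have dotc0 (u v : H) : dot u v = 0 -> dot v u = 0 by move=> uv; rewrite dotC uv conjC0.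
have y1 h : cs_set H1 h -> dot y h = 0.
  move=> h1; have [mh _] := proj1 (H1P _) h1.
  have := oproj_spec x (CSub (mem_set h1)); rewrite /= dotBl => /eqP; rewrite subr_eq0 => /eqP xh.
  rewrite /y /s dotBl !dotDl (dotc0 _ _ (orth_m mh m4)) (dotc0 _ _ (orth15 h1 mem5)).
  by rewrite (dotc0 _ _ (orth_m mh m6)) !addr0 xh subrr.
have y4 h : cs_set H4 h -> dot y h = 0.
  move=> h4; have [mh _] := proj1 (H4P _) h4.
  have := oproj_spec x (CSub (mem_set h4)); rewrite /= dotBl => /eqP; rewrite subr_eq0 => /eqP xh.
  rewrite /y /s dotBl !dotDl (orth_m m1 mh) (orth_m m5 mh).
  by rewrite (dotc0 _ _ (orth46 h4 mem6)) !addr0 add0r xh subrr.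
have y5 h : cs_set H5 h -> dot y h = 0.
  move=> h5; have mh := H5m h5.
  have := oproj_spec x (CSub (mem_set h5)); rewrite /= dotBl => /eqP; rewrite subr_eq0 => /eqP xh.
  rewrite /y /s dotBl !dotDl (orth15 mem1 h5) (dotc0 _ _ (orth_m mh m4)).
  by rewrite (dotc0 _ _ (orth_m mh m6)) !addr0 !add0r xh subrr.
have y6 h : cs_set H6 h -> dot y h = 0.
  move=> h6; have mh := H6m h6.
  have := oproj_spec x (CSub (mem_set h6)); rewrite /= dotBl => /eqP; rewrite subr_eq0 => /eqP xh.
  rewrite /y /s dotBl !dotDl (orth_m m1 mh) (orth46 mem4 h6) (orth_m m5 mh).
  by rewrite !add0r xh subrr.
(* [m y] is still orthogonal to H5, so [complement1] puts it in H1, to which [y] is orthogonal;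
   hence |m y|^2 = <y, m y> = 0. Then [complement4] applies to [y] itself. *)
have my0 : m y = 0.
  have mmy : m (m y) = m y by rewrite -bopME mm.
  have : cs_set H1 (m y).
    apply: complement1 => // h h5; rewrite -{1}msa adjP' (H5m h5); exact: y5.
  by move=> /y1 h; apply: dot0_eq0; rewrite -{1}msa adjP' mmy.
have : cs_set H4 y by apply: complement4.
by move=> /y4/dot0_eq0/subr0_eq.
Qed.

Let adj_Umap z : adj (Umap H1 H4 H5 H6) z =
  cs_val z.1 + (cs_val z.2.1 + (cs_val z.2.2.1 + cs_val z.2.2.2)).
Proof. by rewrite /Umap !adj_opair !adj_oprojE. Qed.

Lemma Umap_unitary : ounitary (Umap H1 H4 H5 H6).
Proof.
split; apply: bop_ext; first by move=> x; rewrite [LHS]/= adj_Umap /= sum_proj.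
move=> [a [b [c d]]]; rewrite [LHS]/= adj_Umap /=.
have dotc0 (u v : H) : dot u v = 0 -> dot v u = 0 by move=> uv; rewrite dotC uv conjC0.
have a1 := csub_mem a; have b4 := csub_mem b; have c5 := csub_mem c; have d6 := csub_mem d.
have ma := proj1 (proj1 (H1P _) a1); have mb := proj1 (proj1 (H4P _) b4).
have mc := H5m c5; have md := H6m d6.
congr (_, (_, (_, _))); rewrite !bopD oproj_val !oproj_orth ?add0r ?addr0//.
- by move=> h /H1P[mh _]; exact: dotc0 (orth_m mh md).
- by move=> h h1; exact: dotc0 (orth15 h1 c5).
- by move=> h /H1P[mh _]; exact: dotc0 (orth_m mh mb).
- by move=> h h4; exact: dotc0 (orth46 h4 d6).
- by move=> h /H4P[mh _]; exact: orth_m mc mh.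
- by move=> h /H4P[mh _]; exact: orth_m ma mh.
- by move=> h /H5m mh; exact: dotc0 (orth_m mh md).
- by move=> h /H5m mh; exact: dotc0 (orth_m mh mb).
- by move=> h h5; exact: orth15 a1 h5.
- by move=> h /H6m mh; exact: orth_m mc mh.
- by move=> h h6; exact: orth46 b4 h6.
- by move=> h /H6m mh; exact: orth_m ma mh.
Qed.

End Decomposition.

Lemma ocompA (R : realType) (H K L M : hilbertType R) (S : 'B(L, M)) (T : 'B(K, L)) (U : 'B(H, K)) :
  S \ob (T \ob U) = S \ob T \ob U.
Proof. exact: bop_ext. Qed.

Lemma ocompDl (R : realType) (H K L : hilbertType R) (S S' : 'B(K, L)) (T : 'B(H, K)) :
  (S + S') \ob T = S \ob T + S' \ob T.
Proof. exact: bop_ext. Qed.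

Lemma ocompDr (R : realType) (H K L : hilbertType R) (S : 'B(K, L)) (T T' : 'B(H, K)) :
  S \ob (T + T') = S \ob T + S \ob T'.
Proof. by apply: bop_ext => x; rewrite ocompE bopD. Qed.

Lemma ocompZl (R : realType) (H K L : hilbertType R) (a : R[i]) (S : 'B(K, L)) (T : 'B(H, K)) :
  (a *: S) \ob T = a *: (S \ob T).
Proof. exact: bop_ext. Qed.

Lemma ocompZr (R : realType) (H K L : hilbertType R) (a : R[i]) (S : 'B(K, L)) (T : 'B(H, K)) :
  S \ob (a *: T) = a *: (S \ob T).
Proof. by apply: bop_ext => x; rewrite ocompE bopZ. Qed.

Lemma ocomp1o (R : realType) (H K : hilbertType R) (T : 'B(H, K)) : oid K \ob T = T.
Proof. exact: bop_ext. Qed.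

Lemma ocompo1 (R : realType) (H K : hilbertType R) (T : 'B(H, K)) : T \ob oid H = T.
Proof. exact: bop_ext. Qed.

Lemma nr_isometry (R : realType) (H K : hilbertType R) (V : 'B(H, K)) :
  adj V \ob V = oid H -> nr V <= 1.
Proof.
move=> VV; apply: nr_bop_le => // x; rewrite mul1r -ler_sqr ?nnegrE ?nr_ge0//.
by rewrite -lecR nr_adj_sqr -ocompE VV dotxx.
Qed.

Lemma complex_cauchy_cvg (R : realType) (u : nat -> R[i]) :
  (forall e : R, 0 < e -> exists N, forall n m, (N <= n)%N -> (N <= m)%N ->
     nr (u n - u m) < e) ->
  exists l, forall e : R, 0 < e -> exists N, forall n, (N <= n)%N -> nr (u n - l) < e.
Proof.
move=> cu.
have real_cvg (v : nat -> R) : (forall n m, `|v n - v m| <= nr (u n - u m)) ->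
    exists l, forall e : R, 0 < e -> exists N, forall n, (N <= n)%N -> `|v n - l| < e.
  move=> vu; have : cvg (v @ \oo).
    apply/cauchy_cvgP/cauchy_ballP => e e0.
    have [N uN] := cu e e0; rewrite !near_simpl.
    exists ([set n | (N <= n)%N], [set n | (N <= n)%N]) => /=.
      by split; exists N.
    move=> [n m] /= [Nn Nm]; rewrite -ball_normE /=; apply: le_lt_trans (vu _ _) _.
    exact: uN.
  move=> /cvg_ex[l vl]; exists l => e e0.
  move/cvgrPdist_lt: vl => /(_ _ e0)[N _ vN]; exists N => n Nn.
  by have := vN _ Nn; rewrite /= distrC.
have [n m|x ux] := real_cvg (fun n => complex.Re (u n)); first by rewrite -raddfB nr_ge_Re.
have [n m|y uy] := real_cvg (fun n => complex.Im (u n)); first by rewrite -raddfB nr_ge_Im.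
exists (x +i* y)%C => e e0; have e20 : 0 < e / 2 by rewrite divr_gt0.
have [N xN] := ux _ e20; have [N' yN] := uy _ e20; exists (maxn N N') => n.
rewrite geq_max => /andP[/xN nx /yN ny]; apply: le_lt_trans (nr_le_ReIm _) _.
by rewrite !raddfB/= [e]splitr ltrD.
Qed.

(** * The algebra of matrix functions *)

Section ContinuousFunctions.
Variables (R : realType) (K : set R[i]^o).

(** Bundling continuity with the function frees the identities between matrix functions from
    continuity side conditions. *)
Definition ctsfun := {f : R[i]^o -> R[i]^o | C_on K f}.
Definition cts_fun (f : ctsfun) : R[i] -> R[i] := sval f.
Coercion cts_fun : ctsfun >-> Funclass.

Lemma ctsP (f : ctsfun) : C_on K f. Proof. exact: svalP f. Qed.
Arguments ctsP f : clear implicits.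

Definition cts (f : R[i]^o -> R[i]^o) (cf : C_on K f) : ctsfun := exist _ f cf.
Definition cts_cst (a : R[i]) : ctsfun := cts (@C_on_cst _ K a).
Definition cts_id : ctsfun := cts (@C_on_id _ K).
Definition cts_add (f g : ctsfun) : ctsfun := cts (C_on_add (ctsP f) (ctsP g)).
Definition cts_mul (f g : ctsfun) : ctsfun := cts (C_on_mul (ctsP f) (ctsP g)).
Definition cts_opp (f : ctsfun) : ctsfun := cts (C_on_opp (ctsP f)).
Definition cts_sub (f g : ctsfun) : ctsfun := cts (C_on_sub (ctsP f) (ctsP g)).
Definition cts_conj (f : ctsfun) : ctsfun := cts (C_on_conj (ctsP f)).
Definition cts_real (h : R[i] -> R) (ch : rcont K h) : ctsfun := cts (proj1 (C_on_rcont K h) ch).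

Lemma cts_cstE (a : R[i]) t : cts_cst a t = a. Proof. by []. Qed.
Lemma cts_idE t : cts_id t = t. Proof. by []. Qed.
Lemma cts_addE f g t : cts_add f g t = f t + g t. Proof. by []. Qed.
Lemma cts_mulE f g t : cts_mul f g t = f t * g t. Proof. by []. Qed.
Lemma cts_oppE f t : cts_opp f t = - f t. Proof. by []. Qed.
Lemma cts_subE f g t : cts_sub f g t = f t - g t. Proof. by []. Qed.
Lemma cts_conjE f t : cts_conj f t = Num.conj (f t). Proof. by []. Qed.
Lemma cts_realE h (ch : rcont K h) t : cts_real ch t = (h t)%:C%C. Proof. by []. Qed.
Definition ctsE := (cts_cstE, cts_idE, cts_addE, cts_mulE, cts_oppE, cts_subE,
  cts_conjE, cts_realE).

Lemma cts_uniform_limit (u : nat -> ctsfun) :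
  (forall e : R, 0 < e -> exists N, forall n m, (N <= n)%N -> (N <= m)%N ->
     forall t, K t -> nr (u n t - u m t) < e) ->
  exists f : ctsfun, forall e : R, 0 < e -> exists N, forall n, (N <= n)%N ->
     forall t, K t -> nr (u n t - f t) <= e.
Proof.
move=> cu.
have pw t : exists l, K t -> forall e : R, 0 < e -> exists N, forall n, (N <= n)%N ->
    nr (u n t - l) < e.
  have [Kt|] := pselect (K t); last by exists 0.
  have [|l ul] := @complex_cauchy_cvg R (fun n => u n t); last by exists l.
  by move=> e e0; have [N uN] := cu e e0; exists N => n m Nn Nm; exact: uN.
have [f fP] := choice pw.
have fu (e : R) : 0 < e -> exists N, forall n, (N <= n)%N -> forall t, K t -> nr (u n t - f t) <= e.
  move=> e0; have [N uN] := cu e e0; exists N => n Nn t Kt; apply: le_eps => d d0.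
  have [N' fN'] := fP t Kt d d0; pose m := maxn N N'.
  apply: le_trans (nr_tri _ (u m t) _) (lerD _ _); apply: ltW.
    exact: uN _ _ Nn (leq_maxl _ _) t Kt.
  exact: fN' _ (leq_maxr _ _).
have cf : C_on K f.
  apply/C_onP => x Kx e e0; have e30 : 0 < e / 3 by rewrite divr_gt0.
  have [N uN] := fu _ e30; have [d d0 xd] := proj1 (C_onP _ _) (ctsP (u N)) x Kx _ e30.
  exists d => // y Ky yx.
  have h1 : nr (u N x - f x : R[i]) <= e / 3 := uN N (leqnn _) x Kx.
  have h2 : nr (f y - u N y : R[i]) <= e / 3 by rewrite nrB; exact: uN N (leqnn _) y Ky.
  have h3 : nr (u N y - u N x : R[i]) < e / 3 := xd y Ky yx.
  apply: le_lt_trans (nr_tri (f y) (u N y) (f x)) _.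
  have := nr_tri (u N y) (u N x) (f x); lra.
by exists (cts cf).
Qed.

End ContinuousFunctions.

Arguments ctsP {R K} f.
Arguments cts_cst {R K}.
Arguments cts_id {R K}.

Section MatrixCalculus.
Variables (R : realType) (H K1 K4 E : hilbertType R) (D : 'B(E)).
Hypothesis Dsa : adj D = D.
Let K := spectrum D.
Hypothesis K1_mem : K 1.
Variable V : 'B(H, hsum K1 (hsum K4 (hsum E E))).
Hypothesis V_unitary : ounitary V.
Let Phi : (R[i]^o -> R[i]^o) -> 'B(E) := cfc D.
Let PhiP : is_cfc D Phi := cfcP Dsa.
Let nrV_le1 : nr V <= 1 := nr_isometry (proj1 V_unitary).
Let V2 : V \ob adj V = oid _ := proj2 V_unitary.
Implicit Types a b c d : ctsfun K.

Definition blk (a b c d : R[i]^o -> R[i]^o) : 'B(hsum K1 (hsum K4 (hsum E E))) :=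
  odsum (a 1 *: oid K1) (odsum (0 : 'B(K4)) (oblock (Phi a) (Phi b) (Phi c) (Phi d))).

(* The operator V^* (f_11(1) + 0 + f(D)) V of the theorem, for f = [a b; c d]. *)
Definition pim (a b c d : R[i]^o -> R[i]^o) : 'B(H) := adj V \ob blk a b c d \ob V.

Lemma blkE a b c d : blk a b c d = V \ob pim a b c d \ob adj V.
Proof. by rewrite /pim !ocompA V2 ocomp1o -ocompA V2 ocompo1. Qed.

(** The scalar a(1) on the first summand depends only on values on the spectrum because 1 is a
    spectral point. *)
Lemma pim_ext a b c d a' b' c' d' :
  (forall t, K t -> a t = a' t) -> (forall t, K t -> b t = b' t) ->
  (forall t, K t -> c t = c' t) -> (forall t, K t -> d t = d' t) ->
  pim a b c d = pim a' b' c' d'.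
Proof.
move=> ea eb ec ed; rewrite /pim /blk (ea _ K1_mem).
by rewrite /Phi (cfc_ext' Dsa (ctsP a) (ctsP a') ea) (cfc_ext' Dsa (ctsP b) (ctsP b') eb)
  (cfc_ext' Dsa (ctsP c) (ctsP c') ec) (cfc_ext' Dsa (ctsP d) (ctsP d') ed).
Qed.

Lemma pim_add a b c d a' b' c' d' :
  pim a b c d + pim a' b' c' d' = pim (cts_add a a') (cts_add b b') (cts_add c c') (cts_add d d').
Proof.
rewrite /pim -ocompDl -ocompDr; congr (_ \ob _ \ob _).
rewrite /blk !odsumD oblockD addr0 -scalerDl.
by rewrite -!(cfc_add PhiP (ctsP _) (ctsP _)).
Qed.

Lemma pim_scale (k : R[i]) a b c d :
  k *: pim a b c d = pim (cts_mul (cts_cst k) a) (cts_mul (cts_cst k) b)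
                         (cts_mul (cts_cst k) c) (cts_mul (cts_cst k) d).
Proof.
rewrite /pim -ocompZl -ocompZr; congr (_ \ob _ \ob _).
rewrite /blk !odsumZ oblockZ scaler0 scalerA.
by rewrite -!(cfc_scale PhiP k (ctsP _)).
Qed.

Lemma pim_opp a b c d : - pim a b c d = pim (cts_opp a) (cts_opp b) (cts_opp c) (cts_opp d).
Proof.
rewrite -scaleN1r pim_scale; apply: pim_ext => t _; exact: mulN1r.
Qed.

Lemma pim_sub a b c d a' b' c' d' :
  pim a b c d - pim a' b' c' d' = pim (cts_sub a a') (cts_sub b b') (cts_sub c c') (cts_sub d d').
Proof. by rewrite pim_opp pim_add; exact: pim_ext. Qed.

(** The condition says that the (1,1) entry of the product, a a' + b c', takes the value a(1) a'(1)
    at 1, as required on the first summand. *)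
Lemma pim_mul a b c d a' b' c' d' : b 1 * c' 1 = 0 ->
  pim a b c d * pim a' b' c' d' =
  pim (cts_add (cts_mul a a') (cts_mul b c')) (cts_add (cts_mul a b') (cts_mul b d'))
      (cts_add (cts_mul c a') (cts_mul d c')) (cts_add (cts_mul c b') (cts_mul d d')).
Proof.
move=> bc; rewrite -[LHS]/(pim a b c d \ob pim a' b' c' d') /pim.
rewrite -!ocompA (ocompA V) V2 ocomp1o !ocompA; congr (_ \ob _).
rewrite -!ocompA; congr (_ \ob _).
rewrite /blk !odsum_comp oblock_comp; congr (odsum _ (odsum _ _)).
- rewrite ocompZl ocomp1o scalerA; congr (_ *: _).
  by rewrite -[RHS]/(a 1 * a' 1 + b 1 * c' 1) bc addr0.
- by apply: bop_ext => x; rewrite ocompE bop0.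
- rewrite -!(cfc_mul PhiP (ctsP _) (ctsP _)).
  by rewrite -!(cfc_add PhiP (ctsP (cts_mul _ _)) (ctsP (cts_mul _ _))).
Qed.

Lemma pim_adj a b c d : adj (pim a b c d) = pim (cts_conj a) (cts_conj c) (cts_conj b) (cts_conj d).
Proof.
rewrite /pim !adj_comp adjK ocompA; congr (_ \ob _ \ob _).
rewrite /blk !adj_odsum adj_oblock adj0 adjZ adj_oid.
by rewrite -!(cfc_conj PhiP (ctsP _)).
Qed.

(** The crude constant 5 counts the scalar on the first summand and the four entries. *)
Lemma pim_norm_le a b c d (s : R) : 0 <= s ->
  (forall t, K t -> nr (a t) <= s) -> (forall t, K t -> nr (b t) <= s) ->
  (forall t, K t -> nr (c t) <= s) -> (forall t, K t -> nr (d t) <= s) ->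
  nr (pim a b c d) <= 5 * s.
Proof.
move=> s0 sa sb sc sd.
have Vs : nr (adj V) <= 1 by rewrite nr_adj.
have : nr (pim a b c d) <= nr (blk a b c d).
  apply: le_trans (nr_comp _ _) _; rewrite -[leRHS]mulr1.
  apply: ler_pM; rewrite ?nr_ge0 //.
  apply: le_trans (nr_comp _ _) _; rewrite -[leRHS]mul1r.
  by apply: ler_pM; rewrite ?nr_ge0.
move=> /le_trans; apply; apply: le_trans (nr_oblock_le _ _ _ _) _; rewrite !nr0 addr0 add0r.
have n1 : nr (a 1 *: oid K1) <= s.
  rewrite nrZ -[leRHS]mulr1; apply: ler_pM; rewrite ?nr_ge0 ?sa//.
  by apply: nr_bop_le => // x; rewrite mul1r.
have n2 : nr (odsum (0 : 'B(K4)) (oblock (Phi a) (Phi b) (Phi c) (Phi d))) <= 4 * s.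
  apply: le_trans (nr_oblock_le _ _ _ _) _; rewrite !nr0 addr0 add0r add0r.
  apply: le_trans (nr_oblock_le _ _ _ _) _.
  have := cfc_norm_le Dsa (ctsP a) s0 sa; have := cfc_norm_le Dsa (ctsP b) s0 sb.
  have := cfc_norm_le Dsa (ctsP c) s0 sc; have := cfc_norm_le Dsa (ctsP d) s0 sd.
  by rewrite -/Phi; lra.
by lra.
Qed.

(** Each entry is a corner of a unitary conjugate of [pim a b c d], and its norm bounds its function
    pointwise by [cfc_norm_ge]. *)
Lemma pim_norm_ge a b c d t : K t ->
  [/\ nr (a t) <= nr (pim a b c d), nr (b t) <= nr (pim a b c d),
      nr (c t) <= nr (pim a b c d) & nr (d t) <= nr (pim a b c d)].
Proof.
move=> Kt.
have Vs : nr (adj V) <= 1 by rewrite nr_adj.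
have h : nr (oblock (Phi a) (Phi b) (Phi c) (Phi d)) <= nr (pim a b c d).
  apply: le_trans (nr_oblock22 (0 : 'B(K4)) 0 0 _) _.
  apply: le_trans (nr_oblock22 (a 1 *: oid K1) 0 0 _) _.
  rewrite -[X in nr X]/(blk a b c d) blkE.
  apply: le_trans (nr_comp _ _) _; rewrite -[leRHS]mulr1.
  apply: ler_pM; rewrite ?nr_ge0//.
  apply: le_trans (nr_comp _ _) _; rewrite -[leRHS]mul1r.
  by apply: ler_pM; rewrite ?nr_ge0.
split.
- exact: le_trans (cfc_norm_ge Dsa (ctsP a) Kt) (le_trans (nr_oblock11 _ _ _ _) h).
- exact: le_trans (cfc_norm_ge Dsa (ctsP b) Kt) (le_trans (nr_oblock12 _ _ _ _) h).
- exact: le_trans (cfc_norm_ge Dsa (ctsP c) Kt) (le_trans (nr_oblock21 _ _ _ _) h).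
- exact: le_trans (cfc_norm_ge Dsa (ctsP d) Kt) (le_trans (nr_oblock22 _ _ _ _) h).
Qed.

Lemma pim_dist_ge a b c d a' b' c' d' t : K t ->
  let r := nr (pim a b c d - pim a' b' c' d') in
  [/\ nr (a t - a' t) <= r, nr (b t - b' t) <= r, nr (c t - c' t) <= r & nr (d t - d' t) <= r].
Proof.
move=> Kt; rewrite /= pim_sub.
exact: (pim_norm_ge (cts_sub a a') (cts_sub b b') (cts_sub c c') (cts_sub d d') Kt).
Qed.

Definition pim_image : set 'B(H) := [set T | exists a b c d : ctsfun K,
  [/\ b 1 = 0, c 1 = 0, d 1 = 0 & T = pim a b c d]].

(** By [pim_dist_ge] the entries of a convergent sequence are uniformly Cauchy on the spectrum;
    their limits are continuous and still vanish at the spectral point 1. *)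
Lemma pim_image_closed : closed pim_image.
Proof.
apply/closedP => T clT.
have app n : exists f : (ctsfun K * ctsfun K) * (ctsfun K * ctsfun K),
    [/\ f.1.2 1 = 0, f.2.1 1 = 0, f.2.2 1 = 0 &
      nr (T - pim f.1.1 f.1.2 f.2.1 f.2.2) < n.+1%:R^-1].
  have n0 : 0 < n.+1%:R^-1 :> R by rewrite invr_gt0.
  have [_ [a [b [c [d [b1 c1 d1 ->]]]]] h] := clT _ n0.
  by exists ((a, b), (c, d)).
have [f fP] := choice app.
pose S n := pim (f n).1.1 (f n).1.2 (f n).2.1 (f n).2.2.
have ST (e : R) : 0 < e -> exists N, forall n, (N <= n)%N -> nr (T - S n) < e.
  move=> e0; have [N NP] := inv_nat_small e0; exists N => n /NP; apply: lt_trans.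
  by case: (fP n).
have SS (e : R) : 0 < e -> exists N, forall n m, (N <= n)%N -> (N <= m)%N -> nr (S n - S m) < e.
  move=> e0; have [N NP] := ST _ (divr_gt0 e0 (ltr0Sn _ 1)); exists N => n m /NP hn /NP hm.
  apply: le_lt_trans (nr_tri _ T _) _; rewrite nrB; move: hn hm; lra.
have lim (u : nat -> ctsfun K) :
    (forall n m t, K t -> nr (u n t - u m t) <= nr (S n - S m)) ->
    exists g : ctsfun K, forall e : R, 0 < e -> exists N, forall n, (N <= n)%N ->
      forall t, K t -> nr (u n t - g t) <= e.
  move=> uS; apply: cts_uniform_limit => e e0; have [N SN] := SS e e0.
  by exists N => n m Nn Nm t Kt; apply: le_lt_trans (uS n m t Kt) (SN n m Nn Nm).
have dist n m t (Kt : K t) := pim_dist_ge (f n).1.1 (f n).1.2 (f n).2.1 (f n).2.2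
  (f m).1.1 (f m).1.2 (f m).2.1 (f m).2.2 Kt.
have [|a aP] := lim (fun n => (f n).1.1); first by move=> n m t /(dist n m)[].
have [|b bP] := lim (fun n => (f n).1.2); first by move=> n m t /(dist n m)[].
have [|c cP] := lim (fun n => (f n).2.1); first by move=> n m t /(dist n m)[].
have [|d dP] := lim (fun n => (f n).2.2); first by move=> n m t /(dist n m)[].
have vanish (u : nat -> ctsfun K) (g : ctsfun K) : (forall n, u n 1 = 0) ->
    (forall e : R, 0 < e -> exists N, forall n, (N <= n)%N -> forall t, K t ->
      nr (u n t - g t) <= e) ->
    g 1 = 0.
  move=> u0 ug; apply: nr_eq0; apply/eqP; rewrite eq_le nr_ge0 andbT.
  apply: le_eps => e e0; have [N NP] := ug e e0; have := NP N (leqnn _) 1 K1_mem.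
  by rewrite u0 sub0r nrN add0r.
exists a, b, c, d; split.
- by apply: vanish bP => n; case: (fP n).
- by apply: vanish cP => n; case: (fP n).
- by apply: vanish dP => n; case: (fP n).
apply: subr0_eq; apply: nr_eq0; apply/eqP; rewrite eq_le nr_ge0 andbT.
(* One sixth for T - S n, five for the factor 5 of [pim_norm_le]. *)
apply: le_eps => e e0; rewrite add0r; have e60 : 0 < e / 6 by rewrite divr_gt0.
have [N0 SN] := ST _ e60; have [Na aN] := aP _ e60; have [Nb bN] := bP _ e60.
have [Nc cN] := cP _ e60; have [Nd dN] := dP _ e60.
pose n := (N0 + Na + Nb + Nc + Nd)%N.
have n0 : (N0 <= n)%N by rewrite /n -!addnA leq_addr.
have na : (Na <= n)%N.
  by apply: leq_trans (leq_addl N0 Na) _; rewrite /n -!addnA leq_add2l leq_addr.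
have nb : (Nb <= n)%N.
  by apply: leq_trans (leq_addl (N0 + Na) Nb) _; rewrite /n -[leqRHS]addnA leq_addr.
have nc : (Nc <= n)%N by exact: leq_trans (leq_addl (N0 + Na + Nb) Nc) (leq_addr _ _).
have nd : (Nd <= n)%N by rewrite /n leq_addl.
apply: le_trans (nr_tri _ (S n) _) _.
have := ltW (SN n n0).
have : nr (S n - pim a b c d) <= 5 * (e / 6).
  rewrite /S pim_sub; apply: pim_norm_le => [|t Kt|t Kt|t Kt|t Kt]; first exact: ltW.
  - exact: aN.
  - exact: bN.
  - exact: cN.
  - exact: dN.
by lra.
Qed.

Lemma pim_image_cstar : is_cstar_subalgebra pim_image.
Proof.
split.
- exists (cts_cst 0), (cts_cst 0), (cts_cst 0), (cts_cst 0); split=> //.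
  have := pim_scale 0 (cts_cst 0) (cts_cst 0) (cts_cst 0) (cts_cst 0); rewrite scale0r => ->.
  by apply: pim_ext => t _; exact: mul0r.
- move=> _ _ [a [b [c [d [b1 c1 d1 ->]]]]] [a' [b' [c' [d' [b1' c1' d1' ->]]]]].
  exists (cts_add a a'), (cts_add b b'), (cts_add c c'), (cts_add d d').
  split; last by rewrite pim_add.
  + by rewrite -[LHS]/(b 1 + b' 1) b1 b1' addr0.
  + by rewrite -[LHS]/(c 1 + c' 1) c1 c1' addr0.
  + by rewrite -[LHS]/(d 1 + d' 1) d1 d1' addr0.
- move=> k _ [a [b [c [d [b1 c1 d1 ->]]]]].
  exists (cts_mul (cts_cst k) a), (cts_mul (cts_cst k) b),
    (cts_mul (cts_cst k) c), (cts_mul (cts_cst k) d).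
  split; last by rewrite pim_scale.
  + by rewrite -[LHS]/(k * b 1) b1 mulr0.
  + by rewrite -[LHS]/(k * c 1) c1 mulr0.
  + by rewrite -[LHS]/(k * d 1) d1 mulr0.
- move=> _ _ [a [b [c [d [b1 c1 d1 ->]]]]] [a' [b' [c' [d' [b1' c1' d1' ->]]]]].
  exists (cts_add (cts_mul a a') (cts_mul b c')), (cts_add (cts_mul a b') (cts_mul b d')),
    (cts_add (cts_mul c a') (cts_mul d c')), (cts_add (cts_mul c b') (cts_mul d d')).
  split; last by rewrite -pim_mul// b1 mul0r.
  + by rewrite -[LHS]/(a 1 * b' 1 + b 1 * d' 1) b1 b1' mulr0 mul0r addr0.
  + by rewrite -[LHS]/(c 1 * a' 1 + d 1 * c' 1) c1 d1 !mul0r addr0.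
  + by rewrite -[LHS]/(c 1 * b' 1 + d 1 * d' 1) c1 d1 !mul0r addr0.
- move=> _ [a [b [c [d [b1 c1 d1 ->]]]]].
  exists (cts_conj a), (cts_conj c), (cts_conj b), (cts_conj d); split; last by rewrite pim_adj.
  + by rewrite -[LHS]/(Num.conj (c 1)) c1 conjC0.
  + by rewrite -[LHS]/(Num.conj (b 1)) b1 conjC0.
  + by rewrite -[LHS]/(Num.conj (d 1)) d1 conjC0.
- exact: pim_image_closed.
Qed.

End MatrixCalculus.

(** * Matrix functions generated by Q *)

Section Generation.
Variables (R : realType) (H K1 K4 E : hilbertType R) (D : 'B(E)).
Hypothesis D_ge1 : opos (D - 1).
Let K := spectrum D.
Hypothesis K1_mem : K 1.
Variable V : 'B(H, hsum K1 (hsum K4 (hsum E E))).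
Hypothesis V_unitary : ounitary V.

Lemma opos_sub1_sa : adj D = D.
Proof.
have := opos_sa D_ge1; rewrite adjB adj1 => /(congr1 (fun T => T + 1)).
by rewrite !subrK.
Qed.
Let Dsa := opos_sub1_sa.

Lemma spectrum_ge1 t : K t -> 1 <= complex.Re t.
Proof.
move=> Kt; have : spectrum (D - 1) (t - 1).
  apply/(spectrumP (opos_sa D_ge1)) => bb; move: Kt => /(spectrumP Dsa); apply.
  by move: bb; rewrite scalerBl scale1r opprB addrA subrK.
by move=> /(opos_spectrum D_ge1); rewrite raddfB/= subr_ge0.
Qed.

Let rRe : rcont K (fun z => complex.Re z).
Proof. by apply: rcont_Re; exact: C_on_id. Qed.

Let lsq (z : R[i]) : R := complex.Re z * (complex.Re z - 1).

Let lsq_ge0 t : K t -> 0 <= lsq t.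
Proof. by move=> /spectrum_ge1 t1; rewrite mulr_ge0 ?subr_ge0// (le_trans ler01). Qed.

Let rlsq : rcont K lsq.
Proof. exact: rcont_mul rRe (rcont_add rRe (@rcont_cst _ K (-1))). Qed.

Let rl : rcont K (fun z => Num.sqrt (lsq z)).
Proof. by apply: rcont_comp rlsq; exact: sqrt_continuous. Qed.

Let l : ctsfun K := cts_real rl.

Let l1 : l 1 = 0.
Proof. by rewrite cts_realE /lsq subrr mulr0 sqrtr0. Qed.

Let l_sqr t : K t -> l t * l t = t * (t - 1).
Proof.
move=> Kt; rewrite cts_realE -rmorphM -expr2 sqr_sqrtr ?lsq_ge0//.
by rewrite rmorphM rmorphB/= -(spectrum_real Dsa Kt).
Qed.

Let l_conj t : Num.conj (l t) = l t.
Proof. exact: conj_real. Qed.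

(** [ell D] is only a chosen positive root of D (D - 1); the functional calculus gives another, and
    [osqrt_uniq] identifies them. *)
Lemma ell_cfc : ell D = cfc D l.
Proof.
have [Ssa SS] := cfc_sqrt Dsa rlsq lsq_ge0.
have DD : D * (D - 1) = cfc D l * cfc D l.
  rewrite [RHS]SS -{1 2}(cfc_id (cfcP Dsa)) -[1](cfc_one (cfcP Dsa)).
  rewrite -(cfcB Dsa (@C_on_id _ K) (@C_on_cst _ K 1)).
  have c1 := C_on_sub (@C_on_id _ K) (@C_on_cst _ K 1).
  rewrite -[LHS](cfc_mul (cfcP Dsa) (@C_on_id _ K) c1).
  apply: (cfc_ext' Dsa (C_on_mul (@C_on_id _ K) c1)); first exact/C_on_rcont.
  by move=> t Kt; rewrite /lsq rmorphM rmorphB/= -(spectrum_real Dsa Kt).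
have T0 : opos (D * (D - 1)).
  by rewrite DD SS; apply: (cfc_opos Dsa rlsq); exact: lsq_ge0.
have [S0 SS'] := osqrtP T0.
apply: osqrt_uniq; first exact: S0.
- by apply: (cfc_opos Dsa rl) => t _; exact: sqrtr_ge0.
- by rewrite -DD; exact: SS'.
Qed.

Let idc : ctsfun K := cts_id.
Let one : ctsfun K := cts_cst 1.
Let idm1 : ctsfun K := cts_sub idc one.
Let onem : ctsfun K := cts_sub one idc.

Variable Q : 'B(H).
Hypothesis QE : Q = adj V \ob odsum (oid K1) (odsum (0 : 'B(K4))
  (oblock D (- ell D) (ell D) (1 - D))) \ob V.

Let Qpi : Q = pim D V idc (cts_opp l) l onem.
Proof.
rewrite QE; have -> : oblock D (- ell D) (ell D) (1 - D) =
    oblock (cfc D idc) (cfc D (cts_opp l)) (cfc D l) (cfc D onem).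
  have eN : - ell D = cfc D (cts_opp l).
    rewrite ell_cfc -scaleN1r -(cfc_scale (cfcP Dsa) (-1) (ctsP l)).
    by congr (cfc D _); apply/funext => z; exact: mulN1r.
  have e1 : 1 - D = cfc D onem.
    rewrite [RHS](cfcB Dsa (@C_on_cst _ K 1) (@C_on_id _ K)).
    by rewrite (cfc_one (cfcP Dsa)) (cfc_id (cfcP Dsa)).
  by rewrite -eN -e1 -ell_cfc [cfc D idc](cfc_id (cfcP Dsa)).
by rewrite /pim /blk cts_idE scale1r.
Qed.

Lemma generator_pim : pim_image D V Q.
Proof.
exists idc, (cts_opp l), l, onem; split=> //.
- by rewrite cts_oppE l1 oppr0.
- by rewrite cts_subE subrr.
Qed.

Let adjQ : adj Q = pim D V idc l (cts_opp l) onem.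
Proof.
rewrite Qpi (pim_adj Dsa); apply: (pim_ext Dsa K1_mem) => t Kt; rewrite !ctsE.
- exact: (spectrum_conj Dsa Kt).
- exact: conj_real.
- by rewrite rmorphN/= conj_real.
- by rewrite rmorphB rmorph1/= (spectrum_conj Dsa Kt).
Qed.

Variable B : set 'B(H).
Hypothesis B_cstar : is_cstar_subalgebra B.
Hypothesis BQ : B Q.

Let B_sub S T : B S -> B T -> B (S - T).
Proof.
move=> BS BT; rewrite -scaleN1r; apply: (cstar_add B_cstar) => //.
exact: (cstar_scale B_cstar).
Qed.

Let BQs : B (adj Q). Proof. exact: (cstar_adj B_cstar). Qed.

(* Let u = (sqrt t, sqrt (t - 1)) and v = (sqrt t, - sqrt (t - 1)), so that Q
   corresponds to u v^T; then q1, q2, q3 and q4 of g correspond to g u v^T,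
   g v u^T, g u u^T and g v v^T. *)
Let q1 (g : ctsfun K) :=
  pim D V (cts_mul g idc) (cts_opp (cts_mul g l)) (cts_mul g l) (cts_mul g onem).
Let q2 (g : ctsfun K) :=
  pim D V (cts_mul g idc) (cts_mul g l) (cts_opp (cts_mul g l)) (cts_mul g onem).
Let q3 (g : ctsfun K) :=
  pim D V (cts_mul g idc) (cts_mul g l) (cts_mul g l) (cts_mul g idm1).
Let q4 (g : ctsfun K) :=
  pim D V (cts_mul g idc) (cts_opp (cts_mul g l)) (cts_opp (cts_mul g l)) (cts_mul g idm1).

Let q1_ext (f g : ctsfun K) : (forall t, K t -> f t = g t) -> q1 f = q1 g.
Proof. by move=> fg; apply: (pim_ext Dsa K1_mem) => t Kt; rewrite !ctsE fg. Qed.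

(* w = 2 t - 1 = u^T u = v^T v, which is at least 1 on the spectrum. *)
Let wr (z : R[i]) : R := 2 * complex.Re z + - 1.
Let rwr : rcont K wr.
Proof. exact: rcont_add (rcont_mul (@rcont_cst _ K 2) rRe) (@rcont_cst _ K (-1)). Qed.
Let wr_ge1 t : K t -> 1 <= wr t.
Proof. by move=> /spectrum_ge1; rewrite /wr; lra. Qed.
Let w : ctsfun K := cts_real rwr.
Let wE t : K t -> w t = 2 * t - 1.
Proof.
move=> Kt; rewrite cts_realE /wr rmorphD rmorphM rmorphN rmorph1/= -(spectrum_real Dsa Kt).
by rewrite -(rmorph_nat (real_complex R)).
Qed.
Let winv : ctsfun K := cts_real (rcont_inv ltr01 wr_ge1 rwr).
Let winvE t : K t -> winv t * (2 * t - 1) = 1.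
Proof.
move=> Kt; rewrite -wE// !cts_realE -rmorphM mulVf ?rmorph1// gt_eqF//.
exact: lt_le_trans ltr01 (wr_ge1 Kt).
Qed.

Ltac entrywise := apply: (pim_ext Dsa K1_mem) => t Kt;
  rewrite !(cts_addE, cts_mulE, cts_oppE, cts_subE, cts_idE, cts_cstE).

Let zero1 g : cts_mul g l 1 = 0.
Proof. by rewrite cts_mulE l1 mulr0. Qed.

(** This is (g u v^T)(v u^T) = g (v^T v) u u^T with v^T v = w; the next two identities are the
    analogous rank-one products. *)
Let q1_adjQ g : q1 g * adj Q = q3 (cts_mul w g).
Proof.
rewrite adjQ /q1 (pim_mul Dsa V_unitary); last by rewrite !cts_oppE zero1 oppr0 mul0r.
by entrywise; have := l_sqr Kt; have := wE Kt; move: (l t) (g t) (w t) => L G W -> LL; ring: LL.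
Qed.

Let q3_Q g : q3 g * Q = q1 (cts_mul w g).
Proof.
rewrite [in LHS]Qpi /q3 (pim_mul Dsa V_unitary); last by rewrite zero1 mul0r.
by entrywise; have := l_sqr Kt; have := wE Kt; move: (l t) (g t) (w t) => L G W -> LL; ring: LL.
Qed.

Let q2_Q g : q2 g * Q = q4 (cts_mul w g).
Proof.
rewrite [in LHS]Qpi /q2 (pim_mul Dsa V_unitary); last by rewrite zero1 mul0r.
by entrywise; have := l_sqr Kt; have := wE Kt; move: (l t) (g t) (w t) => L G W -> LL; ring: LL.
Qed.

Let q1_add f g : q1 (cts_add f g) = q1 f + q1 g.
Proof. by rewrite /q1 (pim_add Dsa); entrywise; ring. Qed.

Let q1_scale a g : q1 (cts_mul (cts_cst a) g) = a *: q1 g.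
Proof. by rewrite /q1 (pim_scale Dsa); entrywise; ring. Qed.

Let Kc : compact K := spectrum_compact Dsa.

Let B_lim (T : 'B(H)) : (forall e : R, 0 < e -> exists2 S, B S & nr (T - S) <= e) -> B T.
Proof.
move=> BT; apply: (proj1 (closedP _) (cstar_closed B_cstar)) => e e0.
have [S BS TS] := BT (e / 2) (divr_gt0 e0 (ltr0Sn _ 1)); exists S => //.
by apply: le_lt_trans TS _; lra.
Qed.

Let q1_lim (f : ctsfun K) : (forall e : R, 0 < e -> exists2 g : ctsfun K, B (q1 g) &
  forall t, K t -> nr (f t - g t) <= e) -> B (q1 f).
Proof.
move=> fl; apply: B_lim => e e0.
have [M1 M10 idM] := C_on_bounded Kc (ctsP idc).
have [M2 M20 lM] := C_on_bounded Kc (ctsP l).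
have [M3 M30 oM] := C_on_bounded Kc (ctsP onem).
pose M := M1 + M2 + M3; have M0 : 0 < M by rewrite !addr_gt0.
(* [M] bounds every entry of the matrix of [Q], and 5 is the constant of [pim_norm_le]. *)
have d0 : 0 < e / (5 * M) by rewrite divr_gt0// mulr_gt0.
have [g Bg fg] := fl _ d0; exists (q1 g) => //.
have bnd (k : ctsfun K) : (forall t, K t -> nr (k t) <= M) -> forall t, K t ->
    nr (f t * k t - g t * k t) <= e / (5 * M) * M.
  move=> kM t Kt; rewrite -mulrBl nrM; apply: ler_pM; rewrite ?nr_ge0//; [exact: fg|exact: kM].
have b1 := bnd idc (fun t Kt => le_trans (idM t Kt) (ltac:(rewrite /M; lra) : M1 <= M)).
have b2 := bnd l (fun t Kt => le_trans (lM t Kt) (ltac:(rewrite /M; lra) : M2 <= M)).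
have b3 := bnd onem (fun t Kt => le_trans (oM t Kt) (ltac:(rewrite /M; lra) : M3 <= M)).
rewrite /q1 (pim_sub Dsa K1_mem).
apply: le_trans (_ : _ <= 5 * (e / (5 * M) * M)) _; last first.
  by rewrite le_eqVlt; apply/orP; left; apply/eqP; field; rewrite gt_eqF.
apply: (pim_norm_le Dsa K1_mem V_unitary) => [|t Kt|t Kt|t Kt|t Kt].
- by rewrite mulr_ge0// ltW.
- exact: b1.
- by rewrite cts_subE !cts_oppE -opprD nrN; exact: b2.
- exact: b2.
- exact: b3.
Qed.

(* The h such that q1 (h g) is in B whenever q1 g is form a closed algebra; it
   contains w^2, which separates the points of [1, +oo), as w^2 u v^T =
   u v^T v u^T u v^T. *)
Let multiplier (h : R[i] -> R) (ch : rcont K h) g : B (q1 g) ->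
  B (q1 (cts_mul (cts_real ch) g)).
Proof.
pose A := [set h : R[i] -> R | exists ch : rcont K h, forall g, B (q1 g) ->
  B (q1 (cts_mul (cts_real ch) g))].
suff [ch' Ah] : A h.
  by move=> /Ah; congr (B _); apply: q1_ext => t _; rewrite !cts_mulE !cts_realE.
apply: (stone_weierstrass Kc) ch => //.
- by move=> k [].
- move=> c; exists (@rcont_cst _ K c) => f Bf.
  by have := cstar_scale B_cstar c%:C%C Bf; rewrite -q1_scale.
- move=> h1 h2 [c1 A1] [c2 A2]; exists (rcont_add c1 c2) => f Bf.
  have := cstar_add B_cstar (A1 f Bf) (A2 f Bf); rewrite -q1_add; congr (B _).
  by apply: q1_ext => t _; rewrite cts_addE !cts_mulE !cts_realE rmorphD mulrDl.
- move=> h1 h2 [c1 A1] [c2 A2]; exists (rcont_mul c1 c2) => f Bf.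
  have := A1 _ (A2 f Bf); congr (B _).
  by apply: q1_ext => t _; rewrite !cts_mulE !cts_realE rmorphM mulrA.
- move=> k kl.
  have ck : rcont K k by apply: rcont_lim => e e0; have [k' [ck' _] kk'] := kl e e0; exists k'.
  exists ck => f Bf; apply: q1_lim => e e0.
  have [M M0 fM] := C_on_bounded Kc (ctsP f).
  have [k' [ck' Ak'] kk'] := kl _ (divr_gt0 e0 M0).
  exists (cts_mul (cts_real ck') f); first exact: Ak'.
  move=> t Kt; rewrite !cts_mulE !cts_realE -mulrBl -rmorphB nrM nr_real.
  rewrite -[leRHS](divfK (_ : M != 0)) ?gt_eqF//; apply: ler_pM; rewrite ?nr_ge0//.
    exact: kk'.
  exact: fM.
- move=> x y Kx Ky xy.
  exists (fun z => wr z * wr z); last first.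
    apply: contra xy => /eqP xy; rewrite (spectrum_real Dsa Kx) (spectrum_real Dsa Ky).
    apply/eqP; congr (_%:C%C); have := spectrum_ge1 Kx; have := spectrum_ge1 Ky.
    by move: xy; rewrite /wr; nra.
  exists (rcont_mul rwr rwr) => f Bf.
  have := cstar_mul B_cstar (cstar_mul B_cstar Bf BQs) BQ.
  rewrite -[X in B X]/(q1 f * adj Q * Q) q1_adjQ q3_Q; congr (B _).
  by apply: q1_ext => t _; rewrite !cts_mulE !cts_realE rmorphM mulrA.
Qed.

Let Bq1 g : B (q1 g).
Proof.
have Bone : B (q1 one).
  by move: BQ; rewrite Qpi; congr (B _); entrywise; ring.
have Br := multiplier (rcont_Re (ctsP g)) Bone.
have Bi := multiplier (rcont_Im (ctsP g)) Bone.
have := cstar_add B_cstar Br (cstar_scale B_cstar 'i%C Bi).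
rewrite -q1_scale -q1_add; congr (B _); apply: q1_ext => t _.
by rewrite !(cts_addE, cts_mulE, cts_cstE) !mulr1 -complexE.
Qed.

Let Bq2 g : B (q2 g).
Proof.
have := cstar_adj B_cstar (Bq1 (cts_conj g)); rewrite /q1 (pim_adj Dsa); congr (B _).
apply: (pim_ext Dsa K1_mem) => t Kt;
  rewrite !(cts_addE, cts_mulE, cts_oppE, cts_subE, cts_idE, cts_cstE, cts_conjE);
  rewrite ?rmorphN rmorphM/= conjCK.
- by rewrite (spectrum_conj Dsa Kt).
- by rewrite l_conj.
- by rewrite l_conj.
- by rewrite rmorphB rmorph1/= (spectrum_conj Dsa Kt).
Qed.

Let wwinv t g : K t -> w t * (winv t * g) = g.
Proof. by move=> Kt; rewrite mulrA [w t * _]mulrC wE// winvE// mul1r. Qed.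

(** Multiplying by [adj Q] introduces the factor [w], which is compensated in advance by [winv]. *)
Let Bq3 g : B (q3 g).
Proof.
have := cstar_mul B_cstar (Bq1 (cts_mul winv g)) BQs.
rewrite -[X in B X]/(q1 _ * adj Q) q1_adjQ; congr (B _).
by entrywise; rewrite wwinv.
Qed.

Let Bq4 g : B (q4 g).
Proof.
have := cstar_mul B_cstar (Bq2 (cts_mul winv g)) BQ.
rewrite -[X in B X]/(q2 _ * Q) q2_Q; congr (B _).
by entrywise; rewrite wwinv.
Qed.

Let zero : ctsfun K := cts_cst 0.
Let four : ctsfun K := cts_cst 4.

(** As u + v = (2 sqrt t, 0) and u - v = (0, 2 sqrt (t - 1)), the four products of u + v and u - v
    with their transposes are multiples of matrix units; here (u + v)(u + v)^T = 4 t e_11, and the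
    next three lemmas treat the others. *)
Let B11 g : B (pim D V (cts_mul (cts_mul four idc) g) zero zero zero).
Proof.
have := cstar_add B_cstar (cstar_add B_cstar (Bq3 g) (Bq4 g)) (cstar_add B_cstar (Bq1 g) (Bq2 g)).
rewrite /q1 /q2 /q3 /q4 !(pim_add Dsa); congr (B _).
by entrywise; ring.
Qed.

Let B12 g : B (pim D V zero (cts_mul (cts_mul four l) g) zero zero).
Proof.
have := cstar_add B_cstar (B_sub (Bq3 g) (Bq4 g)) (B_sub (Bq2 g) (Bq1 g)).
rewrite /q1 /q2 /q3 /q4 !(pim_sub Dsa K1_mem) !(pim_add Dsa); congr (B _).
by entrywise; ring.
Qed.

Let B21 g : B (pim D V zero zero (cts_mul (cts_mul four l) g) zero).
Proof.
have := cstar_add B_cstar (B_sub (Bq3 g) (Bq4 g)) (B_sub (Bq1 g) (Bq2 g)).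
rewrite /q1 /q2 /q3 /q4 !(pim_sub Dsa K1_mem) !(pim_add Dsa); congr (B _).
by entrywise; ring.
Qed.

Let B22 g : B (pim D V zero zero zero (cts_mul (cts_mul four idm1) g)).
Proof.
have := B_sub (cstar_add B_cstar (Bq3 g) (Bq4 g)) (cstar_add B_cstar (Bq1 g) (Bq2 g)).
rewrite /q1 /q2 /q3 /q4 !(pim_add Dsa) !(pim_sub Dsa K1_mem); congr (B _).
by entrywise; ring.
Qed.

(* f is the uniform limit of h (f / (h + s)) as s tends to 0. *)
Let approx (f : ctsfun K) (h : R[i] -> R) (ch : rcont K h) : f 1 = 0 ->
  (forall t, K t -> 0 <= h t) ->
  (forall d : R, 0 < d -> exists2 k : R, 0 < k & forall t, K t -> d <= nr (t - 1) -> k <= h t) ->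
  forall e : R, 0 < e -> exists g : ctsfun K, forall t, K t ->
    nr (f t - cts_mul (cts_real ch) g t) <= e.
Proof.
move=> f1 h0 hlow e e0.
have [M M0 fM] := C_on_bounded Kc (ctsP f).
have [d d0 fd] := proj1 (C_onP _ _) (ctsP f) 1 K1_mem e e0.
have [k k0 kh] := hlow d d0.
(* The error is |f| s / (h + s). Within [d] of 1 it is at most |f| < e; elsewhere h >= k, so it is
   at most M s / k = e. *)
pose s := e * k / M; have s0 : 0 < s by rewrite divr_gt0// mulr_gt0.
have sh t : K t -> s <= h t + s by move=> /h0; rewrite lerDr.
have cinv := rcont_inv s0 sh (rcont_add ch (@rcont_cst _ K s)).
exists (cts_mul (cts_real cinv) f) => t Kt.
have hs0 : 0 < h t + s by apply: lt_le_trans (sh t Kt).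
have -> : f t - cts_mul (cts_real ch) (cts_mul (cts_real cinv) f) t = (s / (h t + s))%:C%C * f t.
  rewrite !cts_mulE !cts_realE mulrA -{1}[f t]mul1r -mulrBl; congr (_ * _).
  rewrite -rmorphM -[1](rmorph1 (real_complex R)) -rmorphB; congr (_%:C%C).
  by field; rewrite gt_eqF.
have q0 : 0 <= s / (h t + s) by rewrite divr_ge0// ltW.
rewrite nrM nr_real ger0_norm//.
have [tin|tout] := ltP (nr (t - 1)) d.
  have : nr (f t) < e by have := fd t Kt tin; rewrite [f 1]f1 subr0.
  move=> /ltW fe; rewrite -[leRHS]mul1r; apply: ler_pM; rewrite ?nr_ge0//.
  by rewrite ler_pdivrMr// mul1r lerDr h0.
have kt := kh t Kt tout.
apply: le_trans (_ : s / (h t + s) * M <= _); first by rewrite ler_wpM2l// fM.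
rewrite mulrAC ler_pdivrMr// /s divfK ?gt_eqF//.
by rewrite ler_wpM2l ?(ltW e0)// (le_trans kt)// lerDl -/s ltW.
Qed.

Let spectrum_dist t : K t -> nr (t - 1) = complex.Re t - 1.
Proof.
move=> Kt; rewrite {1}(spectrum_real Dsa Kt) -[1 in LHS](rmorph1 (real_complex R)) -rmorphB nr_real.
by rewrite ger0_norm// subr_ge0 spectrum_ge1.
Qed.

(** Since t >= 1 on the spectrum, t (t - 1) >= t - 1 >= d. *)
Let lower_l (d : R) : 0 < d -> exists2 k : R, 0 < k & forall t, K t -> d <= nr (t - 1) ->
  k <= 4 * Num.sqrt (lsq t).
Proof.
move=> d0; exists (4 * Num.sqrt d) => [|t Kt]; first by rewrite mulr_gt0// sqrtr_gt0.
rewrite spectrum_dist// => dt; rewrite ler_pM2l// ler_wsqrtr//.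
by apply: le_trans dt _; rewrite /lsq; have := spectrum_ge1 Kt; nra.
Qed.

Let lower_idm1 (d : R) : 0 < d -> exists2 k : R, 0 < k & forall t, K t -> d <= nr (t - 1) ->
  k <= 4 * (complex.Re t + - 1).
Proof.
move=> d0; exists (4 * d) => [|t Kt]; first by rewrite mulr_gt0.
by rewrite spectrum_dist// => dt; rewrite ler_pM2l.
Qed.

Let nr_single (a b c d : ctsfun K) (a' b' c' d' : ctsfun K) (e : R) : 0 <= e ->
  (forall t, K t -> nr (a t - a' t) <= e) -> (forall t, K t -> nr (b t - b' t) <= e) ->
  (forall t, K t -> nr (c t - c' t) <= e) -> (forall t, K t -> nr (d t - d' t) <= e) ->
  nr (pim D V a b c d - pim D V a' b' c' d') <= 5 * e.
Proof.
move=> e0 ha hb hc hd; rewrite (pim_sub Dsa K1_mem).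
exact: (pim_norm_le Dsa K1_mem V_unitary).
Qed.

Lemma pim_generated (a b c d : ctsfun K) : b 1 = 0 -> c 1 = 0 -> d 1 = 0 ->
  B (pim D V a b c d).
Proof.
move=> b1 c1 d1.
have rl4 : rcont K (fun z => 4 * Num.sqrt (lsq z)) := rcont_mul (@rcont_cst _ K 4) rl.
have ri4 : rcont K (fun z => 4 * (complex.Re z + - 1)) :=
  rcont_mul (@rcont_cst _ K 4) (rcont_add rRe (@rcont_cst _ K (-1))).
have l4_ge0 t : K t -> 0 <= 4 * Num.sqrt (lsq t) by move=> _; rewrite mulr_ge0// sqrtr_ge0.
have i4_ge0 t : K t -> 0 <= 4 * (complex.Re t + - 1).
  by move=> Kt; rewrite mulr_ge0// subr_ge0 spectrum_ge1.
have z0 (e : R) : 0 < e -> forall t : R[i], K t -> nr (zero t - zero t) <= e.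
  by move=> e0 t _; rewrite subrr nr0 ltW.
(* No approximation here: [t] is at least 1 on the spectrum, so [a] is exactly 4 t times a / (4 t),
   and a(1) is arbitrary. *)
have Ba : B (pim D V a zero zero zero).
  have := B11 (cts_mul (cts_real (rcont_inv ltr01 spectrum_ge1 rRe)) (cts_mul (cts_cst 4^-1) a)).
  congr (B _); entrywise => //.
  rewrite cts_realE fmorphV/= -(spectrum_real Dsa Kt); field.
  have := spectrum_ge1 Kt; apply: contraTneq => ->; rewrite -ltNge; exact: ltr01.
have Bb : B (pim D V zero b zero zero).
  apply: B_lim => e e0; have e50 : 0 < e / 5 by rewrite divr_gt0.
  have [g bg] := approx rl4 b1 l4_ge0 lower_l e50.
  exists (pim D V zero (cts_mul (cts_real rl4) g) zero zero).
    have := B12 g; congr (B _); entrywise => //.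
    by rewrite !cts_realE rmorphM/= -(rmorph_nat (real_complex R)).
  have -> : e = 5 * (e / 5) by field.
  by apply: nr_single (ltW e50) (z0 _ e50) bg (z0 _ e50) (z0 _ e50).
have Bc : B (pim D V zero zero c zero).
  apply: B_lim => e e0; have e50 : 0 < e / 5 by rewrite divr_gt0.
  have [g cg] := approx rl4 c1 l4_ge0 lower_l e50.
  exists (pim D V zero zero (cts_mul (cts_real rl4) g) zero).
    have := B21 g; congr (B _); entrywise => //.
    by rewrite !cts_realE rmorphM/= -(rmorph_nat (real_complex R)).
  have -> : e = 5 * (e / 5) by field.
  by apply: nr_single (ltW e50) (z0 _ e50) (z0 _ e50) cg (z0 _ e50).
have Bd : B (pim D V zero zero zero d).
  apply: B_lim => e e0; have e50 : 0 < e / 5 by rewrite divr_gt0.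
  have [g dg] := approx ri4 d1 i4_ge0 lower_idm1 e50.
  exists (pim D V zero zero zero (cts_mul (cts_real ri4) g)).
    have := B22 g; congr (B _); entrywise => //.
    rewrite !cts_realE rmorphM rmorphB rmorph1/= -(rmorph_nat (real_complex R)).
    by rewrite -(spectrum_real Dsa Kt).
  have -> : e = 5 * (e / 5) by field.
  by apply: nr_single (ltW e50) (z0 _ e50) (z0 _ e50) (z0 _ e50) dg.
have := cstar_add B_cstar (cstar_add B_cstar Ba Bb) (cstar_add B_cstar Bc Bd).
rewrite !(pim_add Dsa); congr (B _); entrywise; ring.
Qed.

End Generation.

(** * Passage from the decomposition over H5 and H6 to the unitary V_Q *)

Lemma oblock_twist (R : realType) (K5 K6 : hilbertType R) (U : 'B(K5, K6)) (D L : 'B(K5)) :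
  adj U \ob U = oid K5 ->
  odsum (oid K5) (adj U) \ob
    oblock D (- (L \ob adj U)) (U \ob L) (U \ob (oid K5 - D) \ob adj U) \ob
    odsum (oid K5) U = oblock D (- L) L (oid K5 - D).
Proof.
move=> UU; have UUx x : adj U (U x) = x by rewrite -ocompE UU.
rewrite /odsum !oblock_comp; congr oblock; apply: bop_ext => x;
  rewrite !(bopDE, ocompE, bop0E, bop0, bopD, bopNE, bopN, UUx) ?addr0 ?add0r ?oppr0 //.
exact: addr0.
Qed.

(** Identifying H6 with H5 through U^* removes [U] from the canonical form, so that every entry of
    the matrix of [Q] becomes a function of [D]. *)
Lemma odsum_twist (R : realType) (K1 K4 K5 K6 : hilbertType R) (U : 'B(K5, K6)) (D L : 'B(K5)) :
  adj U \ob U = oid K5 ->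
  let W := odsum (oid K1) (odsum (oid K4) (odsum (oid K5) (adj U))) in
  W \ob odsum (oid K1) (odsum (0 : 'B(K4)) (oblock
    D (- (L \ob adj U)) (U \ob L) (U \ob (oid K5 - D) \ob adj U))) \ob adj W =
  odsum (oid K1) (odsum (0 : 'B(K4)) (oblock D (- L) L (oid K5 - D))).
Proof.
move=> UU W; have -> : adj W = odsum (oid _) (odsum (oid _) (odsum (oid _) U)).
  by rewrite !adj_odsum !adj_oid adjK.
rewrite /W (odsum_comp (oid K1)) (odsum_comp (oid K4)) (odsum_comp (_ \ob _)).
rewrite (odsum_comp (_ \ob _)) !ocompo1 !ocomp1o oblock_twist//.
Qed.

Lemma unitary_conj (R : realType) (H K L : hilbertType R) (W : 'B(K, L)) (Z : 'B(H, K))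
    (Q : 'B(H)) (M : 'B(K)) (N : 'B(L)) : adj W \ob W = oid K -> adj Z \ob Z = oid H ->
  Z \ob Q \ob adj Z = M -> W \ob M \ob adj W = N ->
  Q = adj (W \ob Z) \ob N \ob (W \ob Z).
Proof.
move=> WW ZZ <- <-; apply: bop_ext => x.
have WWx y : adj W (W y) = y by rewrite -ocompE WW.
have ZZx y : adj Z (Z y) = y by rewrite -ocompE ZZ.
by rewrite adj_comp !ocompE !(WWx, ZZx).
Qed.

Lemma cstar_gen_JD (R : realType) (H K1 K4 E : hilbertType R) (D : 'B(E))
    (V : 'B(H, hsum K1 (hsum K4 (hsum E E)))) (Q : 'B(H)) :
  opos (D - 1) -> spectrum D 1 -> ounitary V ->
  Q = adj V \ob odsum (oid K1) (odsum (0 : 'B(K4)) (oblock D (- ell D) (ell D) (1 - D))) \ob V ->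
  cstar_gen Q = [set T : 'B(H) | exists f : 'M[R[i]^o -> R[i]^o]_2, JD D f /\
    T = adj V \ob odsum (f 0 0 1 *: oid K1) (odsum (0 : 'B(K4)) (cfc_mx D f)) \ob V].
Proof.
move=> D_ge1 h1 Vu QE; have Dsa := opos_sub1_sa D_ge1.
apply/seteqP; split=> [T genT|_ [f [[cf [f01 f10 f11]] ->]]]; last first.
  move=> B [Bc BQ].
  exact: (pim_generated D_ge1 h1 Vu QE Bc (BQ _ erefl) (cts (cf 0 0))
    (b := cts (cf 0 1)) (c := cts (cf 1 0)) (d := cts (cf 1 1)) f01 f10 f11).
have [a [b [c [d [b1 c1 d1 ->]]]]] : pim_image D V T.
  apply: genT; split; first exact: (pim_image_cstar Dsa h1 Vu).
  by move=> _ ->; exact: (generator_pim D_ge1 QE).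
exists (\matrix_(i, j) if i == 0 then (if j == 0 then sval a else sval b)
                       else (if j == 0 then sval c else sval d)); split.
  split; last by rewrite !mxE.
  by move=> i j; rewrite mxE; case: (i == 0); case: (j == 0); exact: ctsP.
by rewrite /cfc_mx !mxE.
Qed.

Theorem theorem3p8 (R : realType) (H : hilbertType R)
    (H_neq0 : exists x : H, x != 0)
    (Q : 'B(H)) (hQ : non_projection_idempotent Q)
    (H1 H4 H5 H6 : closed_subspace H)
    (U : 'B(csub H5, csub H6)) (D : 'B(csub H5))
    (hD : canonical_decomposition H1 H4 Q U D)
    (h1 : spectrum D 1) :
  cstar_gen Q =
  [set T : 'B(H) | exists f : 'M[R[i]^o -> R[i]^o]_2, JD D f /\
     T = adj (Vmap H1 H4 U) \ob
         odsum (f 0 0 1 *: oid (csub H1))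
               (odsum (0 : 'B(csub H4)) (cfc_mx D f)) \ob
         Vmap H1 H4 U].
Proof.
have QQ : Q * Q = Q := proj1 hQ.
have [A A0 [msa mm Am twoQm kerA]] := matched_projection_spec QQ.
have Uu := cd_U hD; have D_ge1 : opos (D - 1) := cd_D_ge1 hD.
have Zu := Umap_unitary QQ A0 msa mm Am twoQm kerA (cd_H1 hD) (cd_H4 hD) (cd_H5 hD) (cd_H6 hD).
pose W := odsum (oid (csub H1)) (odsum (oid (csub H4)) (odsum (oid (csub H5)) (adj U))).
have Wu : ounitary W.
  apply: ounitary_odsum (ounitary_oid _) _.
  apply: ounitary_odsum (ounitary_oid _) _.
  exact: ounitary_odsum (ounitary_oid _) (ounitary_adj Uu).
(* [Vmap] unfolds to [W \ob Umap], so it is unitary as a composite. *)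
pose V := Vmap H1 H4 U; have Vu : ounitary V := ounitary_comp Wu Zu.
have QE : Q = adj V \ob odsum (oid (csub H1)) (odsum (0 : 'B(csub H4))
    (oblock D (- ell D) (ell D) (1 - D))) \ob V.
  refine (unitary_conj (proj1 Wu) (proj1 Zu) (cd_Q hD) _).
  exact (odsum_twist _ _ D (ell D) (proj1 Uu)).
exact: (cstar_gen_JD D_ge1 h1 Vu QE).
Qed.
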